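(* Let $(\mathcal X,d,m,L)$ be a graph space as in the context, and let $\nu_0,\nu_1$ be probability measures on $\mathcal X$ with finite support. Assume: (a) there is $S\ge1$ with $\sup_{x\in\mathcal X}|L(x,x)|\le S$; (b) there is $I\in(0,1]$ with $\inf_{x\sim y}L(x,y)\ge I$; (c) for every $x\in\mathcal X$ there is $\gamma_o\in(0,1]$ with $\sum_{y\in\mathcal X}\gamma_o^{d(x,y)}<\infty$. Let $(\gamma_\ell)_{\ell\in\mathbb N}$ be a sequence of positive numbers converging to $0$, and let $\widehat Q_t$ be the weak limit of $(\widehat Q_t^{\gamma_\ell})_\ell$. Then for every $t\in(0,1)$, $$\liminf_{\gamma_\ell\to0}\varphi''_{\gamma_\ell}(t)\ \ge\ \int\Big[\Big(\sum_{z'\in V_\leftarrow(z)}A_t(z,z')L(z,z')\Big)^2+\sum_{z'\in V_\leftarrow(z),\,z''\in\mathbb V_\leftarrow(z),\,z'\sim z''}\rho\big(A_t(z,z'),\mathbb A_t(z,z'')\big)L(z',z'')L(z,z')\Big]d\widehat Q_t(z)$$ $$=\int\Big[\Big(\sum_{z'\in V(z)}A_t(z,z')L(z,z')\Big)^2+\sum_{z'\in V(z),\,z''\in\mathbb V(z),\,z'\sim z''}\rho\big(A_t(z,z'),\mathbb A_t(z,z'')\big)L(z',z'')L(z,z')\Big]d\widehat Q_t(z),$$ and $$\liminf_{\gamma_\ell\to0}\psi''_{\gamma_\ell}(t)\ \ge\ \int\Big[\Big(\sum_{z'\in V_\rightarrow(z)}B_t(z,z')L(z,z')\Big)^2+\sum_{z'\in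 V_\rightarrow(z),\,z''\in\mathbb V_\rightarrow(z),\,z'\sim z''}\rho\big(B_t(z,z'),\mathbb B_t(z,z'')\big)L(z',z'')L(z,z')\Big]d\widehat Q_t(z)$$ $$=\int\Big[\Big(\sum_{z'\in V(z)}B_t(z,z')L(z,z')\Big)^2+\sum_{z'\in V(z),\,z''\in\mathbb V(z),\,z'\sim z''}\rho\big(B_t(z,z'),\mathbb B_t(z,z'')\big)L(z',z'')L(z,z')\Big]d\widehat Q_t(z).$$
   Context: Graph space. $\mathcal X$ is the countable vertex set of a connected undirected graph with uniformly bounded degrees ($\sup_xd_x=d_{\max}<\infty$); $x\sim y$ means neighbours; $d$ is the graph distance. $m$ is a measure on $\mathcal X$ with $m(x)>0$ for all $x$, reversible for a generator $L$: $m(x)L(x,y)=m(y)L(y,x)$, where for $x\ne y$, $L(x,y)>0$ if $x\sim y$ and $L(x,y)=0$ otherwise, and $L(x,x)=-\sum_{y\ne x}L(x,y)$. $L^k$ is the $k$-th matrix power ($L^0$ the identity). $P_t^\gamma=e^{\gamma tL}$ and $P_t^\gamma f(x)=\sum_yP_t^\gamma(x,y)f(y)$. Schrödinger bridges. For $\gamma>0$, let $f^\gamma,g^\gamma\ge0$ on $\mathcal X$ solve $f^\gamma(x)P_1^\gamma g^\gamma(x)=\nu_0(x)/m(x)$ and $g^\gamma(y)P_1^\gamma f^\gamma(y)=\nu_1(y)/m(y)$ for all $x,y$ (existence, and uniqueness up to $(f,g)\mapsto(cf,g/c)$, are known). Set $\widehat Q_t^\gamma(z)=m(z)\,P_t^\gamma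 f^\gamma(z)\,P_{1-t}^\gamma g^\gamma(z)$ and $\widehat\pi^\gamma(x,y)=m(x)P_1^\gamma(x,y)f^\gamma(x)g^\gamma(y)$, a coupling of $\nu_0,\nu_1$. It is known (Léonard) that as $\gamma\to0$, $\widehat\pi^\gamma$ converges to a coupling $\widehat\pi$ of $\nu_0,\nu_1$ minimizing $\iint d\,d\pi$ among couplings, and $\widehat Q^\gamma_t$ converges weakly to $\widehat Q_t=\sum_{x,y}Q_t^{x,y}\widehat\pi(x,y)$, where $$Q_t^{x,y}(z)=\mathbf 1_{[x,y]}(z)\,r(x,z,z,y)\,\rho_t^{d(x,y)}(d(x,z)),\quad r(x,z,v,y)=\frac{L^{d(x,z)}(x,z)L^{d(v,y)}(v,y)}{L^{d(x,y)}(x,y)},\quad \rho_t^d(k)=\binom dkt^k(1-t)^{d-k}.$$ Here $[x,y]$ is the set of points on discrete geodesics from $x$ to $y$; and for two points $z,w$, ''$(z,w)\in[x,y]$'' means that some discrete geodesic $(z_0=x,\dots,z_{d(x,y)}=y)$ has $z=z_i$, $w=z_j$ with $i<j$. Kernels: $\widehat\pi_\rightarrow(w|x)=\widehat\pi(x,w)/\nu_0(x)$ for $x\in\mathrm{supp}(\nu_0)$, $\widehat\pi_\leftarrow(w|y)=\widehat\pi(w,y)/\nu_1(y)$ for $y\in\mathrm{supp}(\nu_1)$. Functions (for $\gamma$ sufficiently small): $\varphi_\gamma(t)=\int\log(P_t^\gamma f^\gamma)\,P_t^\gamma f^\gamma\,P_{1-t}^\gamma g^\gamma\,dm$ and $\psi_\gamma(t)=\int\log(P_{1-t}^\gamma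 g^\gamma)\,P_{1-t}^\gamma g^\gamma\,P_t^\gamma f^\gamma\,dm$. For $a,b>0$, $\rho(a,b)=(\log b-2\log a-1)\,b$, and $\rho(a,b)=0$ if $a=0$ or $b=0$. Sets. $\widehat Z=\mathrm{supp}(\widehat Q_t)=\bigcup_{(x,y)\in\mathrm{supp}(\widehat\pi)}[x,y]$ for $t\in(0,1)$. $V(z)=\{z':z'\sim z\}$, $\mathbb V(z)=\{z'':d(z,z'')=2\}$. $C_\rightarrow=\{(z,w):z\ne w,\ \exists(x,y)\in\mathrm{supp}(\widehat\pi),\ (z,w)\in[x,y]\}$, $C_\leftarrow=\{(z,w):(w,z)\in C_\rightarrow\}$. $V_\rightarrow(z)=\{z'\in V(z):(z,z')\in C_\rightarrow\}$, $V_\leftarrow(z)=\{z'\in V(z):(z,z')\in C_\leftarrow\}$, and $\mathbb V_\rightarrow(z),\mathbb V_\leftarrow(z)$ are defined likewise with $\mathbb V(z)$. $\widehat Y_z=\{y\in\mathrm{supp}(\nu_1):\exists x,\ (x,y)\in\mathrm{supp}(\widehat\pi),\ z\in[x,y]\}$, $\widehat X_z=\{x\in\mathrm{supp}(\nu_0):\exists y,\ (x,y)\in\mathrm{supp}(\widehat\pi),\ z\in[x,y]\}$. Coefficients. For $t\in(0,1)$, $z\in\widehat Z$, $y\in\mathrm{supp}(\nu_1)$, $x\in\mathrm{supp}(\nu_0)$, $z'\in V(z)$, $z''\in\mathbb V(z)$: $a_t(z,y)=\sum_wQ_t^{w,y}(z)\widehat\pi_\leftarrow(w|y)$, $\ b_t(z,x)=\sum_wQ_t^{x,w}(z)\widehat\pi_\rightarrow(w|x)$;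 $\mathrm a_t(z,z',y)=\sum_{w:(z,z')\in[y,w]}r(y,z,z',w)\,d(y,w)\,\rho_t^{d(y,w)-1}(d(z,w)-1)\,\widehat\pi_\leftarrow(w|y)$; $\mathrm b_t(z,z',x)=\sum_{w:(z,z')\in[x,w]}r(x,z,z',w)\,d(x,w)\,\rho_t^{d(x,w)-1}(d(x,z))\,\widehat\pi_\rightarrow(w|x)$; $\mathbb a_t(z,z'',y)=\sum_{w:(z,z'')\in[y,w]}r(y,z,z'',w)\,d(y,w)(d(y,w)-1)\,\rho_t^{d(y,w)-2}(d(z,w)-2)\,\widehat\pi_\leftarrow(w|y)$; $\mathbb b_t(z,z'',x)=\sum_{w:(z,z'')\in[x,w]}r(x,z,z'',w)\,d(x,w)(d(x,w)-1)\,\rho_t^{d(x,w)-2}(d(x,z))\,\widehat\pi_\rightarrow(w|x)$. Then $A_t(z,z')=\mathrm a_t(z,z',y)/a_t(z,y)$ and $\mathbb A_t(z,z'')=\mathbb a_t(z,z'',y)/a_t(z,y)$ for any $y\in\widehat Y_z$, and $B_t(z,z')=\mathrm b_t(z,z',x)/b_t(z,x)$ and $\mathbb B_t(z,z'')=\mathbb b_t(z,z'',x)/b_t(z,x)$ for any $x\in\widehat X_z$; the ratios do not depend on the choice of $y$, $x$. They are also the limits $A_t(z,z')=\lim\gamma_\ell\frac{P_t^{\gamma_\ell}f^{\gamma_\ell}(z')}{P_t^{\gamma_\ell}f^{\gamma_\ell}(z)}$, $\mathbb A_t(z,z'')=\lim\gamma_\ell^2\frac{P_t^{\gamma_\ell}f^{\gamma_\ell}(z'')}{P_t^{\gamma_\ell}f^{\gamma_\ell}(z)}$,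 $B_t(z,z')=\lim\gamma_\ell\frac{P_{1-t}^{\gamma_\ell}g^{\gamma_\ell}(z')}{P_{1-t}^{\gamma_\ell}g^{\gamma_\ell}(z)}$, $\mathbb B_t(z,z'')=\lim\gamma_\ell^2\frac{P_{1-t}^{\gamma_\ell}g^{\gamma_\ell}(z'')}{P_{1-t}^{\gamma_\ell}g^{\gamma_\ell}(z)}$. *)

(* Defs.v *)
From HB Require Import structures.
From mathcomp Require Import all_boot all_order all_algebra.
From mathcomp Require Import all_classical all_reals all_analysis.

Set Implicit Arguments.
Unset Strict Implicit.
Unset Printing Implicit Defensive.

Import Order.TTheory GRing.Theory Num.Theory.
Import numFieldNormedType.Exports.

Local Open Scope classical_set_scope.
Local Open Scope ring_scope.

(* Measures on the countable set X are represented by their mass functions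
   X -> R.  The sums \sum_(x \in A) below all have finite support (by local
   finiteness of the graph, or by finiteness of the supports of nu0 and nu1);
   genuinely infinite sums are written with esum. *)

Record graph_space (R : realType) (X : countType) := GraphSpace {
  adj : rel X;
  mass : X -> R;
  gen : X -> X -> R;
  adj_sym : symmetric adj;
  adj_irr : irreflexive adj;
  adj_connected : forall x y, exists2 p : seq X, path adj x p & last x p = y;
  adj_bounded_degree : exists dmax : nat, forall x, ([set y | adj x y] #<= `I_dmax)%card;
  mass_gt0 : forall x, 0 < mass x;
  gen_reversible : forall x y, mass x * gen x y = mass y * gen y x;
  gen_adj : forall x y, adj x y -> 0 < gen x y;
  gen_nadj : forall x y, x != y -> ~~ adj x y -> gen x y = 0;
  gen_diag : forall x, gen x x = - \sum_(y \in [set y | y != x]) gen x y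
}.

Section GraphSpace.
Context (R : realType) (X : countType) (G : graph_space R X).

Local Notation e := (adj G).
Local Notation m := (mass G).
Local Notation L := (gen G).

Definition walk (n : nat) (x y : X) : Prop :=
  exists p : seq X, [/\ path e x p, size p = n & last x p = y].

Lemma walk_exists x y : exists n, `[< walk n x y >].
Proof.
have [p xp py] := adj_connected G x y.
by exists (size p); apply/asboolP; exists p.
Qed.

Definition gdist (x y : X) : nat := ex_minn (walk_exists x y).

Local Notation d := gdist.

(* The geodesic (x = z_0, ..., z_(d x y) = y) is the sequence x :: p. *)
Definition geodesic (x y : X) (p : seq X) : Prop :=
  [/\ path e x p, size p = d x y & last x p = y].

Definition between (x y : X) : set X :=
  [set z | exists2 p, geodesic x y p & z \in x :: p].

Definition between2 (x y z w : X) : Prop :=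
  exists p i j, [/\ geodesic x y p, (i < j <= d x y)%N,
                    z = nth x (x :: p) i & w = nth x (x :: p) j].

Fixpoint genpow (k : nat) (x y : X) : R :=
  if k is k'.+1 then \sum_(z \in [set: X]) L x z * genpow k' z y
  else (x == y)%:R.

(* entries of the matrix exponential e^(s L); P_t^gamma is heat (gamma * t) *)
Definition heat (s : R) (x y : X) : R :=
  limn (series (fun k => s ^+ k / k`!%:R * genpow k x y)).

(* P_t^gamma h for h >= 0, a priori with values in [0, +oo] *)
Definition semigroup (gamma t : R) (h : X -> R) (x : X) : \bar R :=
  (\esum_(y in [set: X]) (heat (gamma * t) x y * h y)%:E)%E.

(* sum over X of a function of arbitrary sign *)
Definition csum (h : X -> R) : R :=
  fine (\esum_(x in [set: X]) (h^\+ x)%:E - \esum_(x in [set: X]) (h^\- x)%:E)%E.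

Definition supp (nu : X -> R) : set X := [set x | 0 < nu x].

Definition finite_probability (nu : X -> R) : Prop :=
  [/\ forall x, 0 <= nu x, finite_set (supp nu) &
      \sum_(x \in [set: X]) nu x = 1].

Definition weak_cvg (mu_ : nat -> X -> R) (mu : X -> R) : Prop :=
  forall h : X -> R, (exists M : R, forall x, `|h x| <= M) ->
    csum (fun x => h x * mu_ l x) @[l --> \oo] --> csum (fun x => h x * mu x).

(* The equations are read in the extended reals: in particular a solution
   satisfies P_1 g < +oo on supp nu0 and P_1 f < +oo on supp nu1. *)
Definition schrodinger_system (nu0 nu1 : X -> R) (gamma : R)
    (f g : X -> R) : Prop :=
  [/\ forall x, 0 <= f x, forall x, 0 <= g x,
      forall x, ((f x)%:E * semigroup gamma 1 g x = (nu0 x / m x)%:E)%E &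
      forall y, ((g y)%:E * semigroup gamma 1 f y = (nu1 y / m y)%:E)%E].

Section Bridge.
Variables (gamma : R) (f g : X -> R).

Let F (t : R) (z : X) : R := fine (semigroup gamma t f z).
Let H (t : R) (z : X) : R := fine (semigroup gamma (1 - t) g z).

Definition bridge_marginal (t : R) (z : X) : R := m z * F t z * H t z.

Definition bridge_coupling (x y : X) : R :=
  m x * heat (gamma * 1) x y * f x * g y.

Definition phi (t : R) : R :=
  csum (fun z => ln (F t z) * F t z * H t z * m z).

Definition psi (t : R) : R :=
  csum (fun z => ln (H t z) * H t z * F t z * m z).

End Bridge.

Definition rratio (x z v y : X) : R :=
  genpow (d x z) x z * genpow (d v y) v y / genpow (d x y) x y.

Definition binmass (t : R) (n k : nat) : R :=
  'C(n, k)%:R * t ^+ k * (1 - t) ^+ (n - k).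

Definition Qxy (t : R) (x y z : X) : R :=
  (if `[< between x y z >] then rratio x z z y * binmass t (d x y) (d x z)
   else 0).

Definition rho (a b : R) : R :=
  if (0 < a) && (0 < b) then (ln b - 2 * ln a - 1) * b else 0.

Section Coefficients.
Variables (nu0 nu1 : X -> R) (pihat : X -> X -> R).

Definition kernel_fwd (w x : X) : R := pihat x w / nu0 x.
Definition kernel_bwd (w y : X) : R := pihat w y / nu1 y.

Definition C_fwd (z w : X) : Prop :=
  z != w /\ exists x y, 0 < pihat x y /\ between2 x y z w.
Definition C_bwd (z w : X) : Prop := C_fwd w z.

Definition V (z : X) : set X := [set z' | e z z'].
Definition VV (z : X) : set X := [set z'' | d z z'' = 2%N].
Definition V_fwd (z : X) : set X := [set z' | V z z' /\ C_fwd z z'].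
Definition V_bwd (z : X) : set X := [set z' | V z z' /\ C_bwd z z'].
Definition VV_fwd (z : X) : set X := [set z'' | VV z z'' /\ C_fwd z z''].
Definition VV_bwd (z : X) : set X := [set z'' | VV z z'' /\ C_bwd z z''].

Definition Yhat (z : X) : set X :=
  [set y | supp nu1 y /\ exists x, 0 < pihat x y /\ between x y z].
Definition Xhat (z : X) : set X :=
  [set x | supp nu0 x /\ exists y, 0 < pihat x y /\ between x y z].

(* a0, a1, a2 are the weights of z, of its neighbours, and of the points at
   distance 2, in the limit of P_t f; b0, b1, b2 likewise for P_(1-t) g.  The
   truncated subtractions are exact: between2 y w z z' forces d z w >= d z z'. *)
Definition a0 (t : R) (z y : X) : R :=
  \sum_(w \in [set: X]) Qxy t w y z * kernel_bwd w y.
Definition b0 (t : R) (z x : X) : R :=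
  \sum_(w \in [set: X]) Qxy t x w z * kernel_fwd w x.

Definition a1 (t : R) (z z' y : X) : R :=
  \sum_(w \in [set w | between2 y w z z'])
    rratio y z z' w * (d y w)%:R *
    binmass t (d y w - 1) (d z w - 1) * kernel_bwd w y.
Definition b1 (t : R) (z z' x : X) : R :=
  \sum_(w \in [set w | between2 x w z z'])
    rratio x z z' w * (d x w)%:R *
    binmass t (d x w - 1) (d x z) * kernel_fwd w x.

Definition a2 (t : R) (z z'' y : X) : R :=
  \sum_(w \in [set w | between2 y w z z''])
    rratio y z z'' w * ((d y w)%:R * ((d y w)%:R - 1)) *
    binmass t (d y w - 2) (d z w - 2) * kernel_bwd w y.
Definition b2 (t : R) (z z'' x : X) : R :=
  \sum_(w \in [set w | between2 x w z z''])
    rratio x z z'' w * ((d x w)%:R * ((d x w)%:R - 1)) *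
    binmass t (d x w - 2) (d x z) * kernel_fwd w x.

(* The ratios defining A1, A2, B1, B2 do not depend on the points of Yhat z
   and Xhat z used to compute them; we select some.  Both sets are nonempty
   for z in the support of the limit bridge, and elsewhere (default value z)
   the coefficients are irrelevant. *)
Definition ysel (z : X) : X := xget z (Yhat z).
Definition xsel (z : X) : X := xget z (Xhat z).

Definition A1 (t : R) (z z' : X) : R := a1 t z z' (ysel z) / a0 t z (ysel z).
Definition A2 (t : R) (z z'' : X) : R := a2 t z z'' (ysel z) / a0 t z (ysel z).
Definition B1 (t : R) (z z' : X) : R := b1 t z z' (xsel z) / b0 t z (xsel z).
Definition B2 (t : R) (z z'' : X) : R := b2 t z z'' (xsel z) / b0 t z (xsel z).

End Coefficients.

(* The integrand at z, with the neighbours z' ranging over W and the points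
   z'' at distance 2 over WW; K1 and K2 are (A1, A2) or (B1, B2) at z. *)
Definition integrand (W WW : set X) (K1 K2 : X -> R) (z : X) : R :=
  (\sum_(z' \in W) K1 z' * L z z') ^+ 2 +
  \sum_(z' \in W) \sum_(z'' \in [set z'' | WW z'' /\ e z' z''])
    rho (K1 z') (K2 z'') * L z' z'' * L z z'.

End GraphSpace.

(* Main.v *)
Require Import Defs.
From HB Require Import structures.
From mathcomp Require Import all_boot all_order all_algebra.
From mathcomp Require Import all_classical all_reals all_analysis.
From mathcomp Require Import zify ring lra.

Set Implicit Arguments.
Unset Strict Implicit.
Unset Printing Implicit Defensive.

Import Order.TTheory GRing.Theory Num.Theory.
Import numFieldNormedType.Exports.

Local Open Scope classical_set_scope.
Local Open Scope ring_scope.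

(** Write F = P_t f and H = P_(1-t) g for the flows of the slowed-down generator
    gamma L; f and g are supported by the finite supports of nu0 and nu1.
    Differentiating phi twice under the sum, and moving L from H to F by
    reversibility, gives
      phi''(t) = sum_z Q(z) E(z),
      E(z) = (sum_v L(z,v) a(v))^2 + sum_(v,w) L(z,v) L(v,w) rho(a(v), b(w)),
    where Q = m F H is the marginal of the bridge at time t,
    a(v) = gamma F(v) / F(z), b(w) = gamma^2 F(w) / F(z), and v, w run over all
    steps of L, including those that stay put (entropy_second_derivative; E is
    called dissipation_rate).  The powers of gamma disappear from rho because b
    is of order two and a of order one.  The inequality for phi is then the
    Fatou lemma for the sum over z, which rests on three facts.

    - Pointwise limits.  The heat kernel at time gamma t between x and y is
      gamma^d(x,y) times a constant, to leading order.  Multiplying F(v) by g(y)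
      for a fixed y turns the unknown f into the coupling of the Schroedinger
      system, which converges; hence a power of gamma times F(v) g(y) converges,
      and its limit is, up to a factor independent of v, one of the coefficients
      a0, a1, a2 at y (source_flow_cvg, a0E, a1E, a2E).  The ratios therefore
      converge to A and AA (source_ratio_cvg).  Moreover rho is lower
      semicontinuous along positive sequences (rho_lowlim), and the pairs (v, w)
      that remain within distance one of z contribute nothing negative in the
      limit (dissipation_rate_lowlim).

    - A lower bound.  Since rho(a, b) >= - a^2, and since F(v) / F(z) is at most
      of order 1 / gamma with a constant that is exponential in the distance of
      z to a base point x0 (heatn_ratio), E(z) >= - C K^(2 d(x0,z)) uniformly in
      gamma (dissipation_rate_ge).

    - Tightness.  Visiting a point z away from the geodesics costs powers of
      gamma: Q(z) <= C gamma^(d(x0,z) - 3D) if the supports lie within distance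
      D of x0 (marginal_bound).  For small gamma this beats K^(2 d(x0,z)), by
      the summability of some gamma_o^d(x0,z).

    The integral over all neighbours equals the one over V_bwd and VV_bwd because
    the coefficients vanish elsewhere, and rho vanishes when one of its arguments
    does (integrand_bwd).  The statement about psi is the one about phi for the
    time-reversed system: t becomes 1 - t, and f and g, nu0 and nu1, and the two
    arguments of the coupling are exchanged. *)

(** * Graph distance and geodesics *)

Section Metric.
Context (R : realType) (X : countType) (G : graph_space R X).
Local Notation e := (adj G).
Local Notation d := (gdist G).

Lemma gdist_walk x y : walk G (d x y) x y.
Proof. by rewrite /gdist; case: ex_minnP => n /asboolP. Qed.

Lemma gdist_le n x y : walk G n x y -> (d x y <= n)%N.
Proof.
by move=> w; rewrite /gdist; case: ex_minnP => k _; apply; apply/asboolP.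
Qed.

Lemma walk_cat n k x y z : walk G n x y -> walk G k y z -> walk G (n + k) x z.
Proof.
move=> [p [xp <- <-]] [q [yq <- <-]]; exists (p ++ q).
by rewrite cat_path xp yq size_cat last_cat.
Qed.

Lemma walk_sym n x y : walk G n x y -> walk G n y x.
Proof.
move=> [p [xp <- <-]]; exists (rev (belast x p)); split.
- by rewrite rev_path (eq_path (e' := e))// => u v; rewrite adj_sym.
- by rewrite size_rev size_belast.
- by case: p xp => //= a p _; rewrite rev_cons last_rcons.
Qed.

Lemma walk_nth x p i j : path e x p -> (i <= j <= size p)%N ->
  walk G (j - i) (nth x (x :: p) i) (nth x (x :: p) j).
Proof.
move=> xp /andP[ij jp].
exists (take (j - i) (drop i p)).
have sz : size (take (j - i) (drop i p)) = (j - i)%N.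
  by rewrite size_takel// size_drop leq_sub2r.
have xi : nth x (x :: p) i = last x (take i p).
  case: i {sz} ij => [|i] ij; first by rewrite take0.
  by rewrite -nth_last size_takel ?(leq_trans ij)//= nth_take.
rewrite xi sz; split => //.
  move: xp; rewrite -{1}(cat_take_drop i p) cat_path => /andP[_ xp].
  by move: xp; rewrite -{1}(cat_take_drop (j - i) (drop i p)) cat_path => /andP[].
rewrite -last_cat -takeD subnKC//.
case: j {xi sz} ij jp => [|j] ij jp; first by rewrite take0.
by rewrite -nth_last size_takel//= nth_take.
Qed.

Lemma gdist_sym x y : d x y = d y x.
Proof.
by apply/eqP; rewrite eqn_leq !gdist_le//; apply: walk_sym; exact: gdist_walk.
Qed.

Lemma gdist_triangle y x z : (d x z <= d x y + d y z)%N.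
Proof. by apply: gdist_le; apply: walk_cat; exact: gdist_walk. Qed.

Lemma gdistxx x : d x x = 0%N.
Proof. by apply/eqP; rewrite -leqn0 gdist_le//; exists [::]. Qed.

Lemma gdist_eq0 x y : (d x y == 0%N) = (x == y).
Proof.
apply/eqP/eqP => [|->]; last exact: gdistxx.
move=> d0; have [p [_ + <-]] := gdist_walk x y.
by rewrite d0; case: p.
Qed.

Lemma gdist_eq1 x y : (d x y == 1%N) = e x y.
Proof.
apply/eqP/idP => [dxy|exy].
  have [p [+ + <-]] := gdist_walk x y.
  by rewrite dxy; case: p => [//|a [|//]]/=; rewrite andbT.
apply/eqP; rewrite eqn_leq gdist_le/=; last by exists [:: y]; rewrite /= exy.
rewrite lt0n gdist_eq0; apply/negP => /eqP xy.
by move: exy; rewrite xy adj_irr.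
Qed.

(** Concatenating geodesics from x to z, from z to w and from w to y gives a walk
    whose length is the sum of the three distances; conversely, the pieces of a
    geodesic are walks, so that the triangle inequality is an equality. *)
Lemma between2P x y z w :
  between2 G x y z w <-> z != w /\ (d x z + d z w + d w y = d x y)%N.
Proof.
split=> [[p [i [j [[xp sp lp] /andP[ij jd] zE wE]]]]|[zw dE]].
  have x0 : x = nth x (x :: p) 0 by [].
  have y0 : y = nth x (x :: p) (size p).
    by rewrite -lp -nth_last; case: (p).
  have h1 := @walk_nth x p 0 i xp; have h2 := @walk_nth x p i j xp.
  have h3 := @walk_nth x p j (size p) xp.
  have h4 := @walk_nth x p 0 (size p) xp.
  rewrite /= -?x0 -?y0 -?zE -?wE in h1 h2 h3 h4.
  have /gdist_le {}h1 := h1 ltac:(lia).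
  have /gdist_le {}h2 := h2 ltac:(lia).
  have /gdist_le {}h3 := h3 ltac:(lia).
  have t1 := gdist_triangle z x y; have t2 := gdist_triangle w z y.
  split; last by lia.
  by rewrite -gdist_eq0; lia.
have [p [xp sp lp]] := gdist_walk x z.
have [q [zq sq lq]] := gdist_walk z w.
have [r [wr sr lr]] := gdist_walk w y.
exists (p ++ q ++ r), (d x z), (d x z + d z w)%N; split.
- split; first by rewrite !cat_path xp lp zq lq wr.
    by rewrite !size_cat sp sq sr addnA.
  by rewrite !last_cat lp lq.
- by rewrite -dE leq_addr andbT -[ltnLHS]addn0 ltn_add2l lt0n gdist_eq0.
- by rewrite -sp -cat_cons nth_cat/= ltnSn -[LHS]lp -nth_last; case: (p).
- rewrite -sp -sq -size_cat catA -cat_cons nth_cat/= ltnSn -[LHS]lq -lp.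
  by rewrite -last_cat -nth_last; case: (p ++ q).
Qed.

Lemma betweenP x y z : between G x y z <-> (d x z + d z y = d x y)%N.
Proof.
split=> [[p [xp sp lp] zp]|dE].
  have [i ip zE] : exists2 i, (i < size (x :: p))%N & z = nth x (x :: p) i.
    by exists (index z (x :: p)); rewrite ?index_mem// nth_index.
  have y0 : y = nth x (x :: p) (size p) by rewrite -lp -nth_last; case: (p).
  have h1 := @walk_nth x p 0 i xp; have h2 := @walk_nth x p i (size p) xp.
  rewrite /= in ip; rewrite /= -?y0 -?zE in h1 h2.
  have /gdist_le {}h1 := h1 ltac:(lia).
  have /gdist_le {}h2 := h2 ltac:(lia).
  by have := gdist_triangle z x y; lia.
have [p [xp sp lp]] := gdist_walk x z.
have [q [zq sq lq]] := gdist_walk z y.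
exists (p ++ q); first split; rewrite ?cat_path ?xp ?lp ?zq//.
- by rewrite size_cat sp sq.
- by rewrite last_cat lp.
- by rewrite -cat_cons mem_cat -lp mem_last.
Qed.

End Metric.

(** * Absolutely convergent sums over a countable set *)

Section Csum.
Context (R : realType) (X : countType).
Implicit Types (h k p q M : X -> R) (A : set X) (s : seq X).

(** Outside this class csum takes the value 0, and it is neither additive nor
    monotone. *)
Definition absum h : Prop := (\esum_(x in [set: X]) `|h x|%:E < +oo)%E.

Lemma absum_le M h : (forall x, `|h x| <= M x) -> absum M -> absum h.
Proof.
move=> hM; apply: le_lt_trans; apply: le_esum => x _.
by rewrite lee_fin (le_trans (hM x))// ler_norm.
Qed.

Lemma esum_fin p : (forall x, 0 <= p x) -> absum p ->
  (\esum_(x in [set: X]) (p x)%:E \is a fin_num)%E.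
Proof.
move=> p0 ap; rewrite ge0_fin_numE; last first.
  by apply: esum_ge0 => x _; rewrite lee_fin.
by apply: le_lt_trans ap; apply: le_esum => x _; rewrite lee_fin ler_norm.
Qed.

Lemma absumD h k : absum h -> absum k -> absum (fun x => h x + k x).
Proof.
move=> ah ak; apply: le_lt_trans (lte_add_pinfty ah ak).
rewrite -esumD; do ?by move=> x _; rewrite lee_fin.
by apply: le_esum => x _; rewrite lee_fin ler_normD.
Qed.

Lemma absumZ (c : R) h : absum h -> absum (fun x => c * h x).
Proof.
move=> ah; have nh0 x : 0 <= `|h x| by [].
have fh : (\esum_(x in [set: X]) `|h x|%:E \is a fin_num)%E.
  by rewrite ge0_fin_numE//; apply: esum_ge0 => x _; rewrite lee_fin.
apply: (@le_lt_trans _ _ (`|c|%:E * \esum_(x in [set: X]) `|h x|%:E)%E); last first.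
  by rewrite -(fineK fh) -EFinM ltry.
apply: ge_ereal_sup => _ [A [fA _] <-].
under eq_fsbigr do rewrite normrM EFinM.
rewrite -ge0_mule_fsumr; last by move=> x; rewrite lee_fin.
rewrite lee_wpmul2l ?lee_fin//; apply: esum_ge; exists A => //; split => //.
Qed.

Lemma absumN h : absum h -> absum (fun x => - h x).
Proof.
by move=> ah; apply: le_lt_trans ah; apply: le_esum => x _; rewrite normrN.
Qed.

Lemma absumB h k : absum h -> absum k -> absum (fun x => h x - k x).
Proof. by move=> ah /absumN ak; exact: absumD. Qed.

Lemma absum_norm h : absum h -> absum (fun x => `|h x|).
Proof.
by move=> ah; apply: le_lt_trans ah; apply: le_esum => x _; rewrite normr_id.
Qed.

Lemma absum_seq s h : (forall x, x \notin s -> h x = 0) -> absum h.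
Proof.
move=> hs; rewrite /absum (_ : (\esum_(x in [set: X]) _)%E =
  (\esum_(x in [set` s]) `|h x|%:E)%E); last first.
  rewrite [RHS]esum_mkcond; apply: eq_esum => x _.
  by case: ifPn => //; rewrite mem_setE => /hs->; rewrite normr0.
rewrite esum_fset; [|exact: finite_seq|by move=> x _; rewrite lee_fin].
by rewrite fsbig_finite ?sumEFin ?ltry//; exact: finite_seq.
Qed.

Lemma csum_sub p q : (forall x, 0 <= p x) -> (forall x, 0 <= q x) ->
  absum p -> absum q ->
  csum (fun x => p x - q x) = fine (\esum_(x in [set: X]) (p x)%:E)%E
                            - fine (\esum_(x in [set: X]) (q x)%:E)%E.
Proof.
move=> p0 q0 ap aq; rewrite /csum.
rewrite -fineB; [|exact: esum_fin..]; congr fine.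
have sp r : absum r -> summable [set: X] (EFin \o r) by [].
have := @esumB R X [set: X] (EFin \o p) (EFin \o q) (sp _ ap) (sp _ aq).
move=> <-; do ?by move=> x _; rewrite lee_fin.
congr (_ - _)%E; apply: eq_esum => x _; rewrite ?funeposE ?funenegE ?funrposE ?funrnegE.
  by rewrite /= EFin_max.
by rewrite /= EFin_max.
Qed.

Lemma ge0_csum p : (forall x, 0 <= p x) -> absum p ->
  csum p = fine (\esum_(x in [set: X]) (p x)%:E)%E.
Proof.
move=> p0 ap; have := @csum_sub p (fun=> 0) p0 (fun=> lexx _) ap.
under [X in csum X = _]eq_fun do rewrite subr0.
rewrite [in RHS](_ : (\esum_(x in [set: X]) 0%:E)%E = 0%E) ?subr0; last first.
  by apply: esum1.
by apply; apply: (@absum_seq [::]).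
Qed.

Lemma eq_csum h k : h =1 k -> csum h = csum k.
Proof. by move=> /funext ->. Qed.

Let pos h : X -> R := fun x => Num.max (h x) 0.
Let neg h : X -> R := fun x => Num.max (- h x) 0.

Let pos_neg h : h = (fun x => pos h x - neg h x).
Proof. by apply/funext => x; rewrite /pos /neg; case: lerP => ?; case: lerP => ?; lra. Qed.

Let pos_ge0 h x : 0 <= pos h x.
Proof. by rewrite le_max lexx orbT. Qed.

Let neg_ge0 h x : 0 <= neg h x.
Proof. by rewrite le_max lexx orbT. Qed.

Let absum_pos h : absum h -> absum (pos h).
Proof.
move=> /absum_norm; apply: absum_le => x; rewrite ger0_norm// /pos.
by rewrite ge_max ler_norm normr_ge0.
Qed.

Let absum_neg h : absum h -> absum (neg h).
Proof.
move=> /absum_norm; apply: absum_le => x; rewrite ger0_norm// /neg.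
by rewrite ge_max -normrN ler_norm normr_ge0.
Qed.

Let fesumD p q : (forall x, 0 <= p x) -> (forall x, 0 <= q x) ->
  absum p -> absum q ->
  fine (\esum_(x in [set: X]) (p x + q x)%:E)%E =
    fine (\esum_(x in [set: X]) (p x)%:E)%E
  + fine (\esum_(x in [set: X]) (q x)%:E)%E.
Proof.
move=> p0 q0 ap aq; rewrite -fineD; [|exact: esum_fin..].
by congr fine; rewrite -esumD//; move=> x _; rewrite lee_fin.
Qed.

Let csum_posneg h : absum h ->
  csum h = fine (\esum_(x in [set: X]) (pos h x)%:E)%E
         - fine (\esum_(x in [set: X]) (neg h x)%:E)%E.
Proof.
move=> ah; rewrite -csum_sub//; [|exact: absum_pos|exact: absum_neg].
by congr csum; exact: pos_neg.
Qed.

Lemma csumD h k : absum h -> absum k ->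
  csum (fun x => h x + k x) = csum h + csum k.
Proof.
move=> ah ak.
have -> : (fun x => h x + k x) =
  (fun x => (pos h x + pos k x) - (neg h x + neg k x)).
  by apply/funext => x; rewrite {1}(pos_neg h) {1}(pos_neg k); ring.
have ahp := absum_pos ah; have ahn := absum_neg ah.
have akp := absum_pos ak; have akn := absum_neg ak.
rewrite csum_sub; do ?[exact: absumD | by move=> x; rewrite addr_ge0].
rewrite (fesumD (pos_ge0 h) (pos_ge0 k) ahp akp).
rewrite (fesumD (neg_ge0 h) (neg_ge0 k) ahn akn).
by rewrite (csum_posneg ah) (csum_posneg ak) opprD addrACA.
Qed.

Lemma csumN h : absum h -> csum (fun x => - h x) = - csum h.
Proof.
move=> ah; have ahp := absum_pos ah; have ahn := absum_neg ah.
have -> : (fun x => - h x) = (fun x => neg h x - pos h x).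
  by apply/funext => x; rewrite {1}(pos_neg h) opprB.
by rewrite csum_sub// csum_posneg// opprB.
Qed.

Lemma csumB h k : absum h -> absum k ->
  csum (fun x => h x - k x) = csum h - csum k.
Proof. by move=> ah ak; rewrite csumD ?csumN//; exact: absumN. Qed.

Lemma csum_ge0 p : (forall x, 0 <= p x) -> absum p -> 0 <= csum p.
Proof.
move=> p0 ap; rewrite ge0_csum// fine_ge0// esum_ge0// => x _.
by rewrite lee_fin.
Qed.

Lemma ler_csum h k : absum h -> absum k -> (forall x, h x <= k x) ->
  csum h <= csum k.
Proof.
move=> ah ak hk; rewrite -subr_ge0 -csumB//; apply: csum_ge0.
  by move=> x; rewrite subr_ge0.
exact: absumB.
Qed.

Lemma csum_seq s h : uniq s -> (forall x, x \notin s -> h x = 0) ->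
  csum h = \sum_(x <- s) h x.
Proof.
move=> us hs.
have ge0_case p : (forall x, 0 <= p x) -> (forall x, x \notin s -> p x = 0) ->
    fine (\esum_(x in [set: X]) (p x)%:E)%E = \sum_(x <- s) p x.
  move=> p0 ps; rewrite (_ : (\esum_(x in [set: X]) _)%E =
    (\esum_(x in [set` s]) (p x)%:E)%E); last first.
    rewrite [RHS]esum_mkcond; apply: eq_esum => x _.
    by case: ifPn => //; rewrite mem_setE => /ps->.
  rewrite esum_fset; [|exact: finite_seq|by move=> x _; rewrite lee_fin].
  by rewrite -fsbig_seq//= sumEFin.
rewrite csum_posneg; last exact: absum_seq hs.
rewrite !ge0_case//; last 2 first.
- by move=> x /hs; rewrite /neg => ->; rewrite oppr0 maxxx.
- by move=> x /hs; rewrite /pos => ->; rewrite maxxx.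
by rewrite -sumrB; apply: eq_bigr => x _; rewrite {3}(pos_neg h).
Qed.

Lemma csum_norm h : absum h -> `|csum h| <= csum (fun x => `|h x|).
Proof.
move=> ah; have anh := absum_norm ah; rewrite ler_norml; apply/andP; split.
  rewrite -csumN//; apply: ler_csum => // [|x]; first exact: absumN.
  by rewrite lerNl -normrN ler_norm.
by apply: ler_csum => // x; exact: ler_norm.
Qed.

(** One finite set serves all the functions dominated by M: this uniformity is
    what the limit theorems for csum are built on. *)
Lemma csum_tail M : absum M -> forall eps : R, 0 < eps ->
  exists2 s, uniq s & forall h, (forall x, `|h x| <= M x) ->
    `|csum h - \sum_(x <- s) h x| <= eps.
Proof.
move=> aM eps eps0.
have [M0|] := pselect (forall x, 0 <= M x); last first.
  move=> /existsNP[x /negP]; rewrite -ltNge => Mx0; exists [::] => // h /(_ x).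
  by move=> /(le_trans (normr_ge0 _)); rewrite leNgt Mx0.
have [_ [A [fA _] <-] lt] := ub_ereal_sup_adherent eps0 (esum_fin M0 aM).
have {}lt : fine (\esum_(x in [set: X]) (M x)%:E)%E - eps <
    \sum_(x <- finmap.enum_fset (fset_set A)) M x.
  move: lt; rewrite -/(esum [set: X] (fun x => (M x)%:E)) -(fineK (esum_fin M0 aM)).
  by rewrite -EFinB fsbig_finite//= sumEFin lte_fin.
have inA x : (x \in finmap.enum_fset (fset_set A)) = (x \in A).
  by rewrite -in_fset_set.
move: (finmap.enum_fset _) (finmap.fset_uniq (fset_set A)) inA lt => s us inA lt.
exists s => // h hM.
pose r k x := if x \in A then 0 else k x : R.
pose c k x := if x \in A then k x else 0 : R.
have crE k : k = (fun x => c k x + r k x).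
  by apply/funext => x; rewrite /c /r; case: ifP; rewrite ?addr0 ?add0r.
have ah : absum h by exact: absum_le hM aM.
have ar k : absum k -> absum (r k).
  move=> /absum_norm; apply: absum_le => x.
  by rewrite /r; case: ifP; rewrite ?normr0.
have ac k : absum (c k).
  apply: (@absum_seq s) => x; rewrite inA /c => /negbTE ->//.
have csumE k : absum k -> csum k - \sum_(x <- s) k x = csum (r k).
  move=> ak; rewrite [in csum k](crE k) csumD//; last exact: ar.
  rewrite (@csum_seq s (c k))//; last first.
    by move=> x; rewrite inA /c => /negbTE ->.
  have -> : \sum_(x <- s) c k x = \sum_(x <- s) k x.
    by apply: eq_big_seq => x; rewrite inA /c => ->.
  by rewrite addrAC subrr add0r.
rewrite csumE//; apply: (@le_trans _ _ (csum (r M))).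
  apply: le_trans (csum_norm (ar _ ah)) _.
  apply: ler_csum; [exact/absum_norm/ar|exact: ar|move=> x].
  by rewrite /r; case: ifP; rewrite ?normr0.
rewrite -csumE// ge0_csum// lerBlDr.
by rewrite addrC -lerBlDr ltW.
Qed.

Lemma csumZ (c : R) h : absum h -> csum (fun x => c * h x) = c * csum h.
Proof.
move=> ah; apply/eqP; rewrite -subr_eq0 -normr_le0.
apply/ler_addgt0Pr => e e0; rewrite add0r.
have c1 : 0 < `|c| + 1 by rewrite ltr_pwDr.
have e1 : 0 < e / (`|c| + 1) by rewrite divr_gt0.
have [s us sP] := csum_tail (absumZ (`|c| + 1) (absum_norm ah)) e1.
have chM x : `|c * h x| <= (`|c| + 1) * `|h x|.
  by rewrite normrM ler_wpM2r// lerDl.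
have hM x : `|h x| <= (`|c| + 1) * `|h x| by rewrite ler_peMl// lerDr.
have := sP _ chM; rewrite -mulr_sumr => ch.
have := sP _ hM => /(ler_wpM2l (normr_ge0 c)); rewrite -normrM mulrBr => hh.
have -> : e = e / (`|c| + 1) + `|c| * (e / (`|c| + 1)).
  by rewrite -[X in _ = X + _]mul1r -mulrDl [1 + _]addrC mulrC divfK ?gt_eqF.
rewrite distrC in hh; apply: le_trans (lerD ch hh).
by apply: le_trans (ler_normD _ _); rewrite addrA subrK.
Qed.

(** Fubini for the positive and for the negative part of K. *)
Lemma csum_swap (K : X -> X -> R) :
  (\esum_(x in [set: X]) \esum_(y in [set: X]) `|K x y|%:E < +oo)%E ->
  csum (fun x => csum (K x)) = csum (fun y => csum (K ^~ y)).
Proof.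
have exch (a : X -> X -> \bar R) : (forall x y, 0 <= a x y)%E ->
  (\esum_(x in [set: X]) \esum_(y in [set: X]) a x y =
   \esum_(y in [set: X]) \esum_(x in [set: X]) a x y)%E.
  move=> a0; rewrite !esum_esum//.
  rewrite (@reindex_esum _ _ _ ([set: X] `*`` (fun=> [set: X]))
    ([set: X] `*`` (fun=> [set: X])) (fun z : X * X => (z.2, z.1)))//.
  by split => // [[x y] [u v] _ _ [-> ->]|[x y] _] //; exists (y, x).
have fin (Q : X -> X -> R) :
  (\esum_(x in [set: X]) \esum_(y in [set: X]) `|Q x y|%:E < +oo)%E ->
  forall x, absum (Q x).
  move=> fQ x; apply: le_lt_trans fQ; apply: esum_ge; exists [set x] => //.
  by rewrite fsbig_set1.
have ge0_csumE (Q : X -> X -> R) : (forall x y, 0 <= Q x y) ->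
  (\esum_(x in [set: X]) \esum_(y in [set: X]) `|Q x y|%:E < +oo)%E ->
  (absum (fun x => csum (Q x)) /\ csum (fun x => csum (Q x)) =
  fine (\esum_(x in [set: X]) \esum_(y in [set: X]) (Q x y)%:E)%E).
  move=> Q0 fQ; have aQ := fin _ fQ.
  have QE x : ((csum (Q x))%:E = \esum_(y in [set: X]) (Q x y)%:E)%E.
    by rewrite ge0_csum// fineK// esum_fin.
  have cQ0 x : 0 <= csum (Q x) by apply: csum_ge0.
  have acQ : absum (fun x => csum (Q x)).
    apply: le_lt_trans fQ; apply: le_esum => x _.
    rewrite ger0_norm// QE; apply: le_esum => y _.
    by rewrite lee_fin ler_norm.
  by split => //; rewrite ge0_csum//; congr fine; apply: eq_esum => x _.
have swapf (Q : X -> X -> R) : 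
  (\esum_(x in [set: X]) \esum_(y in [set: X]) `|Q x y|%:E < +oo)%E ->
  (\esum_(x in [set: X]) \esum_(y in [set: X]) `|Q y x|%:E < +oo)%E.
  by move=> fQ; rewrite -exch// => x y; rewrite lee_fin.
have main (Q : X -> X -> R) : (forall x y, 0 <= Q x y) ->
  (\esum_(x in [set: X]) \esum_(y in [set: X]) `|Q x y|%:E < +oo)%E ->
  csum (fun x => csum (Q x)) = csum (fun y => csum (Q ^~ y)).
  move=> Q0 fQ; rewrite (ge0_csumE Q Q0 fQ).2.
  rewrite exch; last by move=> x y; rewrite lee_fin.
  by have [_ ->] := ge0_csumE (fun y x => Q x y) (fun y x => Q0 x y) (swapf _ fQ).
move=> fK.
pose P x y := pos (K x) y; pose N x y := neg (K x) y.
have fP : (\esum_(x in [set: X]) \esum_(y in [set: X]) `|P x y|%:E < +oo)%E.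
  apply: le_lt_trans fK; apply: le_esum => x _; apply: le_esum => y _.
  rewrite lee_fin ger0_norm /P /pos ?le_max ?lexx ?orbT//.
  by rewrite ge_max ler_norm normr_ge0.
have fN : (\esum_(x in [set: X]) \esum_(y in [set: X]) `|N x y|%:E < +oo)%E.
  apply: le_lt_trans fK; apply: le_esum => x _; apply: le_esum => y _.
  rewrite lee_fin ger0_norm /N /neg ?le_max ?lexx ?orbT//.
  by rewrite ge_max -normrN ler_norm normr_ge0.
have P0 x y : 0 <= P x y by exact: pos_ge0.
have N0 x y : 0 <= N x y by exact: neg_ge0.
have KE x y : K x y = P x y - N x y by rewrite {1}(pos_neg (K x)).
rewrite (eq_csum (k := fun x => csum (P x) - csum (N x))); last first.
  by move=> x; rewrite -csumB; [apply: eq_csum => y|exact: fin..].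
rewrite [RHS](eq_csum (k := fun y => csum (P ^~ y) - csum (N ^~ y))); last first.
  move=> y; rewrite -csumB; first by apply: eq_csum => x.
    exact: (fin (fun y x => P x y) (swapf _ fP)).
  exact: (fin (fun y x => N x y) (swapf _ fN)).
have [aP _] := ge0_csumE P P0 fP; have [aN _] := ge0_csumE N N0 fN.
have [aP' _] := ge0_csumE (fun y x => P x y) (fun y x => P0 x y) (swapf _ fP).
have [aN' _] := ge0_csumE (fun y x => N x y) (fun y x => N0 x y) (swapf _ fN).
by rewrite (csumB aP aN) (csumB aP' aN') (main P P0 fP) (main N N0 fN).
Qed.

End Csum.

(** * Limits, derivatives and lower limits of sums *)

Section CsumLimits.
Context (R : realType) (X : countType).
Implicit Types (h M : X -> R).

Lemma cvg_sum_seq (I : Type) (F : set_system I) {FF : Filter F} (T : Type)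
    (s : seq T) (u : I -> T -> R) (h : T -> R) :
  (forall x, u i x @[i --> F] --> h x) ->
  \sum_(x <- s) u i x @[i --> F] --> \sum_(x <- s) h x.
Proof.
by move=> uh; apply: (cvg_big (op := +%R)) => // -[a b]; exact: cvgD cvg_fst cvg_snd.
Qed.

(** Dominated convergence: outside the finite set given by csum_tail, all the sums
    are uniformly small. *)
Lemma cvg_csum (I : topologicalType) (F : set_system I) {FF : ProperFilter F}
    (u : I -> X -> R) h M :
  absum M -> (\forall i \near F, forall x, `|u i x| <= M x) ->
  (forall x, u i x @[i --> F] --> h x) ->
  csum (u i) @[i --> F] --> csum h.
Proof.
move=> aM uM uh.
have hM x : `|h x| <= M x.
  apply: (@ler_cvg_to _ F _ _ _ (fun=> M x) _ _ (cvg_norm (uh x))).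
    exact: cvg_cst.
  by apply: filterS uM => i; apply.
apply/cvgrPdist_le => e e0.
have e3 : 0 < e / 3 by rewrite divr_gt0.
have [s us sM] := csum_tail aM e3.
have /cvgrPdist_le /(_ _ e3) us_cvg :
    \sum_(x <- s) u i x @[i --> F] --> \sum_(x <- s) h x.
  exact: cvg_sum_seq.
apply: filter_app us_cvg; apply: filterS uM => i ui hi.
have := sM _ hM; have := sM _ ui.
move: (csum h) (csum (u i)) (\sum_(x <- s) h x) (\sum_(x <- s) u i x) hi.
move=> a b a' b'; rewrite !ler_norml => /andP[? ?] /andP[? ?] /andP[? ?].
apply/andP; split; lra.
Qed.

Lemma lipschitz_of_derive (v v' : R -> R) (t r K : R) :
  (forall s, `|s - t| < r -> is_derive s 1 v (v' s)) ->
  (forall s, `|s - t| < r -> `|v' s| <= K) ->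
  forall s, `|s - t| < r -> `|v s - v t| <= K * `|s - t|.
Proof.
move=> dv vK s st.
have key a b : a <= b -> `|a - t| < r -> `|b - t| < r ->
    `|v b - v a| <= K * `|b - a|.
  move=> ab ar br.
  have inr c : c \in `[a, b]%R -> `|c - t| < r.
    rewrite in_itv/= => /andP[ac cb]; move: ar br.
    rewrite !ltr_norml => /andP[? ?] /andP[? ?]; apply/andP; split; lra.
  have [| |c /inr cr ->] := @MVT_segment _ v v' a b ab _ _.
  - by move=> c /subset_itv_oo_cc cab; apply/dv/inr.
  - apply: derivable_within_continuous => c cab.
    by have [] := dv _ (inr _ cab).
  by rewrite normrM ler_wpM2r// vK.
have tr : `|t - t| < r by rewrite subrr normr0 (le_lt_trans _ st).
have [st'|/ltW ts] := leP t s; first exact: key.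
by rewrite distrC [`|s - t|]distrC; exact: key.
Qed.

(** By the mean value inequality the difference quotients of each term are
    dominated by M, so that dominated convergence applies to them. *)
Lemma is_derive_csum (u u' : R -> X -> R) (t r : R) M :
  0 < r -> absum M ->
  (forall s, `|s - t| < r -> absum (u s)) ->
  (forall s, `|s - t| < r -> forall x, is_derive s 1 (u ^~ x) (u' s x)) ->
  (forall s, `|s - t| < r -> forall x, `|u' s x| <= M x) ->
  is_derive t 1 (fun s => csum (u s)) (csum (u' t)).
Proof.
move=> r0 aM au du u'M.
have tt : `|t - t| < r by rewrite subrr normr0.
have near_r : \forall h \near (0 : R)^', `|h + t - t| < r.
  by near=> h; rewrite addrK; near: h; exact: dnbhs0_lt.
have cvgq : (fun h : R => h^-1 *: (csum (u (h + t)) - csum (u t))) @ 0^'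
    --> csum (u' t).
  apply: (@cvg_trans _
    ((fun h : R => csum (fun x => h^-1 * (u (h + t) x - u t x))) @ 0^')).
    apply: near_eq_cvg; near=> h.
    have hr : `|h + t - t| < r by near: h.
    have [a1 a2] := (au _ hr, au _ tt).
    by rewrite csumZ ?csumB//; exact: absumB.
  apply: (@cvg_csum _ _ _ _ _ M) => //.
    near=> h => x.
    have hr : `|h + t - t| < r by near: h.
    have h0 : h != 0 by near: h; exact: nbhs_dnbhs_neq.
    rewrite normrM normfV ler_pdivrMl ?normr_gt0// mulrC.
    have := @lipschitz_of_derive (u ^~ x) (u' ^~ x) t r (M x).
    by move=> /(_ (fun s sr => du s sr x) (fun s sr => u'M s sr x) _ hr); rewrite addrK.
  move=> x; have [+ +] := du t tt x; rewrite /derivable /derive => dd <-.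
  rewrite [X in X @ _](_ : _ = (fun h : R => h^-1 *: ((u ^~ x \o shift t) (h *: 1) - u t x)))//.
  by apply/funext => k /=; rewrite [k *: 1]mulr1.
have E : (fun h : R => h^-1 *: (csum (u (h + t)) - csum (u t))) =
  (fun h : R => h^-1 *: (((fun s => csum (u s)) \o shift t) (h *: 1) - csum (u t))).
  by apply/funext => k /=; rewrite [k *: 1]mulr1.
by rewrite E in cvgq; split; [apply/cvg_ex; exists (csum (u' t))|exact: cvg_lim cvgq].
Unshelve. all: by end_near. Qed.

(** That c is at most the lower limit of u, in a form that is stable under sums
    and products without any finiteness condition on the lower limit itself. *)
Definition lowlim (u : nat -> R) (c : R) : Prop :=
  forall e : R, 0 < e -> \forall n \near \oo, c - e <= u n.

Lemma lowlim_limn_einf u c : lowlim u c ->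
  (c%:E <= limn_einf (fun n => (u n)%:E))%E.
Proof.
move=> uc; rewrite limn_einf_lim.
have := @is_cvg_einfs _ (fun n => (u n)%:E).
move=> cv; apply/lee_subgt0Pr => e e0.
have [N _ hN] := uc _ e0.
apply: lime_ge => //; exists N => // n /= Nn.
apply: le_ereal_inf_tmp => _ [k /= nk <-].
by rewrite -EFinB lee_fin hN//= (leq_trans Nn).
Qed.

Lemma lowlim_cvg u c : u n @[n --> \oo] --> c -> lowlim u c.
Proof.
move=> /cvgrPdist_le uc e /uc; apply: filterS => n.
by rewrite ler_norml => /andP[_]; rewrite lerBlDr addrC -lerBlDr.
Qed.

Lemma lowlim_le u v c : (\forall n \near \oo, u n <= v n) ->
  lowlim u c -> lowlim v c.
Proof.
move=> uv uc e /uc; apply: filter_app; apply: filterS uv => n uv.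
by move=> /le_trans; apply.
Qed.

Lemma lowlimD u v a b : lowlim u a -> lowlim v b ->
  lowlim (fun n => u n + v n) (a + b).
Proof.
move=> ua vb e e0; have e2 : 0 < e / 2 by rewrite divr_gt0.
by apply: filter_app (ua _ e2); apply: filterS (vb _ e2) => n ? ?; lra.
Qed.

Lemma lowlim_sum (I : Type) (s : seq I) (u : I -> nat -> R) (c : I -> R) :
  (forall i, lowlim (u i) (c i)) ->
  lowlim (fun n => \sum_(i <- s) u i n) (\sum_(i <- s) c i).
Proof.
move=> uc; elim: s => [|i s IH].
  rewrite big_nil; apply: lowlim_cvg.
  by under eq_fun do rewrite big_nil; exact: cvg_cst.
rewrite big_cons; under eq_fun do rewrite big_cons.
exact: lowlimD.
Qed.

Lemma lowlimM (q u : nat -> R) (a c : R) :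
  (\forall n \near \oo, 0 <= q n) -> q n @[n --> \oo] --> a -> lowlim u c ->
  lowlim (fun n => q n * u n) (a * c).
Proof.
move=> q0 qa uc e e0.
have a1 : 0 < `|a| + 1 by rewrite ltr_pwDr.
pose d := e / 2 / (`|a| + 1).
have d0 : 0 < d by rewrite !divr_gt0.
have qd : q n * (c - d) @[n --> \oo] --> a * (c - d) by exact: cvgMl.
have := lowlim_cvg qd; move=> /(_ (e / 2)); rewrite divr_gt0// => /(_ isT).
apply: filter_app; apply: filter_app (uc _ d0); apply: filterS q0 => n qn un h.
apply: le_trans (ler_wpM2l qn un); apply: le_trans h.
have : a * d <= e / 2.
  rewrite /d mulrCA ger_pMr ?divr_gt0// ler_pdivrMr// mul1r.
  by rewrite (le_trans (ler_norm a))// lerDl.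
by rewrite mulrBr; lra.
Qed.

(** The finite set of csum_tail splits the sum: inside, finitely many lower limits
    add up; outside, u n is at least - M, whose sum there is small. *)
Lemma fatou_csum (u : nat -> X -> R) h M : absum M -> absum h ->
  (\forall n \near \oo, absum (u n)) ->
  (\forall n \near \oo, forall x, - M x <= u n x) ->
  (forall x, lowlim (u ^~ x) (h x)) ->
  lowlim (fun n => csum (u n)) (csum h).
Proof.
move=> aM ah au Mu uh e e0.
have e4 : 0 < e / 4 by rewrite divr_gt0.
have aMh : absum (fun x => `|M x| + `|h x|) by apply: absumD; exact: absum_norm.
have [s us sP] := csum_tail aMh e4.
(* off s this is a minorant of u n, and its sum is small by the choice of s *)
pose v x := if x \in s then 0 else - `|M x|.
have vM x : `|v x| <= `|M x| + `|h x|.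
  by rewrite /v; case: ifP => _; rewrite ?normr0 ?normrN ?normr_id ?lerDl// addr_ge0.
have av : absum v by exact: absum_le vM aMh.
have := sP _ vM; rewrite big_seq big1 ?subr0; last by move=> x xs; rewrite /v xs.
have /sP hs x : `|h x| <= `|M x| + `|h x| by rewrite lerDr.
move=> vs.
have := @lowlim_sum _ s (fun x n => u n x) h uh; move=> /(_ (e / 4) e4).
apply: filter_app; apply: filter_app au; apply: filterS Mu => n Mu au us4.
pose c x := if x \in s then u n x else 0.
have cs x : x \notin s -> c x = 0 by rewrite /c => /negbTE ->.
have ac : absum c by exact: absum_seq cs.
have : csum (fun x => c x + v x) <= csum (u n).
  apply: ler_csum => //; first exact: absumD.
  move=> x; rewrite /c /v; case: ifP => _; rewrite ?addr0// add0r.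
  by apply: le_trans (Mu x); rewrite lerN2 ler_norm.
rewrite csumD// (csum_seq us cs) (_ : \sum_(x <- s) c x = \sum_(x <- s) u n x).
  move: hs vs; rewrite !ler_norml => /andP[? ?] /andP[? ?] ?.
  by lra.
by apply: eq_big_seq => x; rewrite /c => ->.
Qed.

End CsumLimits.

(** * The generator and its powers *)

Section Generator.
Context (R : realType) (X : countType) (G : graph_space R X).
Local Notation e := (adj G).
Local Notation d := (gdist G).
Local Notation m := (mass G).
Local Notation L := (gen G).
Implicit Types (x y z v w : X) (K : X -> X -> R).

Lemma finite_neighbours x : finite_set [set y | e x y].
Proof.
have [D hD] := adj_bounded_degree G.
exact: card_le_finite (hD x) (finite_II D).
Qed.

(** The point x itself is listed, since L has a diagonal. *)
Definition nbs x : seq X := x :: finmap.enum_fset (fset_set [set y | e x y]).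

Arguments nbs : simpl never.

Let mem_nb x y :
  (y \in finmap.enum_fset (fset_set [set y | e x y])) = e x y.
Proof.
by apply: etrans (in_fset_set (finite_neighbours x) y) _; apply/asboolP/idP.
Qed.

Lemma mem_nbs x y : (y \in nbs x) = (y == x) || e x y.
Proof. by rewrite inE mem_nb. Qed.

Lemma nbs_uniq x : uniq (nbs x).
Proof. by rewrite cons_uniq finmap.fset_uniq andbT mem_nb adj_irr. Qed.

Lemma nbs_sym x y : (y \in nbs x) = (x \in nbs y).
Proof. by rewrite !mem_nbs eq_sym adj_sym. Qed.

Lemma gen_out x y : y \notin nbs x -> L x y = 0.
Proof.
by rewrite mem_nbs negb_or eq_sym => /andP[xy exy]; exact: gen_nadj.
Qed.

Lemma gen_ge0 x y : x != y -> 0 <= L x y.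
Proof.
by move=> xy; have [/gen_adj/ltW//|/(gen_nadj xy) ->] := boolP (e x y).
Qed.

Definition genop (U : X -> R) z : R := \sum_(v <- nbs z) L z v * U v.

Lemma gen_row_sum x : \sum_(v <- nbs x) L x v = 0.
Proof.
rewrite /nbs big_cons gen_diag.
rewrite (fsbigE (finmap.enum_fset (fset_set [set y | e x y])))//=.
- apply/eqP; rewrite addrC subr_eq0; apply/eqP.
  rewrite big_seq [RHS]big_seq_cond; apply: eq_bigl => v.
  have [|//] := boolP (v \in _); rewrite mem_nb => xv; apply/esym/mem_set => /=.
  by apply/eqP => vx; move: xv; rewrite vx adj_irr.
- by move=> v /=; rewrite mem_nb => xv; apply/eqP => vx; move: xv; rewrite vx adj_irr.
- by move=> v /= vx; rewrite mem_nb => xv; rewrite gen_nadj// eq_sym.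
Qed.

Section Bounded.
Variables (S : R).
Hypothesis (gen_bound : forall x, `|L x x| <= S).

(** The rows of L sum to 0, so the off-diagonal entries add up to minus the
    diagonal one. *)
Lemma gen_row_norm x : \sum_(v <- nbs x) `|L x v| <= 2 * S.
Proof.
have := gen_row_sum x; rewrite /nbs !big_cons => row0.
rewrite [X in _ + X <= _](@eq_big_seq _ _ _ _ _ _ (L x)).
  have := gen_bound x; rewrite -normrN; have := ler_norm (- L x x).
  by lra.
move=> v; rewrite mem_nb => xv; rewrite ger0_norm// gen_ge0//.
by apply/eqP => vx; move: xv; rewrite vx adj_irr.
Qed.

End Bounded.

(** The recursion of genpow, with finite sums over neighbours and for any kernel:
    it is used for L and for the nonnegative kernel L + S. *)
Fixpoint kpow K k x y : R :=
  if k is k'.+1 then \sum_(v <- nbs x) K x v * kpow K k' v y else (x == y)%:R.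

Lemma genpowE k x y : genpow G k x y = kpow L k x y.
Proof.
elim: k x y => //= k IH x y.
rewrite (fsbigE (nbs x))//; [|exact: nbs_uniq|]; last first.
  by move=> v _ /gen_out ->; rewrite mul0r.
by rewrite big_seq_cond [RHS]big_seq; apply: eq_big => v;
   rewrite ?inE ?in_setT ?andbT// => _; rewrite IH.
Qed.

Lemma kpow_out K k x y : (k < d x y)%N -> kpow K k x y = 0.
Proof.
elim: k x => [|k IH] x /=.
  by rewrite lt0n gdist_eq0 => /negbTE ->.
move=> kd; rewrite big_seq big1// => v; rewrite mem_nbs => vx.
rewrite IH ?mulr0//; have := gdist_triangle G v x y.
case/orP: vx => [/eqP ->|]; rewrite ?gdistxx -?gdist_eq1; lia.
Qed.

Lemma kpowSr K k x y : (forall u v, v \notin nbs u -> K u v = 0) ->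
  kpow K k.+1 x y = \sum_(v <- nbs y) kpow K k x v * K v y.
Proof.
move=> K0; elim: k x => [|k IH] x.
  have [yx|yx] := boolP (y \in nbs x).
    rewrite /= (bigD1_seq y yx (nbs_uniq x))/= eqxx mulr1 big1 ?addr0; last first.
      by move=> v /negbTE ->; rewrite mulr0.
    rewrite nbs_sym in yx; rewrite (bigD1_seq x yx (nbs_uniq y))/= eqxx mul1r.
    by rewrite big1 ?addr0// => v; rewrite eq_sym => /negbTE ->; rewrite mul0r.
  rewrite /= !big_seq !big1// => v.
    rewrite nbs_sym => vy; case: eqVneq => [vx|_]; rewrite ?mul0r//.
    by move: yx; rewrite vx vy.
  move=> vx; case: eqVneq => [vy|_]; rewrite ?mulr0//.
  by move: yx; rewrite -vy vx.
transitivity (\sum_(v <- nbs x) K x v * kpow K k.+1 v y); first by [].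
under eq_bigr => v _ do rewrite IH mulr_sumr.
rewrite exchange_big/=; apply: eq_bigr => w _.
by rewrite mulr_suml; apply: eq_bigr => v _; rewrite mulrA.
Qed.

Lemma genpowSr k x y :
  genpow G k.+1 x y = \sum_(v <- nbs y) genpow G k x v * L v y.
Proof.
rewrite genpowE kpowSr; last exact: gen_out.
by apply: eq_bigr => v _; rewrite genpowE.
Qed.

Lemma genpowS k x y :
  genpow G k.+1 x y = \sum_(v <- nbs x) L x v * genpow G k v y.
Proof. by rewrite genpowE; apply: eq_bigr => v _; rewrite genpowE. Qed.

Lemma genpow_out k x y : (k < d x y)%N -> genpow G k x y = 0.
Proof. by rewrite genpowE; exact: kpow_out. Qed.

Lemma genpow_rev k x y : m x * genpow G k x y = m y * genpow G k y x.
Proof.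
elim: k x y => [|k IH] x y.
  by rewrite /= [y == x]eq_sym; case: eqVneq => [->//|_]; rewrite !mulr0.
rewrite genpowS genpowSr !mulr_sumr; apply: eq_bigr => v _.
by rewrite mulrA gen_reversible mulrAC IH mulrA.
Qed.

Lemma genpow_norm S k x y : (forall x, `|L x x| <= S) ->
  `|genpow G k x y| <= (2 * S) ^+ k.
Proof.
move=> LS; elim: k x => [|k IH] x.
  by rewrite expr0 /=; case: eqVneq; rewrite ?normr1 ?normr0.
have S0 : 0 <= 2 * S by rewrite mulr_ge0// (le_trans _ (LS x)).
rewrite genpowS; apply: le_trans (ler_norm_sum _ _ _) _.
apply: (@le_trans _ _ (\sum_(v <- nbs x) `|L x v| * (2 * S) ^+ k)).
  by apply: ler_sum => v _; rewrite normrM ler_wpM2l.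
by rewrite -mulr_suml exprS ler_wpM2r ?exprn_ge0// gen_row_norm.
Qed.

Lemma kpow_ge0 K k x y : (forall u v, 0 <= K u v) -> 0 <= kpow K k x y.
Proof.
by move=> K0; elim: k x => [|k IH] x //=; apply: sumr_ge0 => v _; rewrite mulr_ge0.
Qed.

Lemma kpow_walk K k x y (I : R) : 0 <= I -> (forall u v, 0 <= K u v) ->
  (forall u v, e u v -> I <= K u v) -> walk G k x y -> I ^+ k <= kpow K k x y.
Proof.
move=> I0 K0 KI [p [xp <- <-]] {k y}.
elim: p x xp => [|v p IH] x /=; first by rewrite eqxx.
move=> /andP[xv vp]; have vx : v \in nbs x by rewrite mem_nbs xv orbT.
rewrite (bigD1_seq v vx (nbs_uniq x))/=.
rewrite exprS; apply: (@le_trans _ _ (K x v * kpow K (size p) v (last v p))).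
  by rewrite ler_pM ?exprn_ge0 ?KI ?IH.
by rewrite lerDl sumr_ge0// => w _; rewrite mulr_ge0// kpow_ge0.
Qed.

(** The rule of Pascal, as used in the induction step of kpow_shift. *)
Lemma binomial_conv_step (a : nat -> R) (c : R) k :
  \sum_(j < k.+1) 'C(k, j)%:R * c ^+ (k - j) * a j.+1 +
  c * (\sum_(j < k.+1) 'C(k, j)%:R * c ^+ (k - j) * a j) =
  \sum_(j < k.+2) 'C(k.+1, j)%:R * c ^+ (k.+1 - j) * a j.
Proof.
rewrite [RHS]big_ord_recl /= bin0 subn0.
under [in RHS]eq_bigr => i _ do
  rewrite /bump/= add1n binS natrD subSS mulrDl mulrDl.
rewrite big_split/= [X in _ = _ + (X + _)]big_ord_recr/= bin_small//.
rewrite !mul0r addr0 [in RHS]addrA [RHS]addrC; congr (_ + _).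
rewrite big_ord_recl/= bin0 subn0 mulrDr mulr_sumr; congr (_ + _).
  by rewrite !mul1r mulrA -exprS.
apply: eq_bigr => i _; rewrite /bump/= add1n.
by rewrite mulrA mulrCA mulrA -mulrA -exprS subnSK// !mulrA.
Qed.

(** The binomial formula for the sum of K and of a multiple of the identity. *)
Lemma kpow_shift K (c : R) k x y :
  kpow (fun u v => K u v + c * (u == v)%:R) k x y =
  \sum_(j < k.+1) 'C(k, j)%:R * c ^+ (k - j) * kpow K j x y.
Proof.
elim: k x => [|k IH] x; first by rewrite big_ord1 bin0 expr0 !mul1r.
rewrite -(binomial_conv_step (fun j => kpow K j x y)) -IH /=.
under eq_bigr do rewrite mulrDl.
rewrite big_split/=; congr (_ + _).
  under eq_bigr do rewrite IH mulr_sumr.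
  rewrite exchange_big/=; apply: eq_bigr => j _; rewrite mulr_sumr.
  by apply: eq_bigr => v _; rewrite mulrCA.
have xx : x \in nbs x by rewrite mem_nbs eqxx.
rewrite (bigD1_seq x xx (nbs_uniq x))/= eqxx mulr1 big1 ?addr0// => v.
by rewrite eq_sym => /negbTE ->; rewrite mulr0 mul0r.
Qed.

End Generator.

(** * Series dominated by the exponential series *)

Section ExponentialSeries.
Context (R : realType).
Implicit Types (u a b : nat -> R).

(** The entries (x, y) of the powers of L vanish below the power d x y, so the
    kernel is compared with an exponential series whose first terms are cut. *)
Lemma exp_dominated u n (B c : R) : 0 <= c ->
  (forall k, (k < n)%N -> u k = 0) ->
  (forall k, `|u (n + k)%N| <= B * (c ^+ k / k`!%:R)) ->
  cvgn (series u) /\ `|limn (series u)| <= B * expR c.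
Proof.
move=> c0 u0 uB; pose v k := u (n + k)%N.
have B0 : 0 <= B.
  by have := le_trans (normr_ge0 _) (uB 0%N); rewrite expr0 fact0 divr1 mulr1.
have e0 k : 0 <= exp_coeff c k by rewrite exp_coeff_ge0.
have cB : cvgn (series (B *: exp_coeff c)).
  by apply: is_cvg_seriesZ; exact: is_cvg_series_exp_coeff.
have cv : cvgn (series v).
  apply: normed_cvg; apply: series_le_cvg cB => k; first exact: normr_ge0.
    by rewrite mulr_ge0.
  exact: uB.
have vu N : series v N = series u (N + n)%N.
  rewrite /series/= (@big_cat_nat _ _ _ n 0 (N + n))//= ?leq_addl//.
  have -> : \sum_(0 <= i < n) u i = 0.
    by rewrite big_nat big1// => k /andP[_ kn]; rewrite u0.
  rewrite add0r; symmetry; rewrite -{1}[n]add0n big_addn addnK.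
  by apply: eq_bigr => k _; rewrite /v addnC.
have cu : series u N @[N --> \oo] --> limn (series v).
  by rewrite -(cvg_shiftn n) /=; under eq_fun do rewrite -vu; exact: cv.
split; first by apply/cvg_ex; exists (limn (series v)).
rewrite (cvg_lim _ cu)//.
apply: (@ler_cvg_to _ \oo _ _ _ (fun=> B * expR c) _ _ (cvg_norm cv)).
  exact: cvg_cst.
apply: nearW => N; rewrite /series/=.
apply: le_trans (ler_norm_sum _ _ _) _.
apply: (@le_trans _ _ (\sum_(0 <= k < N) B * exp_coeff c k)).
  by apply: ler_sum => k _; exact: uB.
rewrite -mulr_sumr ler_wpM2l//.
apply: (nondecreasing_cvgn_le _ (is_cvg_series_exp_coeff c)).
by apply: nondecreasing_series => k _ _; exact: e0.
Qed.

Let sum_triangle (F : nat -> nat -> R) n :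
  \sum_(k < n) \sum_(i < k.+1) F i (k - i)%N =
  \sum_(i < n) \sum_(j < n | (j < n - i)%N) F i j.
Proof.
transitivity (\sum_(i < n) \sum_(j < n - i) F i j); last first.
  apply: eq_bigr => i _.
  by rewrite (big_ord_widen n (fun j => F i j)) ?leq_subr.
elim: n => [|n IH]; first by rewrite !big_ord0.
rewrite big_ord_recr/= IH [RHS]big_ord_recr/= subSnn big_ord1.
rewrite [X in _ + X]big_ord_recr/= subnn addrA; congr (_ + _).
rewrite -big_split/=; apply: eq_bigr => i _.
have -> : (n.+1 - i = (n - i).+1)%N by rewrite subSn// ltnW.
rewrite [LHS]addrC [RHS]big_ord_recr/= addrC.
congr (_ + _).
Qed.

Let product_minus_cauchy a b n :
  series a n * series b n -
  \sum_(k < n) \sum_(i < k.+1) a i * b (k - i)%N =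
  \sum_(i < n) \sum_(j < n | ~~ (j < n - i)%N) a i * b j.
Proof.
rewrite (sum_triangle (fun i j => a i * b j)) /series/= !big_mkord big_distrl/=.
apply/eqP; rewrite subr_eq; apply/eqP; rewrite -big_split/=.
apply: eq_bigr => i _; rewrite addrC mulr_sumr.
by rewrite (bigID (fun j : 'I_n => (j < n - i)%N)).
Qed.

(** The product of the partial sums differs from the partial sum of the product
    series by terms indexed by a triangle.  Their sum is dominated by its value
    for the exponential series of p and q, which tends to 0 by the functional
    equation of the exponential. *)
Lemma cvg_cauchy_product a b (p q : R) : 0 <= p -> 0 <= q ->
  (forall k, `|a k| <= p ^+ k / k`!%:R) ->
  (forall k, `|b k| <= q ^+ k / k`!%:R) ->
  series (fun k => \sum_(i < k.+1) a i * b (k - i)%N) n @[n --> \oo] -->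
  limn (series a) * limn (series b).
Proof.
move=> p0 q0 ap bq.
have cvs u (c : R) : 0 <= c -> (forall k, `|u k| <= c ^+ k / k`!%:R) ->
    cvgn (series u).
  move=> c0 uc.
  have u1 k : `|u (0 + k)%N| <= 1 * (c ^+ k / k`!%:R) by rewrite mul1r.
  by have [] := @exp_dominated u 0 1 c c0 (fun k => ltac:(by [])) u1.
have ca := cvs _ _ p0 ap; have cb := cvs _ _ q0 bq.
(* the same difference for the series of the exponentials of p and q *)
pose es := fun n => series (exp_coeff p) n * series (exp_coeff q) n -
                    series (exp_coeff (p + q)) n.
have es0 : es n @[n --> \oo] --> 0.
  rewrite -(subrr (expR (p + q))) {1}expRD; apply: cvgB; first apply: cvgM;
  exact: is_cvg_series_exp_coeff.
have ab : series a n * series b n @[n --> \oo] --> limn (series a) * limn (series b).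
  exact: cvgM.
rewrite -[X in _ --> X]subr0.
rewrite (_ : (fun n => _) = (fun n => series a n * series b n -
  (series a n * series b n - \sum_(k < n) \sum_(i < k.+1) a i * b (k - i)%N)));
  last by apply/funext => n; rewrite opprB addrC subrK /series/= big_mkord.
apply: cvgB => //; apply/norm_cvg0P.
apply: (squeeze_cvgr _ (cvg_cst 0) es0).
apply: nearW => n; rewrite normr_ge0/=.
rewrite product_minus_cauchy /es.
have -> : series (exp_coeff (p + q)) n =
    \sum_(k < n) \sum_(i < k.+1) exp_coeff p i * exp_coeff q (k - i)%N.
  rewrite /series/= big_mkord; apply: eq_bigr => k _.
  rewrite /exp_coeff/= [p + q]addrC exprDn mulr_suml; apply: eq_bigr => i _.
  rewrite -(bin_fact (ltnSE (ltn_ord i))) !natrM -mulr_natr.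
  have f0 l : (l`!%:R : R) != 0 by rewrite pnatr_eq0 -lt0n fact_gt0.
  have C0 : ('C(k, i)%:R : R) != 0.
    by rewrite pnatr_eq0 -lt0n bin_gt0 (ltnSE (ltn_ord i)).
  by field; rewrite !f0 C0.
rewrite product_minus_cauchy.
apply: le_trans (ler_norm_sum _ _ _) _; apply: ler_sum => i _.
apply: le_trans (ler_norm_sum _ _ _) _; apply: ler_sum => j _.
by rewrite normrM ler_pM.
Qed.

End ExponentialSeries.

Arguments genpow : simpl never.
Arguments kpow : simpl never.

(** * The heat kernel *)

Section Heat.
Context (R : realType) (X : countType) (G : graph_space R X) (S : R).
Local Notation e := (adj G).
Local Notation d := (gdist G).
Local Notation m := (mass G).
Local Notation L := (gen G).
Hypothesis (S_ge0 : 0 <= S) (gen_bound : forall x, `|L x x| <= S).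

(** The j-th time derivative of the heat kernel, that is, L^j e^(sL). *)
Definition heatn (j : nat) (s : R) (x y : X) : R :=
  limn (series (fun k => s ^+ k / k`!%:R * genpow G (j + k) x y)).

Let S2 : 0 <= 2 * S. Proof. by rewrite mulr_ge0. Qed.

Let heat_term j s x y k : 0 <= s ->
  `|s ^+ k / k`!%:R * genpow G (j + k) x y|
   <= (2 * S) ^+ j * ((2 * S * s) ^+ k / k`!%:R).
Proof.
move=> s0; rewrite normrM ger0_norm ?divr_ge0 ?exprn_ge0//.
apply: (@le_trans _ _ (s ^+ k / k`!%:R * (2 * S) ^+ (j + k))).
  by rewrite ler_wpM2l ?divr_ge0 ?exprn_ge0// genpow_norm.
rewrite exprD [(2 * S * s) ^+ k]exprMn le_eqVlt; apply/orP; left; apply/eqP.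
by rewrite mulrCA; congr (_ * _); rewrite mulrC mulrA.
Qed.

Let le_expn_fact (c : R) n k : 0 <= c ->
  c ^+ (n + k) / (n + k)`!%:R <= c ^+ n / n`!%:R * (c ^+ k / k`!%:R).
Proof.
move=> c0; rewrite exprD mulf_div ler_wpM2l ?mulr_ge0 ?exprn_ge0//.
rewrite lef_pV2 ?posrE ?ltr0n ?fact_gt0 ?mulr_gt0 ?ltr0n ?fact_gt0//.
rewrite -natrM ler_nat -(bin_fact (leq_addr k n)) addKn leq_pmull//.
by rewrite bin_gt0 leq_addr.
Qed.

Lemma heatn_cvg j s x y : 0 <= s ->
  cvgn (series (fun k => s ^+ k / k`!%:R * genpow G (j + k) x y)).
Proof.
move=> s0; apply: (proj1 (@exp_dominated _ _ 0 ((2 * S) ^+ j) (2 * S * s)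
  (mulr_ge0 S2 s0) _ _)) => // k.
exact: heat_term.
Qed.

Lemma heatn0 s x y : heatn 0 s x y = heat G s x y.
Proof. by []. Qed.

Lemma heatn_bound j s x y : 0 <= s ->
  `|heatn j s x y| <= (2 * S) ^+ j *
    ((2 * S * s) ^+ (d x y - j) / (d x y - j)`!%:R) * expR (2 * S * s).
Proof.
move=> s0; have c0 := mulr_ge0 S2 s0.
apply: (proj2 (@exp_dominated _ _ (d x y - j) _ _ c0 _ _)) => k.
  by move=> kd; rewrite genpow_out ?mulr0// -ltn_subRL.
apply: le_trans (heat_term _ _ _ _ s0) _; rewrite -[leRHS]mulrA.
by rewrite ler_wpM2l ?exprn_ge0// le_expn_fact.
Qed.

(** Only the walks of length d x y contribute at leading order in s. *)
Lemma heat_lead s x y : 0 <= s ->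
  `|heat G s x y - s ^+ d x y / (d x y)`!%:R * genpow G (d x y) x y| <=
    (2 * S * s) ^+ (d x y).+1 * expR (2 * S * s).
Proof.
move=> s0; have c0 := mulr_ge0 S2 s0.
pose h k := s ^+ k / k`!%:R * genpow G k x y.
pose u k := if k == d x y then 0 else h k.
have [||cu uB] := @exp_dominated _ u (d x y).+1 ((2 * S * s) ^+ (d x y).+1) _ c0.
- move=> k; rewrite ltnS leq_eqVlt /u; case: eqP => // _ /= kd.
  by rewrite /h genpow_out ?mulr0.
- move=> k; rewrite /u ifN; last by lia.
  apply: le_trans (heat_term 0 _ _ _ s0) _; rewrite expr0 mul1r.
  apply: le_trans (le_expn_fact _ _ c0) _.
  rewrite ler_wpM2r ?divr_ge0 ?exprn_ge0// ler_pdivrMr ?ltr0n ?fact_gt0//.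
  by rewrite ler_peMr ?exprn_ge0// ler1n fact_gt0.
rewrite (_ : heat G s x y - _ = limn (series u))//.
have hu n : (d x y < n)%N -> series h n = h (d x y) + series u n.
  move=> dn; rewrite /series/= !big_mkord (bigD1 (Ordinal dn))//=.
  congr (_ + _); rewrite [RHS](bigD1 (Ordinal dn))//= {1}/u eqxx add0r.
  by apply: eq_bigr => i; rewrite /u -val_eqE/= => /negbTE ->.
have ch : series h n @[n --> \oo] --> h (d x y) + limn (series u).
  apply: (@cvg_trans _ ((fun n => h (d x y) + series u n) @ \oo)).
    by apply: near_eq_cvg; exists (d x y).+1 => // n /= /hu.
  by apply: cvgD => //; exact: cvg_cst.
by rewrite /heat (cvg_lim _ ch)// addrC addKr.
Qed.

Lemma heatn_rev j s x y : 0 <= s -> m x * heatn j s x y = m y * heatn j s y x.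
Proof.
move=> s0; have h1 := @heatn_cvg j s x y s0; have h2 := @heatn_cvg j s y x s0.
pose h u v := series (fun k => s ^+ k / k`!%:R * genpow G (j + k) u v).
have l1 : m x * h x y n @[n --> \oo] --> m x * heatn j s x y by exact: cvgMr.
have l2 : m y * h y x n @[n --> \oo] --> m y * heatn j s y x by exact: cvgMr.
rewrite -(cvg_lim (@Rhausdorff R) l1) -(cvg_lim (@Rhausdorff R) l2); congr (limn _).
apply/funext => n; rewrite /series/= !mulr_sumr; apply: eq_bigr => k _.
by rewrite !(mulrCA (m _)) genpow_rev.
Qed.

Lemma genop_heatn j s x y : 0 <= s ->
  genop G (fun v => heatn j s v y) x = heatn j.+1 s x y.
Proof.
move=> s0; rewrite /genop; apply/esym/cvg_lim => //.
rewrite (_ : series _ = (fun n => \sum_(v <- nbs G x) L x v *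
  series (fun k => s ^+ k / k`!%:R * genpow G (j + k) v y) n)).
  by apply: cvg_sum_seq => v; apply: cvgMr; exact: heatn_cvg.
apply/funext => n; rewrite /series/=.
under [RHS]eq_bigr do rewrite mulr_sumr.
rewrite exchange_big/=; apply: eq_bigr => k _.
rewrite addSn genpowS mulr_sumr; apply: eq_bigr => v _; exact: mulrCA.
Qed.

Lemma is_derive_heatn j (s : R) x y :
  is_derive s (1 : R) (fun r : R => heatn j r x y) (heatn j.+1 s x y).
Proof.
pose c i k : R := genpow G (i + k) x y / k`!%:R.
have hE i t : heatn i t x y = limn (pseries (c i) t).
  rewrite /heatn /pseries; congr (limn _); congr series; apply/funext => k.
  by rewrite /c mulrC mulrA mulrAC.
have dc i : pseries_diffs (c i) = c i.+1.
  apply/funext => k; rewrite /pseries_diffs /c addSnnS factS natrM.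
  by rewrite invfM mulrCA; congr (_ * _); rewrite mulrA mulfV ?mul1r ?pnatr_eq0.
have cv i : cvgn (pseries (c i) (`|s| + 1)).
  rewrite /pseries (_ : (fun k => _) = fun k => (`|s| + 1) ^+ k / k`!%:R * genpow G (i + k) x y).
    by apply: heatn_cvg; rewrite addr_ge0.
  by apply/funext => k; rewrite /c [RHS]mulrC mulrA mulrAC.
rewrite hE -dc; under eq_fun do rewrite hE.
apply: (@pseries_snd_diffs _ (c j) (`|s| + 1)); rewrite ?dc//.
by rewrite [ltRHS]ger0_norm ?addr_ge0// ltrDl.
Qed.

(** e^(sS) e^(sL) = e^(s(L + S)) has nonnegative entries, and the entry (x, y)
    dominates the contribution of a geodesic. *)
Lemma heat_lower I s x y : 0 <= s -> 0 <= I ->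
  (forall u v, e u v -> I <= L u v) ->
  (s * I) ^+ d x y / (d x y)`!%:R * expR (- (S * s)) <= heat G s x y.
Proof.
move=> s0 I0 LI; pose N u v := L u v + S * (u == v)%:R.
have N0 u v : 0 <= N u v.
  rewrite /N; case: eqVneq => [->|uv]; last by rewrite mulr0 addr0 gen_ge0.
  by have := gen_bound v; rewrite mulr1 ler_norml => /andP[? _]; lra.
have NI u v : e u v -> I <= N u v.
  by move=> /LI uv; apply: le_trans uv _; rewrite lerDl mulr_ge0.
have Ss := mulr_ge0 S_ge0 s0.
have := @cvg_cauchy_product _ (fun k => s ^+ k / k`!%:R * genpow G k x y)
  (exp_coeff (S * s)) (2 * S * s) (S * s) (mulr_ge0 S2 s0) Ss _ _.
set f := fun k => \sum_(i < k.+1) _.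
have -> : f = (fun k => s ^+ k / k`!%:R * kpow G N k x y).
  apply/funext => k; rewrite /f kpow_shift mulr_sumr; apply: eq_bigr => i _.
  rewrite -genpowE /exp_coeff/=.
  have f0 l : (l`!%:R : R) != 0 by rewrite pnatr_eq0 -lt0n fact_gt0.
  have C0 : ('C(k, i)%:R : R) != 0.
    by rewrite pnatr_eq0 -lt0n bin_gt0 (ltnSE (ltn_ord i)).
  rewrite -(bin_fact (ltnSE (ltn_ord i))) !natrM exprMn.
  have -> : s ^+ k = s ^+ i * s ^+ (k - i).
    by rewrite -exprD subnKC// (ltnSE (ltn_ord i)).
  by field; rewrite !f0 C0.
move=> cN.
have {}cN := cN (fun k => ltac:(by have := heat_term 0 x y k s0; rewrite expr0 mul1r))
  (fun k => ltac:(by rewrite ger0_norm ?exp_coeff_ge0)).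
rewrite -/(heat G s x y) -/(expR (S * s)) in cN.
have t0 k : 0 <= s ^+ k / k`!%:R * kpow G N k x y.
  by rewrite mulr_ge0 ?divr_ge0 ?exprn_ge0 ?kpow_ge0.
have nd : {homo series (fun k => s ^+ k / k`!%:R * kpow G N k x y) :
    n p / (n <= p)%N >-> n <= p}.
  by apply: nondecreasing_series => k _ _; exact: t0.
have := nondecreasing_cvgn_le nd (cvgP _ cN) (d x y).+1.
rewrite (cvg_lim _ cN)// => le.
rewrite expRN ler_pdivrMr ?expR_gt0//; apply: le_trans le.
rewrite /series/= big_nat_recr//= exprMn mulrAC.
apply: (@le_trans _ _ (s ^+ d x y / (d x y)`!%:R * kpow G N (d x y) x y)).
  rewrite ler_wpM2l ?divr_ge0 ?exprn_ge0//; apply: kpow_walk => //.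
  exact: gdist_walk.
by rewrite lerDr sumr_ge0.
Qed.

End Heat.

(** * Comparing the heat kernel with its time derivatives *)

Section HeatBounds.
Context (R : realType) (X : countType) (G : graph_space R X) (S I : R).
Local Notation e := (adj G).
Local Notation d := (gdist G).
Local Notation m := (mass G).
Local Notation L := (gen G).
Hypothesis (S_ge1 : 1 <= S) (gen_bound : forall x, `|L x x| <= S).
Hypothesis (I_gt0 : 0 < I) (I_le1 : I <= 1).
Hypothesis (gen_lbound : forall x y, e x y -> I <= L x y).

Let S_ge0 : 0 <= S. Proof. exact: le_trans ler01 S_ge1. Qed.
Let S2 : 1 <= 2 * S. Proof. by move: S_ge1; lra. Qed.
Let S20 : 0 <= 2 * S. Proof. exact: le_trans ler01 S2. Qed.

Lemma heat_gt0 s x y : 0 < s -> 0 < heat G s x y.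
Proof.
move=> s0; apply: lt_le_trans (heat_lower S_ge0 gen_bound x y (ltW s0) (ltW I_gt0) gen_lbound).
by rewrite mulr_gt0 ?expR_gt0// divr_gt0 ?exprn_gt0 ?mulr_gt0 ?ltr0n ?fact_gt0.
Qed.

(** The base of the exponential rate, in the distance, at which the ratio between
    a time derivative of the kernel and the kernel may grow. *)
Definition growth : R := 4 * S / I.

Lemma growth_ge1 : 1 <= growth.
Proof. by rewrite /growth ler_pdivlMr// mul1r; move: S_ge1 I_le1; lra. Qed.

Let bin_le n j : ('C(n, j) <= 2 ^ n)%N.
Proof.
elim: n j => [|n IH] [|j]; rewrite ?bin0 ?expn_gt0//.
by rewrite binS expnS mul2n -addnn leq_add.
Qed.

Let fact_sub_le n j : (n`! <= j`! * 2 ^ n * (n - j)`!)%N.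
Proof.
have [nj|/ltnW jn] := leqP n j.
  have -> : (n - j = 0)%N by apply/eqP; rewrite subn_eq0.
  rewrite muln1; apply: (@leq_trans j`!); last by rewrite leq_pmulr ?expn_gt0.
  move: nj; rewrite leq_eqVlt => /predU1P[->//|].
  by case: n => [|n] nj; rewrite ?fact_gt0// ltnW// ltn_fact.
rewrite -{1}(bin_fact jn) mulnA leq_mul2r; apply/orP; right.
by rewrite mulnC leq_mul2l bin_le orbT.
Qed.

Let exp_term_le (c : R) n : 0 <= c -> c ^+ n / n`!%:R <= expR c.
Proof.
move=> c0; have nd : {homo series (exp_coeff c) : k p / (k <= p)%N >-> k <= p}.
  by apply: nondecreasing_series => k _ _; exact: exp_coeff_ge0.
apply: le_trans (nondecreasing_cvgn_le nd (is_cvg_series_exp_coeff c) n.+1).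
rewrite /series/= big_nat_recr//= lerDr sumr_ge0// => k _.
exact: exp_coeff_ge0.
Qed.

Definition ratio_const j : R := (2 * S) ^+ j * j`!%:R * expR (3 * S).

Lemma ratio_const_ge0 j : 0 <= ratio_const j.
Proof. by rewrite !mulr_ge0 ?exprn_ge0 ?expR_ge0. Qed.

(** Near time 0 the kernel and its derivatives behave like s^d / d!, so each
    time derivative costs at most a factor of order 1 / s, up to constants that
    are exponential in the distance. *)
Lemma heatn_ratio j s x y : 0 < s -> s <= 1 ->
  s ^+ j * `|heatn G j s x y| <= ratio_const j * growth ^+ d x y * heat G s x y.
Proof.
move=> s0 s1; have s0' := ltW s0.
have f0 l : 0 < (l`!%:R : R) by rewrite ltr0n fact_gt0.
set D := d x y.
have low := heat_lower S_ge0 gen_bound x y s0' (ltW I_gt0) gen_lbound.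
have up := heatn_bound S_ge0 gen_bound j x y s0'.
apply: (@le_trans _ _ (ratio_const j * growth ^+ D *
  ((s * I) ^+ D / D`!%:R * expR (- (S * s))))); last first.
  by rewrite ler_wpM2l ?mulr_ge0 ?ratio_const_ge0 ?exprn_ge0// (le_trans ler01 growth_ge1).
apply: (@le_trans _ _ (s ^+ j * ((2 * S) ^+ j * ((2 * S * s) ^+ (D - j) / (D - j)`!%:R)
    * expR (2 * S * s)))).
  by rewrite ler_wpM2l// exprn_ge0.
have -> : ratio_const j * growth ^+ D * ((s * I) ^+ D / D`!%:R * expR (- (S * s)))
  = (2 * S) ^+ j * (expR (3 * S) * expR (- (S * s))) *
    ((2 * (2 * S) * s) ^+ D * (j`!%:R / D`!%:R)).
  have -> : 2 * (2 * S) * s = growth * (s * I).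
    by rewrite /growth; field; rewrite gt_eqF.
  rewrite [(growth * _) ^+ D]exprMn /ratio_const; ring.
rewrite -expRD.
have -> : s ^+ j * ((2 * S) ^+ j * ((2 * S * s) ^+ (D - j) / (D - j)`!%:R)
    * expR (2 * S * s)) = (2 * S) ^+ j * expR (2 * S * s) *
   (((2 * S) ^+ (D - j) * (s ^+ (D - j) * s ^+ j)) / (D - j)`!%:R).
  by rewrite [(2 * S * s) ^+ _]exprMn; ring.
apply: ler_pM.
- by rewrite mulr_ge0 ?exprn_ge0 ?expR_ge0.
- by rewrite divr_ge0 ?mulr_ge0 ?exprn_ge0.
- rewrite ler_wpM2l ?exprn_ge0// ler_expR -subr_ge0.
  have -> : 3 * S - S * s - 2 * S * s = 3 * S * (1 - s) by ring.
  by rewrite !mulr_ge0// subr_ge0.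
rewrite ler_pdivrMr//.
have -> : (2 * (2 * S) * s) ^+ D * (j`!%:R / D`!%:R) * (D - j)`!%:R =
  ((2 * S) ^+ D * s ^+ D) * ((j`! * 2 ^ D * (D - j)`!)%N%:R / D`!%:R).
  by rewrite !natrM natrX [(2 * (2 * S) * s) ^+ D]exprMn [(2 * (2 * S)) ^+ D]exprMn; ring.
apply: (@le_trans _ _ ((2 * S) ^+ D * s ^+ D)); last first.
  rewrite ler_peMr ?mulr_ge0 ?exprn_ge0// ler_pdivlMr// mul1r ler_nat.
  exact: fact_sub_le.
apply: ler_pM; rewrite ?mulr_ge0 ?exprn_ge0//.
  by rewrite ler_weXn2l// leq_subr.
rewrite -exprD; apply: ler_wiXn2l => //.
by rewrite addnC -leq_subLR.
Qed.

(** Over a time horizon c, each unit of distance that is not absorbed by a power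
    of L costs a factor c. *)
Lemma heatn_small j s c x y : 0 <= s -> s <= c -> c <= 1 ->
  `|heatn G j s x y| <= (2 * S) ^+ j * expR (4 * S) * c ^+ (d x y - j).
Proof.
move=> s0 sc c1; apply: le_trans (heatn_bound S_ge0 gen_bound j x y s0) _.
set n := (d x y - j)%N; have c0 := le_trans s0 sc.
have -> : expR (4 * S) = expR (2 * S) * expR (2 * S).
  by rewrite -expRD; congr expR; ring.
have -> : (2 * S) ^+ j * (expR (2 * S) * expR (2 * S)) * c ^+ n =
  (2 * S) ^+ j * (expR (2 * S) * c ^+ n) * expR (2 * S) by ring.
apply: ler_pM; rewrite ?expR_ge0 ?mulr_ge0 ?divr_ge0 ?exprn_ge0 ?mulr_ge0//.
  rewrite ler_wpM2l ?exprn_ge0// [(2 * S * s) ^+ n]exprMn mulrAC.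
  by rewrite ler_pM ?divr_ge0 ?exprn_ge0// ?exp_term_le// lerXn2r ?nnegrE.
by rewrite ler_expR ler_piMr// (le_trans sc).
Qed.

End HeatBounds.

(** * Finite superpositions of heat kernels *)

Section Superposition.
Context (R : realType) (X : countType) (G : graph_space R X) (S I : R).
Local Notation e := (adj G).
Local Notation d := (gdist G).
Local Notation m := (mass G).
Local Notation L := (gen G).
Local Notation K := (growth S I).
Hypothesis (S_ge1 : 1 <= S) (gen_bound : forall x, `|L x x| <= S).
Hypothesis (I_gt0 : 0 < I) (I_le1 : I <= 1).
Hypothesis (gen_lbound : forall x y, e x y -> I <= L x y).
Variables (x0 : X) (D : nat) (r : seq X) (h : X -> R).
Hypothesis (rD : forall x, x \in r -> (d x0 x <= D)%N).
Hypothesis (h_ge0 : forall x, 0 <= h x).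

Let S_ge0 : 0 <= S. Proof. exact: le_trans ler01 S_ge1. Qed.
Let K_ge1 : 1 <= K. Proof. exact: growth_ge1. Qed.

(** L^j e^(sL) applied to the function equal to h on r and to 0 elsewhere. *)
Definition hsum (j : nat) (s : R) (z : X) : R :=
  \sum_(x <- r) h x * heatn G j s z x.

Lemma hsum_gt0 s z x1 : x1 \in r -> 0 < h x1 -> 0 < s -> 0 < hsum 0 s z.
Proof.
move=> x1r hx1 s0; have h0 x : 0 < heat G s z x.
  exact: (heat_gt0 S_ge1 gen_bound I_gt0 gen_lbound).
rewrite /hsum (perm_big _ (perm_to_rem x1r)) big_cons ltr_pwDl//.
  exact: mulr_gt0 (h0 x1).
by apply: sumr_ge0 => x _; exact: mulr_ge0 (h_ge0 x) (ltW (h0 x)).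
Qed.

Lemma hsum_ge0 s z : 0 < s -> 0 <= hsum 0 s z.
Proof.
move=> s0; apply: sumr_ge0 => x _; apply: mulr_ge0 => //; apply: ltW.
exact: (heat_gt0 S_ge1 gen_bound I_gt0 gen_lbound).
Qed.

Lemma is_derive_hsum j (s : R) z :
  is_derive s (1 : R) (fun u : R => hsum j u z) (hsum j.+1 s z).
Proof.
rewrite /hsum; elim: r => [|x r' IH].
  rewrite big_nil; under eq_fun do rewrite big_nil; exact: is_derive_cst.
rewrite big_cons; under eq_fun do rewrite big_cons.
apply: (@is_deriveD _ _ _ (fun u => h x * heatn G j u z x)) => //.
have := @is_deriveZ _ _ _ (fun u : R => heatn G j u z x) (h x) s 1 _
  (is_derive_heatn S_ge0 gen_bound j s z x).
exact.
Qed.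

Lemma genop_hsum j s z : 0 <= s -> genop G (hsum j s) z = hsum j.+1 s z.
Proof.
move=> s0; rewrite /genop /hsum; under eq_bigr do rewrite mulr_sumr.
rewrite exchange_big/=; apply: eq_bigr => x _.
rewrite -(genop_heatn S_ge0 gen_bound)// /genop mulr_sumr.
by apply: eq_bigr => v _; rewrite mulrCA.
Qed.

Let growth_le z x : x \in r -> K ^+ d z x <= K ^+ D * K ^+ d x0 z.
Proof.
move=> xr; rewrite -exprD ler_weXn2l//.
by have := gdist_triangle G x0 z x; rewrite (gdist_sym G z x0) => /leq_trans; apply;
   rewrite addnC leq_add2r rD.
Qed.

Lemma hsum_ratio j s z : 0 < s -> s <= 1 ->
  s ^+ j * `|hsum j s z| <= ratio_const S j * K ^+ D * K ^+ d x0 z * hsum 0 s z.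
Proof.
move=> s0 s1; have c0 : 0 <= ratio_const S j by exact: ratio_const_ge0.
apply: (@le_trans _ _ (\sum_(x <- r) h x * (s ^+ j * `|heatn G j s z x|))).
  rewrite -[in leLHS](ger0_norm (exprn_ge0 j (ltW s0))) -normrM mulr_sumr.
  apply: le_trans (ler_norm_sum _ _ _) _; apply: ler_sum => x _.
  by rewrite !normrM mulrCA !(ger0_norm (h_ge0 x)) (ger0_norm (exprn_ge0 j (ltW s0))).
rewrite mulr_sumr big_seq [leRHS]big_seq; apply: ler_sum => x xr.
rewrite [leRHS]mulrCA ler_wpM2l//.
have := heatn_ratio S_ge1 gen_bound I_gt0 I_le1 gen_lbound j z x s0 s1.
move=> /le_trans; apply; rewrite heatn0; apply: ler_wpM2r.
  by apply: ltW; exact: (heat_gt0 S_ge1 gen_bound I_gt0 gen_lbound).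
by rewrite -mulrA ler_wpM2l// growth_le.
Qed.

Let nat_aux a b c j k :
  (c <= b + a)%N -> (b <= k)%N -> (c <= j + k + (a - j))%N.
Proof. by lia. Qed.

(** Reversibility replaces the mass of z by the masses of the finitely many
    sources, which makes the bound uniform in z. *)
Lemma mass_hsum_bound j s c z : 0 <= s -> s <= c -> c <= 1 ->
  c ^+ (j + D) * (m z * `|hsum j s z|) <=
  (2 * S) ^+ j * expR (4 * S) * (\sum_(x <- r) h x * m x) * c ^+ d x0 z.
Proof.
move=> s0 sc c1; have c0 := le_trans s0 sc.
have mz := ltW (mass_gt0 G z).
apply: (@le_trans _ _ (\sum_(x <- r) h x * (c ^+ (j + D) * (m x * `|heatn G j s x z|)))).
  rewrite -[m z](ger0_norm mz) -normrM -[in leLHS](ger0_norm (exprn_ge0 (j + D) c0)).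
  rewrite -normrM !mulr_sumr; apply: le_trans (ler_norm_sum _ _ _) _.
  apply: ler_sum => x _; rewrite (mulrCA (m z)) (heatn_rev S_ge0 gen_bound _ _ _ s0).
  rewrite !normrM (ger0_norm (exprn_ge0 _ c0)) (ger0_norm (h_ge0 x)).
  by rewrite (ger0_norm (ltW (mass_gt0 G x))) mulrCA.
rewrite -[leRHS]mulrA [leRHS]mulrCA [leRHS]mulr_suml.
rewrite big_seq [leRHS]big_seq; apply: ler_sum => x xr.
rewrite -!mulrA ler_wpM2l//.
rewrite [leLHS]mulrCA; apply: ler_wpM2l; first exact: ltW (mass_gt0 G x).
have hs := heatn_small S_ge1 gen_bound j x z s0 sc c1.
apply: (@le_trans _ _ (c ^+ (j + D) * ((2 * S) ^+ j * expR (4 * S) * c ^+ (d x z - j)))).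
  by rewrite ler_wpM2l// exprn_ge0.
rewrite [leLHS]mulrCA [leRHS]mulrA; apply: ler_wpM2l.
  by rewrite mulr_ge0 ?exprn_ge0 ?expR_ge0// mulr_ge0.
rewrite -exprD ler_wiXn2l//.
exact: nat_aux (gdist_triangle G x x0 z) (rD xr).
Qed.

Lemma hsum_le s z : 0 <= s -> s <= 1 ->
  hsum 0 s z <= expR (4 * S) * \sum_(x <- r) h x.
Proof.
move=> s0 s1; rewrite mulr_sumr; apply: ler_sum => x _.
rewrite mulrC ler_wpM2r//; apply: le_trans (ler_norm _) _.
have := heatn_small S_ge1 gen_bound 0 z x s0 s1 (lexx 1).
by rewrite expr0 mul1r expr1n mulr1.
Qed.

End Superposition.

(** * Differentiating the entropy density *)

Section EntropyDerivatives.
Context (R : realType).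
Implicit Types (F H : R -> R) (t : R).

Let dM (f g : R -> R) t (a b : R) : is_derive t (1 : R) f a ->
  is_derive t (1 : R) g b ->
  is_derive t (1 : R) (fun s : R => f s * g s) (f t * b + g t * a).
Proof. by move=> fa gb; exact: is_deriveM. Qed.

Let dD (f g : R -> R) t (a b : R) : is_derive t (1 : R) f a ->
  is_derive t (1 : R) g b ->
  is_derive t (1 : R) (fun s : R => f s + g s) (a + b).
Proof. by move=> fa gb; exact: is_deriveD. Qed.

Let dN (f : R -> R) t (a : R) : is_derive t (1 : R) f a ->
  is_derive t (1 : R) (fun s : R => - f s) (- a).
Proof. by move=> fa; exact: is_deriveN. Qed.

Let dC (c t : R) : is_derive t (1 : R) (fun=> c) 0.
Proof. exact: is_derive_cst. Qed.

Let dE (f : R -> R) t (a b : R) : is_derive t (1 : R) f a -> a = b ->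
  is_derive t (1 : R) f b.
Proof. by move=> ? <-. Qed.

Let dln F t (a : R) : 0 < F t -> is_derive t (1 : R) F a ->
  is_derive t (1 : R) (fun s : R => ln (F s)) ((F t)^-1 * a).
Proof.
by move=> F0 dF; exact: (@is_derive1_comp _ (@ln R) F t _ _ (is_derive1_ln F0) dF).
Qed.

Lemma is_derive_entropy F H t (F1 H1 m : R) : 0 < F t ->
  is_derive t (1 : R) F F1 -> is_derive t (1 : R) H (- H1) ->
  is_derive t (1 : R) (fun s : R => ln (F s) * F s * H s * m)
    (m * ((ln (F t) + 1) * F1 * H t - F t * ln (F t) * H1)).
Proof.
move=> F0 dF dH; apply: dE (dM (dM (dM (dln F0 dF) dF) dH) (dC m t)) _.
by field; rewrite gt_eqF.
Qed.

Lemma is_derive_entropy2 F H (F1 H1 : R -> R) t (F2 H2 m : R) : 0 < F t ->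
  is_derive t (1 : R) F (F1 t) -> is_derive t (1 : R) H (- H1 t) ->
  is_derive t (1 : R) F1 F2 -> is_derive t (1 : R) H1 (- H2) ->
  is_derive t (1 : R)
    (fun s : R => m * ((ln (F s) + 1) * F1 s * H s - F s * ln (F s) * H1 s))
    (m * ((ln (F t) + 1) * F2 * H t + F1 t ^+ 2 / F t * H t
          - 2 * ((ln (F t) + 1) * F1 t * H1 t) + F t * ln (F t) * H2)).
Proof.
move=> F0 dF dH dF1 dH1; have dl := dln F0 dF.
have d1 := dM (dM (dD dl (dC 1 t)) dF1) dH; have d2 := dM (dM dF dl) dH1.
apply: dE (dM (dC m t) (dD d1 (dN d2))) _.
by field; rewrite gt_eqF.
Qed.

Lemma ln_le_sub1 (x : R) : 0 < x -> ln x <= x - 1.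
Proof.
move=> x0; have := @le_ln1Dx R (x - 1).
have -> : 1 + (x - 1) = x by ring.
by apply; lra.
Qed.

Lemma abs_xlnx_le (x : R) : 0 < x -> `|x * ln x| <= 1 + x ^+ 2.
Proof.
move=> x0; have h1 := ln_le_sub1 x0.
have h2 : - ln x <= x^-1 - 1 by rewrite -lnV// ln_le_sub1// invr_gt0.
have h3 : x * - ln x <= 1.
  apply: le_trans (ler_wpM2l (ltW x0) h2) _.
  by rewrite mulrBr mulfV ?gt_eqF// mulr1 lerBlDr lerDl ltW.
have h4 : x * ln x <= x ^+ 2.
  rewrite expr2 ler_wpM2l ?(ltW x0)//; lra.
by rewrite ler_norml; apply/andP; split; have := sqr_ge0 x; lra.
Qed.

Lemma entropy_bounds (F0 B : R) : 0 < F0 -> F0 <= B -> 1 <= B ->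
  `|F0 * ln F0| <= 3 * B ^+ 2 /\ `|ln F0 + 1| * F0 <= 3 * B ^+ 2.
Proof.
move=> F00 FB B1; have xl := abs_xlnx_le F00.
have F2B : F0 ^+ 2 <= B ^+ 2 by rewrite lerXn2r// nnegrE ltW// (lt_le_trans F00).
have B1' : 1 <= B ^+ 2 by rewrite exprn_ege1.
have BB : B <= B ^+ 2 by rewrite expr2 ler_peMl// (le_trans ler01).
split; first by lra.
rewrite -{2}(ger0_norm (ltW F00)) -normrM mulrDl mul1r.
apply: le_trans (ler_normD _ _) _; rewrite mulrC (ger0_norm (ltW F00)); lra.
Qed.

Let norm_mulM (a b m hh c : R) : 0 < m -> `|a| <= c -> m * `|b| <= hh ->
  `|a * (m * b)| <= c * hh.
Proof.
by move=> m0 ac bh; rewrite normrM ler_pM// normrM (ger0_norm (ltW m0)).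
Qed.

Lemma entropy_derive_bound (m F0 F1 H0 H1 k hh B : R) :
  0 < m -> 0 < F0 -> F0 <= B -> 1 <= B -> 1 <= k -> `|F1| <= k * F0 ->
  m * `|H0| <= hh -> m * `|H1| <= hh ->
  `|m * ((ln F0 + 1) * F1 * H0 - F0 * ln F0 * H1)| <= 15 * B ^+ 2 * k ^+ 2 * hh.
Proof.
move=> m0 F00 FB B1 k1 F1k H0h H1h.
have [b1 b2] := entropy_bounds F00 FB B1.
have B20 := sqr_ge0 B.
have hh0 : 0 <= hh by apply: le_trans H0h; rewrite mulr_ge0// ltW.
have -> : m * ((ln F0 + 1) * F1 * H0 - F0 * ln F0 * H1) =
  ((ln F0 + 1) * F1) * (m * H0) + - (F0 * ln F0) * (m * H1) by ring.
have c1 : `|(ln F0 + 1) * F1| <= 3 * B ^+ 2 * k.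
  rewrite normrM; apply: le_trans (ler_wpM2l (normr_ge0 _) F1k) _.
  by rewrite mulrCA mulrC ler_wpM2r// (le_trans ler01).
have c2 : `|- (F0 * ln F0)| <= 3 * B ^+ 2 by rewrite normrN.
apply: le_trans (ler_normD _ _) _.
apply: le_trans (lerD (norm_mulM m0 c1 H0h) (norm_mulM m0 c2 H1h)) _.
rewrite -mulrDl ler_wpM2r//.
have kk : k <= k ^+ 2 by rewrite expr2 ler_peMl// (le_trans ler01).
have Bk := ler_wpM2l B20 kk; have Bk1 := ler_wpM2l B20 k1.
by move: Bk Bk1 B20; rewrite -!mulrA; lra.
Qed.

(** Here k will grow exponentially in the distance while hh decays exponentially;
    the quotient of F1^2 by F0 is what brings the square of k. *)
Lemma entropy_derive2_bound (m F0 F1 F2 H0 H1 H2 k hh B : R) :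
  0 < m -> 0 < F0 -> F0 <= B -> 1 <= B -> 1 <= k -> `|F1| <= k * F0 ->
  `|F2| <= k * F0 ->
  m * `|H0| <= hh -> m * `|H1| <= hh -> m * `|H2| <= hh ->
  `|m * ((ln F0 + 1) * F2 * H0 + F1 ^+ 2 / F0 * H0
          - 2 * ((ln F0 + 1) * F1 * H1) + F0 * ln F0 * H2)| <=
  15 * B ^+ 2 * k ^+ 2 * hh.
Proof.
move=> m0 F00 FB B1 k1 F1k F2k H0h H1h H2h.
have [b1 b2] := entropy_bounds F00 FB B1.
have B20 := sqr_ge0 B; have k0 := le_trans ler01 k1.
have hh0 : 0 <= hh by apply: le_trans H0h; rewrite mulr_ge0// ltW.
have -> : m * ((ln F0 + 1) * F2 * H0 + F1 ^+ 2 / F0 * H0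
          - 2 * ((ln F0 + 1) * F1 * H1) + F0 * ln F0 * H2) =
  ((ln F0 + 1) * F2) * (m * H0) + (F1 ^+ 2 / F0) * (m * H0) +
  (- (2 * ((ln F0 + 1) * F1))) * (m * H1) + (F0 * ln F0) * (m * H2) by ring.
have c1 f : `|f| <= k * F0 -> `|(ln F0 + 1) * f| <= 3 * B ^+ 2 * k.
  move=> fk; rewrite normrM; apply: le_trans (ler_wpM2l (normr_ge0 _) fk) _.
  by rewrite mulrCA mulrC ler_wpM2r.
have c3 : `|- (2 * ((ln F0 + 1) * F1))| <= 2 * (3 * B ^+ 2 * k).
  by rewrite normrN normrM ger0_norm// ler_wpM2l// c1.
have c4 : `|F1 ^+ 2 / F0| <= B ^+ 2 * k ^+ 2.
  rewrite normrM normrX normfV (ger0_norm (ltW F00)) ler_pdivrMr//.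
  apply: (@le_trans _ _ ((k * F0) ^+ 2)).
    by rewrite lerXn2r ?nnegrE// mulr_ge0// ltW.
  rewrite exprMn [F0 ^+ 2]expr2 mulrA ler_wpM2r ?(ltW F00)// mulrC.
  rewrite ler_wpM2r ?sqr_ge0//; apply: le_trans FB _.
  by rewrite expr2 ler_peMl// (le_trans ler01).
apply: le_trans (ler_normD _ _) _.
apply: le_trans (lerD (ler_normD _ _) (norm_mulM m0 b1 H2h)) _.
rewrite -!addrA.
apply: le_trans (lerD (ler_normD _ _) (lexx _)) _.
apply: (@le_trans _ _ ((3 * B ^+ 2 * k * hh + B ^+ 2 * k ^+ 2 * hh) +
  (2 * (3 * B ^+ 2 * k) * hh + 3 * B ^+ 2 * hh))).
  apply: lerD; first exact: lerD (norm_mulM m0 (c1 _ F2k) H0h) (norm_mulM m0 c4 H0h).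
  by apply: lerD => //; exact: norm_mulM.
rewrite -!mulrDl ler_wpM2r//.
have kk : k <= k ^+ 2 by rewrite expr2 ler_peMl.
have k2 : 1 <= k ^+ 2 by rewrite exprn_ege1.
have Bk := ler_wpM2l B20 kk; have Bk1 := ler_wpM2l B20 k2.
by move: Bk Bk1 B20; rewrite -!mulrA; lra.
Qed.

End EntropyDerivatives.

(** * The dissipation rate and reversibility *)

Section EntropyDissipation.
Context (R : realType) (X : countType) (G : graph_space R X).
Local Notation e := (adj G).
Local Notation d := (gdist G).
Local Notation m := (mass G).
Local Notation L := (gen G).

(** As gamma tends to 0, the lower limit of this expression is at least the
    integrand of the theorem.  The sums include the steps v = z and w = v, which come from the
    diagonal of L. *)
Definition dissipation_rate (gamma : R) (F : X -> R) (z : X) : R :=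
  (\sum_(v <- nbs G z) L z v * (gamma * (F v / F z))) ^+ 2 +
  \sum_(v <- nbs G z) \sum_(w <- nbs G v)
    L z v * L v w * rho (gamma * (F v / F z)) (gamma ^+ 2 * (F w / F z)).

Let genop2E (c : R) (U W : X -> R) z :
  c * genop G (fun v => W v * (c * genop G U v)) z =
  \sum_(v <- nbs G z) \sum_(w <- nbs G v) L z v * L v w * (c ^+ 2 * (W v * U w)).
Proof.
rewrite /genop mulr_sumr; apply: eq_bigr => v _.
rewrite !mulr_sumr; apply: eq_bigr => w _; ring.
Qed.

(** In ln b - 2 ln a the logarithms of gamma cancel, and those of F z, F v and F w
    each produce one of the iterated generators. *)
Lemma dissipation_rateE (c : R) (F : X -> R) z : 0 < c -> (forall v, 0 < F v) ->
  F z * dissipation_rate c F z =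
  (ln (F z) + 1) * (c * genop G (fun v => c * genop G F v) z)
  + (c * genop G F z) ^+ 2 / F z
  - 2 * (c * genop G (fun v => (ln (F v) + 1) * (c * genop G F v)) z)
  + c * genop G (fun v => c * genop G (fun w => F w * ln (F w)) v) z.
Proof.
move=> c0 F0; have Fz : F z != 0 by rewrite gt_eqF.
have E (U : X -> R) : genop G (fun v => c * genop G U v) z =
    genop G (fun v => 1 * (c * genop G U v)) z.
  by apply: eq_bigr => v _; rewrite mul1r.
rewrite !E !genop2E /dissipation_rate mulrDr.
have -> : F z * (\sum_(v <- nbs G z) L z v * (c * (F v / F z))) ^+ 2 =
    (c * genop G F z) ^+ 2 / F z.
  have -> : \sum_(v <- nbs G z) L z v * (c * (F v / F z)) = (c * genop G F z) / F z.
    rewrite /genop mulr_sumr mulr_suml; apply: eq_bigr => v _; ring.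
  by move: (c * genop G F z) => a; field.
have -> (a b1 b2 b3 : R) : a + b1 - b2 + b3 = b1 + (a - b2 + b3) by ring.
congr (_ + _).
rewrite !mulr_sumr -sumrB -big_split/=; apply: eq_bigr => v _.
rewrite !mulr_sumr -sumrB -big_split/=; apply: eq_bigr => w _.
have pr x : 0 < F x / F z by rewrite divr_gt0.
have p1 : 0 < c * (F v / F z) by rewrite mulr_gt0.
have p2 : 0 < c ^+ 2 * (F w / F z) by rewrite mulr_gt0 ?exprn_gt0.
have lnr x : ln (F x / F z) = ln (F x) - ln (F z).
  by rewrite lnM ?posrE ?invr_gt0// lnV ?posrE.
have l1 : ln (c * (F v / F z)) = ln c + (ln (F v) - ln (F z)).
  by rewrite -lnr lnM ?posrE.
have l2 : ln (c ^+ 2 * (F w / F z)) = ln c + ln c + (ln (F w) - ln (F z)).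
  by rewrite -lnr -lnM ?posrE// -expr2 lnM ?posrE ?exprn_gt0.
by rewrite /rho p1 p2/= l1 l2; field.
Qed.

(** Self-adjointness of L for the measure m: the domination allows exchanging the
    two sums, and detailed balance exchanges the roles of u and v. *)
Lemma csum_genop_sym (c : R) (u v M : X -> R) : absum M ->
  (forall x, (\sum_(y <- nbs G x) `|L x y * v y|) * (m x * `|u x|) <= M x) ->
  csum (fun x => m x * v x * (c * genop G u x)) =
  csum (fun x => m x * u x * (c * genop G v x)).
Proof.
move=> aM uvM; pose K x y := c * (m x * (L x y * v y) * u x).
have KE x : csum (K x) = m x * u x * (c * genop G v x).
  rewrite (@csum_seq _ _ (nbs G x)) ?nbs_uniq//; last first.
    by move=> y /gen_out; rewrite /K => ->; rewrite mul0r mulr0 mul0r mulr0.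
  rewrite /genop !mulr_sumr; apply: eq_bigr => y _; rewrite /K; ring.
have KE' y : csum (K ^~ y) = m y * v y * (c * genop G u y).
  rewrite (@csum_seq _ _ (nbs G y)) ?nbs_uniq//; last first.
    move=> x; rewrite nbs_sym => /gen_out; rewrite /K => ->.
    by rewrite mul0r mulr0 mul0r mulr0.
  rewrite /genop !mulr_sumr; apply: eq_bigr => x _; rewrite /K mulrA.
  rewrite (mulrA (m x)) gen_reversible; ring.
rewrite -(eq_csum KE) -(eq_csum KE') -csum_swap//.
apply: le_lt_trans (absumZ `|c| aM); apply: le_esum => x _.
rewrite (_ : (\esum_(y in [set: X]) _)%E = (\esum_(y in [set` nbs G x]) `|K x y|%:E)%E).
  rewrite esum_fset; [|exact: finite_seq|by move=> y _; rewrite lee_fin].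
  rewrite -fsbig_seq ?nbs_uniq// sumEFin lee_fin.
  apply: le_trans (ler_norm _); apply: le_trans (ler_wpM2l (normr_ge0 c) (uvM x)).
  rewrite mulr_suml mulr_sumr ler_sum// => y _.
  rewrite !normrM (ger0_norm (ltW (mass_gt0 G x))) le_eqVlt.
  by apply/orP; left; apply/eqP; ring.
rewrite [RHS]esum_mkcond; apply: eq_esum => y _.
case: ifPn => //; rewrite mem_setE => /gen_out; rewrite /K => ->.
by rewrite mul0r mulr0 mul0r mulr0 normr0.
Qed.

Lemma sum_gen_le (S b : R) (v : X -> R) x : (forall x, `|L x x| <= S) ->
  0 <= b -> (forall y, y \in nbs G x -> `|v y| <= b) ->
  \sum_(y <- nbs G x) `|L x y * v y| <= 2 * S * b.
Proof.
move=> LS b0 vb; apply: (@le_trans _ _ ((\sum_(y <- nbs G x) `|L x y|) * b)).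
  rewrite mulr_suml big_seq [leRHS]big_seq; apply: ler_sum => y yx.
  by rewrite normrM ler_wpM2l// vb.
by rewrite ler_wpM2r// (gen_row_norm LS).
Qed.

Lemma genop_le (S b : R) (v : X -> R) x : (forall x, `|L x x| <= S) ->
  0 <= b -> (forall y, y \in nbs G x -> `|v y| <= b) ->
  `|genop G v x| <= 2 * S * b.
Proof.
move=> LS b0 vb; apply: le_trans (sum_gen_le LS b0 vb).
exact: ler_norm_sum.
Qed.

End EntropyDissipation.

(** * Time reflection of derivatives *)

Section Reflection.
Context (R : realType).

Lemma derive1n2E (P P1 : R -> R) (t a : R) : 0 < t < 1 ->
  (forall s : R, 0 < s < 1 -> is_derive s (1 : R) P (P1 s)) ->
  is_derive t (1 : R) P1 a -> derive1n 2 P t = a.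
Proof.
move=> t01 dP dP1.
have nr : {near t, P1 =1 derive1 P}.
  have : \forall s \near t, s \in `]0, 1[%R by apply: near_in_itvoo; rewrite in_itv.
  by apply: filterS => s; rewrite in_itv/= => /dP[_ <-]; rewrite derive1E.
rewrite /derive1n/= derive1E -(near_eq_derive _ nr).
by have [_ ->] := dP1.
Qed.

Lemma is_derive_reflect (P : R -> R) (t a : R) : is_derive (1 - t) (1 : R) P a ->
  is_derive t (1 : R) (fun s : R => P (1 - s)) (- a).
Proof.
move=> dP; have dl : is_derive t (1 : R) (fun u : R => 1 - u) (0 - 1).
  exact: (@is_deriveB R R R (fun=> 1) (fun u : R => u) t (1 : R) 0 1
    (is_derive_cst _ _ _) (is_derive_id _ _)).
have := @is_derive1_comp _ P (fun u : R => 1 - u) t _ _ dP dl.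
by rewrite sub0r mulrN1.
Qed.

End Reflection.

(** * Slowed-down flows of finitely supported functions *)

Section Flow.
Context (R : realType) (X : countType) (G : graph_space R X) (S I : R).
Local Notation e := (adj G).
Local Notation d := (gdist G).
Local Notation m := (mass G).
Local Notation L := (gen G).
Local Notation K := (growth S I).
Hypothesis (S_ge1 : 1 <= S) (gen_bound : forall x, `|L x x| <= S).
Hypothesis (I_gt0 : 0 < I) (I_le1 : I <= 1).
Hypothesis (gen_lbound : forall x y, e x y -> I <= L x y).
Variables (x0 : X) (D : nat).
Variables (r : seq X) (h : X -> R).
Hypothesis (rD : forall x, x \in r -> (d x0 x <= D)%N).
Hypothesis (h_ge0 : forall x, 0 <= h x).
Variable (c : R).
Hypothesis (c_gt0 : 0 < c) (c_le1 : c <= 1).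

Let K_ge1 : 1 <= K. Proof. exact: growth_ge1. Qed.
Let K_ge0 : 0 <= K. Proof. exact: le_trans ler01 K_ge1. Qed.

(** The j-th time derivative of the flow of h under the slowed-down generator
    c L, that is, (c L)^j e^(c t L) h. *)
Definition flow (j : nat) (t : R) (z : X) : R := c ^+ j * hsum G r h j (c * t) z.

Lemma is_derive_flow j (t : R) z :
  is_derive t (1 : R) (fun u : R => flow j u z) (flow j.+1 t z).
Proof.
have dl : is_derive t (1 : R) (fun u : R => c * u) (c * 1).
  exact: (@is_deriveZ _ _ _ id c t 1 1 (is_derive_id _ _)).
have dh := is_derive1_comp (is_derive_hsum S_ge1 gen_bound r h j (c * t) z) dl.
have := @is_deriveZ _ _ _ _ (c ^+ j) t 1 _ dh.
by rewrite mulr1 /flow exprSr -mulrA [c * hsum _ _ _ _ _ _]mulrC.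
Qed.

Lemma is_derive_flow_rev j (t : R) z :
  is_derive t (1 : R) (fun u : R => flow j (1 - u) z) (- flow j.+1 (1 - t) z).
Proof.
exact: (@is_derive_reflect _ (fun u : R => flow j u z) _ _ (is_derive_flow j (1 - t) z)).
Qed.

Lemma genop_flow j t z : 0 <= t -> c * genop G (flow j t) z = flow j.+1 t z.
Proof.
move=> t0; rewrite /flow -(genop_hsum S_ge1 gen_bound) ?mulr_ge0 ?(ltW c_gt0)//.
rewrite /genop exprSr -mulrA !mulr_sumr; apply: eq_bigr => v _; ring.
Qed.

Lemma flow_gt0 t z x1 : x1 \in r -> 0 < h x1 -> 0 < t -> 0 < flow 0 t z.
Proof.
move=> x1r hx1 t0; rewrite /flow mul1r.
exact: (hsum_gt0 S_ge1 gen_bound I_gt0 gen_lbound h_ge0 z x1r hx1 (mulr_gt0 c_gt0 t0)).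
Qed.

Definition flow_const (delta : R) : R :=
  (1 + ratio_const S 1 + ratio_const S 2) * K ^+ D / delta ^+ 2.

Lemma flow_const_ge1 delta : 0 < delta -> delta <= 1 -> 1 <= flow_const delta.
Proof.
move=> d0 d1; have c1 := ratio_const_ge0 S_ge1 1; have c2 := ratio_const_ge0 S_ge1 2.
rewrite /flow_const ler_pdivlMr ?exprn_gt0// mul1r.
apply: (@le_trans _ _ 1); first by rewrite exprn_ile1// ltW.
have KD : 1 <= K ^+ D by rewrite exprn_ege1.
by rewrite -[leLHS]mulr1 ler_pM//; lra.
Qed.

(** The constant does not depend on c: the factor c^j compensates the singularity
    of heatn_ratio at time 0. *)
Lemma flow_ratio delta j t z : (0 < j <= 2)%N -> 0 < delta -> delta <= t ->
  t <= 1 -> `|flow j t z| <= flow_const delta * K ^+ d x0 z * flow 0 t z.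
Proof.
move=> j12 d0 dt t1; have t0 := lt_le_trans d0 dt.
have d1 := le_trans dt t1.
have ct0 : 0 < c * t by rewrite mulr_gt0.
have ct1 : c * t <= 1 by rewrite mulr_ile1// ltW.
have := hsum_ratio S_ge1 gen_bound I_gt0 I_le1 gen_lbound rD h_ge0 j z ct0 ct1.
have hs0 := hsum_ge0 S_ge1 gen_bound I_gt0 gen_lbound r h_ge0 z ct0.
have c1 := ratio_const_ge0 S_ge1 1; have c2 := ratio_const_ge0 S_ge1 2.
rewrite /flow expr0 mul1r normrM (ger0_norm (exprn_ge0 j (ltW c_gt0))).
have Kz : 0 <= K ^+ d x0 z by rewrite exprn_ge0.
have KD : 0 <= K ^+ D by rewrite exprn_ge0.
rewrite exprMn => hr.
have tj0 : 0 < t ^+ j by rewrite exprn_gt0.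
apply: (@le_trans _ _ (ratio_const S j * K ^+ D * K ^+ d x0 z * hsum G r h 0 (c * t) z / t ^+ j)).
  by rewrite ler_pdivlMr// mulrC mulrA [t ^+ j * _]mulrC.
rewrite mulrAC ler_wpM2r// mulrAC ler_wpM2r// /flow_const.
rewrite -[leLHS]mulrA -[leRHS]mulrA; apply: ler_pM => //.
- exact: ratio_const_ge0.
- by rewrite mulr_ge0// invr_ge0 ltW.
- by case: j j12 {hr tj0} => [|[|[|]]]// _; lra.
rewrite ler_wpM2l// lef_pV2 ?posrE ?exprn_gt0//.
apply: (@le_trans _ _ (delta ^+ j)); last by rewrite lerXn2r// nnegrE ltW.
by apply: ler_wiXn2l => //; [exact: ltW|case/andP: j12].
Qed.

Definition decay_const : R := (2 * S) ^+ 2 * expR (4 * S) * \sum_(x <- r) h x * m x.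

Lemma mass_flow j t z : (j <= 2)%N -> 0 <= t -> t <= 1 ->
  c ^+ D * (m z * `|flow j t z|) <= decay_const * c ^+ d x0 z.
Proof.
move=> j2 t0 t1; have c0 := ltW c_gt0.
have ct0 : 0 <= c * t by rewrite mulr_ge0.
have ctc : c * t <= c by rewrite ger_pMr.
have := mass_hsum_bound S_ge1 gen_bound I_gt0 I_le1 rD h_ge0 j z ct0 ctc c_le1.
rewrite /flow normrM (ger0_norm (exprn_ge0 j c0)) => hb.
rewrite (mulrCA (m z)) [leLHS]mulrA -exprD addnC; apply: le_trans hb _.
rewrite ler_wpM2r ?exprn_ge0// ler_wpM2r//.
  by rewrite sumr_ge0// => x _; rewrite mulr_ge0// ltW// mass_gt0.
rewrite ler_wpM2r ?expR_ge0// ler_weXn2l//.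
by move: S_ge1; lra.
Qed.

Lemma flow0_le t z : 0 <= t -> t <= 1 ->
  flow 0 t z <= expR (4 * S) * \sum_(x <- r) h x.
Proof.
move=> t0 t1; rewrite /flow mul1r.
apply: (hsum_le S_ge1 gen_bound r h_ge0 z); first by rewrite mulr_ge0// ltW.
by rewrite mulr_ile1// ltW.
Qed.

End Flow.

(** * The second derivative of the entropy *)

Section SecondDerivative.
Context (R : realType) (X : countType) (G : graph_space R X) (S I : R).
Local Notation e := (adj G).
Local Notation d := (gdist G).
Local Notation m := (mass G).
Local Notation L := (gen G).
Local Notation K := (growth S I).
Hypothesis (S_ge1 : 1 <= S) (gen_bound : forall x, `|L x x| <= S).
Hypothesis (I_gt0 : 0 < I) (I_le1 : I <= 1).
Hypothesis (gen_lbound : forall x y, e x y -> I <= L x y).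
Variables (x0 : X) (D : nat).
Variables (r r' : seq X) (f g : X -> R).
Hypothesis (rD : forall x, x \in r -> (d x0 x <= D)%N).
Hypothesis (rD' : forall x, x \in r' -> (d x0 x <= D)%N).
Hypothesis (f_ge0 : forall x, 0 <= f x) (g_ge0 : forall x, 0 <= g x).
Variable (x1 : X).
Hypothesis (x1r : x1 \in r) (fx1 : 0 < f x1).
Variable (c : R).
Hypothesis (c_gt0 : 0 < c) (c_le1 : c <= 1).
Hypothesis (absum_c : absum (fun z => (K ^+ 2 * c) ^+ d x0 z)).

Let F j t z := flow G r f c j t z.
Let H j t z := flow G r' g c j (1 - t) z.

Let K_ge1 : 1 <= K. Proof. exact: growth_ge1. Qed.
Let K_ge0 : 0 <= K. Proof. exact: le_trans ler01 K_ge1. Qed.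
Let S2_ge0 : 0 <= 2 * S. Proof. by move: S_ge1; lra. Qed.
Let c_ge0 : 0 <= c. Proof. exact: ltW. Qed.

Let B : R := 1 + expR (4 * S) * \sum_(x <- r) f x.
Let B_ge1 : 1 <= B.
Proof.
by rewrite lerDl mulr_ge0 ?expR_ge0// sumr_ge0// => x _.
Qed.

Let k (delta : R) z : R := flow_const S I D delta * K ^+ d x0 z.
Let hh z : R := decay_const G S r' g / c ^+ D * c ^+ d x0 z.

Let F_gt0 t z : 0 < t -> 0 < F 0 t z.
Proof.
exact: (flow_gt0 S_ge1 gen_bound I_gt0 gen_lbound f_ge0 c_gt0 z x1r fx1).
Qed.

Let F_leB t z : 0 <= t -> t <= 1 -> F 0 t z <= B.
Proof.
move=> t0 t1; apply: le_trans (flow0_le S_ge1 gen_bound r f_ge0 c_gt0 c_le1 z t0 t1) _.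
by rewrite lerDr.
Qed.

Let H_le j t z : (j <= 2)%N -> 0 <= t -> t <= 1 -> m z * `|H j t z| <= hh z.
Proof.
move=> j2 t0 t1; have t1' : 0 <= 1 - t by rewrite subr_ge0.
have t0' : 1 - t <= 1 by rewrite lerBlDr lerDl.
have mf := mass_flow S_ge1 gen_bound I_gt0 I_le1 rD' g_ge0 c_gt0 c_le1 z j2 t1' t0'.
by rewrite /hh mulrAC ler_pdivlMr ?exprn_gt0// [leLHS]mulrC; exact: mf.
Qed.

Let hh_ge0 z : 0 <= hh z.
Proof.
have := @H_le 0 0 z isT (lexx 0) ler01; apply: le_trans.
by rewrite mulr_ge0// ltW// mass_gt0.
Qed.

Let M delta z : R := 15 * B ^+ 2 * k delta z ^+ 2 * hh z.

(** The decay of H in the distance, at rate c, beats the growth of the derivatives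
    of F, at rate K, squared because F1^2 occurs. *)
Let absum_M delta : absum (M delta).
Proof.
have -> : M delta = fun z => (15 * B ^+ 2 * flow_const S I D delta ^+ 2 *
    (decay_const G S r' g / c ^+ D)) * (K ^+ 2 * c) ^+ d x0 z.
  apply/funext => z; rewrite /M /k /hh.
  have -> : (K ^+ 2 * c) ^+ d x0 z = (K ^+ d x0 z) ^+ 2 * c ^+ d x0 z.
    by rewrite exprMn -!exprM mulnC.
  move: (flow_const _ _ _ _) (K ^+ _) (c ^+ d x0 z) (decay_const _ _ _ _ / _).
  by move: B => *; ring.
exact: absumZ.
Qed.

Let k_ge1 delta z : 0 < delta -> delta <= 1 -> 1 <= k delta z.
Proof.
move=> d0 d1; rewrite -[leLHS]mulr1 ler_pM//.
  exact: (flow_const_ge1 S_ge1 I_gt0 I_le1).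
by rewrite exprn_ege1.
Qed.

Let F_ratio j delta t z : (0 < j <= 2)%N -> 0 < delta -> delta <= t -> t <= 1 ->
  `|F j t z| <= k delta z * F 0 t z.
Proof.
exact: (flow_ratio S_ge1 gen_bound I_gt0 I_le1 gen_lbound rD f_ge0 c_gt0 c_le1).
Qed.

Let phi0 t z := ln (F 0 t z) * F 0 t z * H 0 t z * m z.
Let phi1 t z := m z *
  ((ln (F 0 t z) + 1) * F 1 t z * H 0 t z - F 0 t z * ln (F 0 t z) * H 1 t z).
Let phi2 t z := m z * ((ln (F 0 t z) + 1) * F 2 t z * H 0 t z
  + F 1 t z ^+ 2 / F 0 t z * H 0 t z
  - 2 * ((ln (F 0 t z) + 1) * F 1 t z * H 1 t z)
  + F 0 t z * ln (F 0 t z) * H 2 t z).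

Let dF j (t : R) z : is_derive t (1 : R) (fun s : R => F j s z) (F j.+1 t z).
Proof. exact: is_derive_flow S_ge1 gen_bound r f c j t z. Qed.

Let dH j (t : R) z : is_derive t (1 : R) (fun s : R => H j s z) (- H j.+1 t z).
Proof. exact: is_derive_flow_rev S_ge1 gen_bound r' g c j t z. Qed.

Let dphi0 (t : R) z : 0 < t -> is_derive t (1 : R) (fun s : R => phi0 s z) (phi1 t z).
Proof.
move=> t0; exact: (@is_derive_entropy _ (fun s => F 0 s z) (fun s => H 0 s z)
  t _ _ (m z) (F_gt0 z t0) (dF 0 t z) (dH 0 t z)).
Qed.

Let dphi1 (t : R) z : 0 < t -> is_derive t (1 : R) (fun s : R => phi1 s z) (phi2 t z).
Proof.
move=> t0.
exact: (@is_derive_entropy2 _ (fun s => F 0 s z) (fun s => H 0 s z)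
  (fun s => F 1 s z) (fun s => H 1 s z) t _ _ (m z) (F_gt0 z t0)
  (dF 0 t z) (dH 0 t z) (dF 1 t z) (dH 1 t z)).
Qed.

Let phi1_le delta t z : 0 < delta -> delta <= t -> t <= 1 ->
  `|phi1 t z| <= M delta z.
Proof.
move=> d0 dt t1; have t0 := lt_le_trans d0 dt; have t0' := ltW t0.
apply: (entropy_derive_bound (mass_gt0 G z) (F_gt0 z t0) (F_leB z t0' t1)).
- exact: B_ge1.
- by apply: k_ge1 => //; exact: le_trans dt t1.
- exact: F_ratio.
- exact: H_le.
- exact: H_le.
Qed.

Let phi2_le delta t z : 0 < delta -> delta <= t -> t <= 1 ->
  `|phi2 t z| <= M delta z.
Proof.
move=> d0 dt t1; have t0 := lt_le_trans d0 dt; have t0' := ltW t0.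
apply: (entropy_derive2_bound (mass_gt0 G z) (F_gt0 z t0) (F_leB z t0' t1)).
- exact: B_ge1.
- by apply: k_ge1 => //; exact: le_trans dt t1.
- exact: F_ratio.
- exact: F_ratio.
- exact: H_le.
- exact: H_le.
- exact: H_le.
Qed.

Let phi0_le delta t z : 0 < delta -> delta <= t -> t <= 1 ->
  `|phi0 t z| <= M delta z.
Proof.
move=> d0 dt t1; have t0 := lt_le_trans d0 dt; have t0' := ltW t0.
have -> : phi0 t z = m z * ((ln (F 0 t z) + 1) * 0 * H 1 t z -
    F 0 t z * ln (F 0 t z) * (- H 0 t z)) by rewrite /phi0; ring.
apply: (entropy_derive_bound (mass_gt0 G z) (F_gt0 z t0) (F_leB z t0' t1)).
- exact: B_ge1.
- by apply: k_ge1 => //; exact: le_trans dt t1.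
- rewrite normr0 mulr_ge0 ?ltW// ?F_gt0//.
  by apply: lt_le_trans ltr01 (k_ge1 z d0 (le_trans dt t1)).
- exact: H_le.
- by rewrite normrN; exact: H_le.
Qed.

Variable Phi : R -> R.
Hypothesis PhiE : forall t, 0 < t < 1 ->
  Phi t = csum (fun z => ln (F 0 t z) * F 0 t z * H 0 t z * m z).

(** On the ball of this radius around t the time stays away from 0, where the
    bounds on the derivatives of the flow degenerate. *)
Let mid t : R := Num.min t (1 - t) / 2.

Let mid_gt0 t : 0 < t < 1 -> 0 < mid t.
Proof. by move=> /andP[t0 t1]; rewrite divr_gt0// lt_min t0 subr_gt0. Qed.

Let mid_ball t s : 0 < t < 1 -> `|s - t| < mid t ->
  [/\ mid t <= s, s <= 1 & 0 < s < 1].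
Proof.
move=> /andP[t0 t1]; rewrite /mid ltr_norml => /andP[].
set a := Num.min _ _.
have a1 : a <= t by rewrite ge_min lexx.
have a2 : a <= 1 - t by rewrite ge_min lexx orbT.
have a0 : 0 < a by rewrite lt_min t0 subr_gt0.
by move=> h1 h2; split; [lra|lra|apply/andP; split; lra].
Qed.

Let derive_Phi (t : R) : 0 < t < 1 -> is_derive t (1 : R) Phi (csum (phi1 t)).
Proof.
move=> t01; have dt := mid_gt0 t01.
have H0 : is_derive t (1 : R) (fun s : R => csum (phi0 s)) (csum (phi1 t)).
  apply: (@is_derive_csum _ _ phi0 phi1 t (mid t) (M (mid t))) => //.
  - move=> s /(mid_ball t01)[h1 h2 _].
    by apply: absum_le (absum_M (mid t)) => z; exact: phi0_le.
  - by move=> s /(mid_ball t01)[h1 h2 /andP[h3 _]] z; exact: dphi0.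
  - by move=> s /(mid_ball t01)[h1 h2 _] z; exact: phi1_le.
have nr : {near t, (fun s : R => csum (phi0 s)) =1 Phi}.
  apply: filterS (nbhsx_ballx t (mid t) dt) => s; rewrite /ball/= distrC => st.
  by rewrite PhiE//; have [] := mid_ball t01 st.
have [dv de] := H0; split; first exact: near_eq_derivable nr dv.
by rewrite -(near_eq_derive _ nr).
Qed.

Let derive_phi1 (t : R) : 0 < t < 1 ->
  is_derive t (1 : R) (fun s : R => csum (phi1 s)) (csum (phi2 t)).
Proof.
move=> t01; have dt := mid_gt0 t01.
apply: (@is_derive_csum _ _ phi1 phi2 t (mid t) (M (mid t))) => //.
- move=> s /(mid_ball t01)[h1 h2 _].
  by apply: absum_le (absum_M (mid t)) => z; exact: phi1_le.
- by move=> s /(mid_ball t01)[h1 h2 /andP[h3 _]] z; exact: dphi1.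
- by move=> s /(mid_ball t01)[h1 h2 _] z; exact: phi2_le.
Qed.

Let derive2_Phi (t : R) : 0 < t < 1 -> derive1n 2 Phi t = csum (phi2 t) /\
  derive1n 2 (fun s : R => Phi (1 - s)) (1 - t) = csum (phi2 t).
Proof.
have refl (s : R) : 0 < s < 1 -> 0 < 1 - s < 1.
  by move=> /andP[s0 s1]; rewrite subr_gt0 s1 ltrBlDr ltrDl s0.
move=> t01; split.
  by apply: (derive1n2E t01 _ (derive_phi1 t01)) => s /derive_Phi.
apply: (@derive1n2E _ (fun s : R => Phi (1 - s)) (fun s : R => - csum (phi1 (1 - s)))).
- exact: refl.
- by move=> s /refl/derive_Phi/is_derive_reflect.
rewrite -[csum (phi2 t)]opprK; apply: is_deriveN.
apply: (@is_derive_reflect _ (fun s : R => csum (phi1 s))).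
by rewrite subKr; exact: derive_phi1.
Qed.

(** Differentiating twice under the sum produces terms in which the derivatives of
    F and of H are mixed.  Moving L from H to F by self-adjointness turns the sum
    into one of H against a function of F alone, which dissipation_rateE
    identifies as F times the dissipation rate.  The reflected function is there
    for the second entropy, which is the first one of the reversed bridge. *)
Lemma entropy_second_derivative t : 0 < t < 1 ->
  absum (fun z => m z * F 0 t z * H 0 t z * dissipation_rate G c (F 0 t) z) /\
  derive1n 2 Phi t =
    csum (fun z => m z * F 0 t z * H 0 t z * dissipation_rate G c (F 0 t) z) /\
  derive1n 2 (fun s : R => Phi (1 - s)) (1 - t) =
    csum (fun z => m z * F 0 t z * H 0 t z * dissipation_rate G c (F 0 t) z).
Proof.
move=> t01; suff [h1 h2] :
    absum (fun z => m z * F 0 t z * H 0 t z * dissipation_rate G c (F 0 t) z) /\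
    csum (phi2 t) = csum (fun z => m z * F 0 t z * H 0 t z * dissipation_rate G c (F 0 t) z).
  by have [-> ->] := derive2_Phi t01.
have /andP[t0 t1] := t01; have t0' := ltW t0; have t1' := ltW t1.
have s0' : 0 <= 1 - t by rewrite subr_ge0.
pose U z := F 0 t z * ln (F 0 t z).
pose V z := (ln (F 0 t z) + 1) * (c * genop G (F 0 t) z).
have gF j z : c * genop G (F j t) z = F j.+1 t z.
  exact: (genop_flow S_ge1 gen_bound _ _ c_gt0).
have gH j z : c * genop G (H j t) z = H j.+1 t z.
  exact: (genop_flow S_ge1 gen_bound _ _ c_gt0).
have F2E z : F 2 t z = c * genop G (fun v => c * genop G (F 0 t) v) z.
  by rewrite -gF; congr (c * _); apply: eq_bigr => v _; rewrite gF.
have Fp v : 0 < F 0 t v by exact: F_gt0.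
have dpos := t0; have kt1 z : 1 <= k t z by exact: k_ge1.
have kt0 z : 0 <= k t z by exact: le_trans ler01 (kt1 z).
have B0 : 0 <= B by exact: le_trans ler01 B_ge1.
pose B' := 3 * B ^+ 2.
have B'0 : 0 <= B' by rewrite mulr_ge0 ?sqr_ge0.
have bd z := entropy_bounds (Fp z) (F_leB z t0' t1') B_ge1.
have Ub z : `|U z| <= B' by have [] := bd z.
have Vb z : `|V z| <= B' * k t z.
  rewrite /V gF normrM; apply: (@le_trans _ _ (`|ln (F 0 t z) + 1| * (k t z * F 0 t z))).
    by rewrite ler_wpM2l// F_ratio.
  by rewrite mulrCA mulrC ler_wpM2r//; have [] := bd z.
have k_nb z y : y \in nbs G z -> k t y <= K * k t z.
  rewrite /k mem_nbs => zy; rewrite mulrCA ler_wpM2l//.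
    exact: le_trans ler01 (flow_const_ge1 S_ge1 I_gt0 I_le1 _ _ _).
  rewrite -exprS ler_weXn2l//; apply: leq_trans (gdist_triangle G z x0 y) _.
  by rewrite -addn1 leq_add2l; case/orP: zy => [/eqP ->|]; rewrite ?gdistxx// -gdist_eq1 => /eqP ->.
pose b z := m z * V z * H 1 t z; pose a z := m z * U z * H 2 t z.
pose LV z := c * genop G V z; pose LU z := c * genop G U z.
have LUb z : `|LU z| <= c * (2 * S * B').
  by rewrite normrM (ger0_norm c_ge0) ler_wpM2l// (genop_le gen_bound).
have ahh C : absum (fun z => C * hh z).
  apply: absum_le (absumZ `|C| (absum_M t)) => z.
  rewrite normrM (ger0_norm (hh_ge0 z)) ler_wpM2l// /M ler_peMl//.
  by rewrite mulr_ege1// ?exprn_ege1// mulr_ege1// ?exprn_ege1//; lra.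
have akhh C : absum (fun z => C * (k t z * hh z)).
  apply: absum_le (absumZ `|C| (absum_M t)) => z.
  rewrite normrM ler_wpM2l// (ger0_norm (mulr_ge0 (kt0 z) (hh_ge0 z))) /M.
  rewrite ler_wpM2r// [k t z ^+ 2]expr2 mulrA ler_peMl// mulr_ege1//.
  by rewrite mulr_ege1// ?exprn_ege1//; lra.
have Hle j z : (j <= 2)%N -> m z * `|H j t z| <= hh z by move=> j2; exact: H_le.
have symU1 : csum a = csum (fun z => m z * H 1 t z * LU z).
  rewrite /a; under eq_csum do rewrite -gH.
  apply: (csum_genop_sym c (ahh (2 * S * B'))) => z.
  by rewrite ler_pM ?mulr_ge0 ?sumr_ge0 ?(ltW (mass_gt0 G z)) ?Hle//
     (sum_gen_le gen_bound).
have LUb0 : 0 <= c * (2 * S * B') by exact: mulr_ge0 c_ge0 (mulr_ge0 S2_ge0 B'0).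
have symU2 : csum (fun z => m z * H 1 t z * LU z) =
    csum (fun z => m z * H 0 t z * (c * genop G LU z)).
  under eq_csum do rewrite -gH mulrAC.
  apply: (csum_genop_sym c (ahh (2 * S * (c * (2 * S * B'))))) => z.
  apply: ler_pM; [exact: sumr_ge0| | |exact: Hle].
    by rewrite mulr_ge0// ltW// mass_gt0.
  by apply: (sum_gen_le gen_bound) => // y _; exact: LUb.
have KB0 z : 0 <= B' * (K * k t z) by rewrite mulr_ge0// mulr_ge0.
have symV : csum b = csum (fun z => m z * H 0 t z * LV z).
  rewrite /b; under eq_csum do rewrite -gH.
  apply: (csum_genop_sym c (akhh (2 * S * (B' * K)))) => z.
  have -> : 2 * S * (B' * K) * (k t z * hh z) = 2 * S * (B' * (K * k t z)) * hh z.
    by ring.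
  apply: ler_pM; [exact: sumr_ge0| | |exact: Hle].
    by rewrite mulr_ge0// ltW// mass_gt0.
  apply: (sum_gen_le gen_bound) => // y yz.
  by apply: le_trans (Vb y) _; rewrite ler_wpM2l// k_nb.
have aphi2 : absum (phi2 t).
  by apply: absum_le (absum_M t) => z; exact: phi2_le.
have absH0 (v w : X -> R) : absum w -> (forall z, hh z * `|v z| <= w z) ->
    absum (fun z => m z * H 0 t z * v z).
  move=> aw vw; apply: absum_le aw => z.
  rewrite 2!normrM (ger0_norm (ltW (mass_gt0 G z))).
  by apply: le_trans (vw z); rewrite ler_wpM2r// Hle.
have absV : absum (fun z => m z * H 0 t z * LV z).
  apply: (absH0 _ _ (akhh (c * (2 * S * (B' * K))))) => z.
  have -> : c * (2 * S * (B' * K)) * (k t z * hh z) =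
      hh z * (c * (2 * S * (B' * (K * k t z)))) by ring.
  rewrite ler_wpM2l// normrM (ger0_norm c_ge0) ler_wpM2l//.
  apply: (genop_le gen_bound) => // y yz.
  by apply: le_trans (Vb y) _; rewrite ler_wpM2l// k_nb.
have absU : absum (fun z => m z * H 0 t z * (c * genop G LU z)).
  apply: (absH0 _ _ (ahh (c * (2 * S * (c * (2 * S * B')))))) => z.
  rewrite [leRHS]mulrC ler_wpM2l// normrM (ger0_norm c_ge0) ler_wpM2l//.
  by apply: (genop_le gen_bound) => // y yz; exact: LUb.
have absa : absum a.
  apply: absum_le (ahh B') => z; rewrite /a 2!normrM (ger0_norm (ltW (mass_gt0 G z))).
  by rewrite mulrAC mulrC; apply: ler_pM; rewrite ?mulr_ge0 ?(ltW (mass_gt0 G z)) ?Hle.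
have absb : absum b.
  apply: absum_le (akhh B') => z; rewrite /b 2!normrM (ger0_norm (ltW (mass_gt0 G z))).
  rewrite mulrAC mulrC mulrA.
  by apply: ler_pM; rewrite ?mulr_ge0 ?(ltW (mass_gt0 G z)) ?Hle.
pose rest z := phi2 t z + 2 * b z - a z.
have arest : absum rest by apply: absumB => //; apply: absumD => //; exact: absumZ.
have restE : csum (phi2 t) = csum rest - 2 * csum b + csum a.
  rewrite /rest csumB//; last by apply: absumD => //; exact: absumZ.
  rewrite csumD//; last exact: absumZ.
  rewrite csumZ//; move: (csum (phi2 t)) (csum b) (csum a) => p q s; ring.
pose fin z := rest z - 2 * (m z * H 0 t z * LV z) + m z * H 0 t z * (c * genop G LU z).
have finE z : m z * F 0 t z * H 0 t z * dissipation_rate G c (F 0 t) z = fin z.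
  have -> : m z * F 0 t z * H 0 t z * dissipation_rate G c (F 0 t) z =
    m z * H 0 t z * (F 0 t z * dissipation_rate G c (F 0 t) z) by ring.
  rewrite (dissipation_rateE G z c_gt0 Fp) -F2E gF /fin /rest /phi2 /a /b /LV /V /LU /U gF.
  move: (c * genop G _ z) (c * genop G _ z) => p q.
  move: (ln (F 0 t z)) => l.
  by move: (F 0 t z) (F 1 t z) (F 2 t z) (H 0 t z) (H 1 t z) (H 2 t z) => *; ring.
have a2 := absumZ 2 absV; have a3 := absumB arest a2.
have afin : absum fin := absumD a3 absU.
split; first by under eq_fun do rewrite finE.
under [RHS]eq_csum do rewrite finE.
rewrite restE symU1 symU2 symV (csumD a3 absU) (csumB arest a2) (csumZ 2 absV).
reflexivity.
Qed.

End SecondDerivative.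

(** * The function rho *)

Section Rho.
Context (R : realType).
Implicit Types (a b c : nat -> R) (A B x y : R).

(** The function y (ln (y / x^2) - 1) is minimal at y = x^2. *)
Lemma rho_ge x y : - x ^+ 2 <= rho x y.
Proof.
rewrite /rho; case: ifP => [/andP[x0 y0]|_]; last by rewrite oppr_le0 sqr_ge0.
have x2 : 0 < x ^+ 2 by rewrite exprn_gt0.
have := @ln_le_sub1 R (x ^+ 2 / y); rewrite divr_gt0// => /(_ isT).
rewrite lnM ?posrE ?invr_gt0// lnV ?posrE// lnXn// => h.
have : (ln x *+ 2 - ln y) * y <= (x ^+ 2 / y - 1) * y by rewrite ler_wpM2r// ltW.
by rewrite !mulrBl divfK ?gt_eqF// mulr2n mulrDl !mul1r; lra.
Qed.

(** x ln x = 2 sqrt x (sqrt x ln (sqrt x)), where the last factor is bounded near 0. *)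
Let xlnx_cvg0 b : (forall n, 0 < b n) -> b n @[n --> \oo] --> 0 ->
  b n * ln (b n) @[n --> \oo] --> 0.
Proof.
move=> b0 bc; apply/norm_cvg0P.
have sb : Num.sqrt (b n) @[n --> \oo] --> 0.
  by rewrite -[X in _ --> X](@sqrtr0 R); apply: continuous_cvg => //; exact: sqrt_continuous.
have up : 2 * Num.sqrt (b n) * (1 + b n) @[n --> \oo] --> (2 * 0 * (1 + 0) : R).
  by apply: cvgM; [apply: cvgM => //; exact: cvg_cst|apply: cvgD => //; exact: cvg_cst].
rewrite mulr0 mul0r in up.
apply: (squeeze_cvgr _ (cvg_cst 0) up); apply: nearW => n.
rewrite normr_ge0/=; have s0 : 0 < Num.sqrt (b n) by rewrite sqrtr_gt0.
have sE : b n = Num.sqrt (b n) ^+ 2 by rewrite sqr_sqrtr// ltW.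
have -> : b n * ln (b n) =
    2 * Num.sqrt (b n) * (Num.sqrt (b n) * ln (Num.sqrt (b n))).
  by rewrite {1 2}sE lnXn//; ring.
have p0 : 0 <= 2 * Num.sqrt (b n) by rewrite mulr_ge0// ltW.
rewrite normrM (ger0_norm p0) ler_wpM2l//.
by rewrite -[X in 1 + X](sqr_sqrtr (ltW (b0 n))); exact: abs_xlnx_le.
Qed.

Let bounded_xlnx_cvg0 a c A : (forall n, 0 < a n) -> (forall n, 0 < c n) ->
  c n @[n --> \oo] --> 0 -> a n @[n --> \oo] --> A ->
  c n * (a n * ln (a n)) @[n --> \oo] --> 0.
Proof.
move=> a0 c0 cc ca; apply/norm_cvg0P.
have up : c n * (1 + a n ^+ 2) @[n --> \oo] --> (0 * (1 + A ^+ 2) : R).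
  by apply: cvgM => //; apply: cvgD; [exact: cvg_cst|apply: cvgM].
rewrite mul0r in up; apply: (squeeze_cvgr _ (cvg_cst 0) up); apply: nearW => n.
by rewrite normr_ge0 normrM (ger0_norm (ltW (c0 n))) ler_wpM2l ?(ltW (c0 n))// abs_xlnx_le.
Qed.

(** At positive limits rho is continuous.  If B = 0, then b ln b and b tend to 0
    while - ln a stays bounded below.  If A = 0 < B, then rho tends to infinity. *)
Lemma rho_lowlim a b A B : (forall n, 0 < a n) -> (forall n, 0 < b n) ->
  a n @[n --> \oo] --> A -> b n @[n --> \oo] --> B ->
  lowlim (fun n => rho (a n) (b n)) (rho A B).
Proof.
move=> a0 b0 ca cb.
have rhoE n : rho (a n) (b n) = (ln (b n) - 2 * ln (a n) - 1) * b n.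
  by rewrite /rho a0 b0.
have limge (u : nat -> R) (l : R) : (forall n, 0 < u n) -> u n @[n --> \oo] --> l -> 0 <= l.
  move=> u0 ul; apply: (@ler_cvg_to _ \oo _ _ (fun=> 0) u _ _ (cvg_cst _) ul).
  by apply: nearW => n; exact: ltW.
have A0 := limge _ _ a0 ca; have B0 := limge _ _ b0 cb.
have [Bp|] := ltP 0 B; last first.
  move=> Bn; have BE : B = 0 by apply/eqP; rewrite eq_le Bn B0.
  rewrite BE {2}/rho ltxx andbF; rewrite BE in cb.
  have Ap : 0 < A + 1 by rewrite ltr_wpDl.
  apply: (@lowlim_le _ (fun n => b n * ln (b n) - b n * (2 * ln (A + 1) + 1))).
    have /cvgrPdist_lt /(_ 1 ltr01) := ca; apply: filterS => n.
    rewrite ltr_norml => /andP[h _]; rewrite rhoE.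
    have : ln (a n) <= ln (A + 1) by rewrite ler_ln ?posrE//; lra.
    move=> /(ler_wpM2l (ltW (b0 n))); lra.
  apply: lowlim_cvg; rewrite -[X in _ --> X](subrr 0).
  apply: cvgB; first exact: xlnx_cvg0.
  by rewrite -[X in _ --> X](mul0r (2 * ln (A + 1) + 1)); apply: cvgM => //; exact: cvg_cst.
have clnb : ln (b n) @[n --> \oo] --> ln B.
  by apply: continuous_cvg => //; exact: continuous_ln.
have [Ap|] := ltP 0 A; last first.
  move=> An; have AE : A = 0 by apply/eqP; rewrite eq_le An A0.
  rewrite AE {2}/rho ltxx/=; apply: (@lowlim_le _ (fun=> 0)); last first.
    by apply: lowlim_cvg; exact: cvg_cst.
  have /cvgrPdist_lt /(_ 1 ltr01) h1 := clnb.
  have e0 : 0 < expR ((ln B - 2) / 2) by rewrite expR_gt0.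
  have /cvgrPdist_lt /(_ _ e0) := ca; rewrite AE; apply: filter_app.
  apply: filterS h1 => n; rewrite ltr_norml => /andP[_ h1]; rewrite sub0r normrN.
  rewrite (ger0_norm (ltW (a0 n))) => h2.
  have : ln (a n) < (ln B - 2) / 2 by rewrite -[ltRHS]expRK ltr_ln ?posrE.
  by move=> h3; rewrite rhoE mulr_ge0 ?(ltW (b0 n))//; lra.
apply: lowlim_cvg; rewrite /rho Ap Bp/=.
under eq_fun do rewrite -/(rho _ _) rhoE.
have clna : ln (a n) @[n --> \oo] --> ln A.
  by apply: continuous_cvg => //; exact: continuous_ln.
apply: cvgM => //; apply: cvgB; last exact: cvg_cst.
by apply: cvgB => //; apply: cvgM => //; exact: cvg_cst.
Qed.

(** The pairs of steps in which one step stays put: v = z gives rho c (c a), and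
    w = v gives rho a (c a), where a is the rescaled ratio at the other point. *)
Lemma rho_stay_cvg0 a c A : (forall n, 0 < a n) -> (forall n, 0 < c n) ->
  c n @[n --> \oo] --> 0 -> a n @[n --> \oo] --> A ->
  rho (c n) (c n * a n) @[n --> \oo] --> 0 /\
  rho (a n) (c n * a n) @[n --> \oo] --> 0.
Proof.
move=> a0 c0 cc ca.
have t1 := bounded_xlnx_cvg0 a0 c0 cc ca.
have t2 : (c n * ln (c n)) * a n @[n --> \oo] --> 0.
  by rewrite -[X in _ --> X](mul0r A); apply: cvgM => //; exact: xlnx_cvg0.
have t3 : c n * a n @[n --> \oo] --> 0.
  by rewrite -[X in _ --> X](mul0r A); exact: cvgM.
have lnE n : ln (c n * a n) = ln (c n) + ln (a n) by rewrite lnM ?posrE.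
have h1 : c n * (a n * ln (a n)) - c n * ln (c n) * a n - c n * a n @[n --> \oo]
    --> (0 - 0 - 0 : R) by apply: cvgB => //; exact: cvgB.
have h2 : c n * ln (c n) * a n - c n * (a n * ln (a n)) - c n * a n @[n --> \oo]
    --> (0 - 0 - 0 : R) by apply: cvgB => //; exact: cvgB.
rewrite !subr0 in h1 h2; split.
  rewrite (_ : (fun n => rho _ _) = (fun n => c n * (a n * ln (a n)) -
    c n * ln (c n) * a n - c n * a n))//.
  by apply/funext => n; rewrite /rho c0 mulr_gt0//= lnE; ring.
rewrite (_ : (fun n => rho _ _) = (fun n => c n * ln (c n) * a n -
  c n * (a n * ln (a n)) - c n * a n))//.
by apply/funext => n; rewrite /rho a0 mulr_gt0//= lnE; ring.
Qed.

(** Bounds, uniform in c1, for the pairs in which one step stays put.  All the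
    logarithms of c1 cancel. *)
Lemma rho_stay_le (c1 : R) x A : 0 < c1 -> c1 <= 1 -> 0 < x -> c1 * x <= A ->
  `|rho c1 (c1 ^+ 2 * x)| <= 2 + 2 * A ^+ 2 /\
  `|rho (c1 * x) (c1 ^+ 2 * x)| <= 2 + 2 * A ^+ 2.
Proof.
move=> c0 c1' x0 cxA; have xl := abs_xlnx_le x0.
have c2x : 0 < c1 ^+ 2 * x by rewrite mulr_gt0 ?exprn_gt0.
have cx : 0 < c1 * x by rewrite mulr_gt0.
have l1 : ln (c1 * x) = ln c1 + ln x by rewrite lnM ?posrE.
have l2 : ln (c1 ^+ 2 * x) = ln c1 + ln c1 + ln x.
  by rewrite -lnM ?posrE// -expr2 lnM ?posrE ?exprn_gt0.
have cc : c1 ^+ 2 <= 1 by rewrite exprn_ile1// ltW.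
have cxA2 : (c1 * x) ^+ 2 <= A ^+ 2.
  by rewrite lerXn2r// nnegrE ltW// (lt_le_trans cx).
have key : c1 ^+ 2 * (1 + x ^+ 2 + x) <= 2 + 2 * A ^+ 2.
  have h1 : x <= 1 + x ^+ 2 by have := sqr_ge0 (x - 1); have := sqr_ge0 x; nra.
  have h2 : c1 ^+ 2 * (1 + x ^+ 2 + x) <= c1 ^+ 2 * (2 * (1 + x ^+ 2)).
    by rewrite ler_wpM2l ?sqr_ge0//; lra.
  by apply: le_trans h2 _; rewrite exprMn in cxA2; lra.
split.
  rewrite /rho c0 c2x/= l2.
  have -> : (ln c1 + ln c1 + ln x - 2 * ln c1 - 1) * (c1 ^+ 2 * x) =
    c1 ^+ 2 * (x * ln x - x) by ring.
  rewrite normrM (ger0_norm (sqr_ge0 _)); apply: le_trans key.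
  rewrite ler_wpM2l ?sqr_ge0//; apply: le_trans (ler_normB _ _) _.
  by rewrite (ger0_norm (ltW x0)) lerD2r.
rewrite /rho cx c2x/= l1 l2.
have -> : (ln c1 + ln c1 + ln x - 2 * (ln c1 + ln x) - 1) * (c1 ^+ 2 * x) =
  c1 ^+ 2 * (- (x * ln x) - x) by ring.
rewrite normrM (ger0_norm (sqr_ge0 _)); apply: le_trans key.
rewrite ler_wpM2l ?sqr_ge0//; apply: le_trans (ler_normB _ _) _.
by rewrite normrN (ger0_norm (ltW x0)) lerD2r.
Qed.

End Rho.

(** * Lower bound and lower limit of the dissipation rate *)

Section DissipationBounds.
Context (R : realType) (X : countType) (G : graph_space R X) (S I : R).
Local Notation e := (adj G).
Local Notation d := (gdist G).
Local Notation L := (gen G).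
Hypothesis (S_ge1 : 1 <= S) (gen_bound : forall x, `|L x x| <= S).
Hypothesis (I_gt0 : 0 < I) (I_le1 : I <= 1).
Hypothesis (gen_lbound : forall x y, e x y -> I <= L x y).

(** The off-diagonal terms of L F at z are nonnegative, so each of them is at most
    L F z - L z z F z. *)
Lemma neighbour_ratio_le (c k : R) (F : X -> R) z v : 0 < c -> c <= 1 ->
  1 <= k -> (forall v, 0 < F v) -> `|c * genop G F z| <= k * F z ->
  v \in nbs G z -> c * (F v / F z) <= (k + S) / I.
Proof.
move=> c0 c1 k1 F0 gk; rewrite mem_nbs => /orP[/eqP ->|zv].
  rewrite divff ?gt_eqF// mulr1 ler_pdivlMr//.
  apply: (@le_trans _ _ 1); first by rewrite mulr_ile1// ltW.
  by move: S_ge1; lra.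
have vz : v \in nbs G z by rewrite mem_nbs zv orbT.
have zz : z \in nbs G z by rewrite mem_nbs eqxx.
have zNv : z != v by apply/eqP => zv'; move: zv; rewrite zv' adj_irr.
have Lv : I * F v <= L z v * F v by rewrite ler_wpM2r ?(ltW (F0 v))// gen_lbound.
have le1 : L z v * F v <= genop G F z - L z z * F z.
  rewrite /genop (bigD1_seq z zz (nbs_uniq G z))/= [leRHS]addrC addKr.
  rewrite big_mkcond (bigD1_seq v vz (nbs_uniq G z))/= eq_sym zNv lerDl.
  apply: sumr_ge0 => w _; case: ifPn => // wz.
  by rewrite mulr_ge0 ?(ltW (F0 w))// gen_ge0// eq_sym.
have le2 : - (L z z * F z) <= S * F z.
  rewrite -mulNr ler_wpM2r ?(ltW (F0 z))//.
  by have := gen_bound z; rewrite -normrN => /(le_trans (ler_norm _)).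
have le3 : c * genop G F z <= k * F z by exact: le_trans (ler_norm _) gk.
have le4 : c * (S * F z) <= S * F z.
  by rewrite ler_piMl// mulr_ge0 ?(ltW (F0 z))//; move: S_ge1; lra.
rewrite mulrA ler_pdivrMr// mulrAC ler_pdivlMr//.
have := ler_wpM2l (ltW c0) (le_trans Lv (le_trans le1 (lerD (lexx _) le2))).
have -> : c * F v * I = c * (I * F v) by ring.
by rewrite mulrDr mulrDl; lra.
Qed.

(** Pairs of genuine steps are bounded below by rho_ge, the others in absolute
    value by rho_stay_le. *)
Lemma dissipation_rate_ge (c A : R) (F : X -> R) z : 0 < c -> c <= 1 ->
  (forall v, 0 < F v) -> (forall v, v \in nbs G z -> c * (F v / F z) <= A) ->
  - ((2 * S) ^+ 2 * (2 + 2 * A ^+ 2)) <= dissipation_rate G c F z.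
Proof.
move=> c0 c1 F0 FA; set b := 2 + 2 * A ^+ 2.
have b0 : 0 <= b by rewrite addr_ge0// mulr_ge0// sqr_ge0.
have S0 : 0 <= 2 * S by move: S_ge1; lra.
have Fz := F0 z.
apply: (@le_trans _ _ (\sum_(v <- nbs G z) \sum_(w <- nbs G v)
    L z v * L v w * rho (c * (F v / F z)) (c ^+ 2 * (F w / F z)))); last first.
  by rewrite lerDr sqr_ge0.
apply: (@le_trans _ _ (\sum_(v <- nbs G z) \sum_(w <- nbs G v) - (`|L z v| * `|L v w| * b))).
  under eq_bigr => v _ do rewrite sumrN -mulr_suml -mulr_sumr.
  rewrite sumrN -mulr_suml lerN2 ler_wpM2r// expr2.
  apply: (@le_trans _ _ (\sum_(v <- nbs G z) `|L z v| * (2 * S))).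
    by apply: ler_sum => v _; rewrite ler_wpM2l// gen_row_norm.
  by rewrite -mulr_suml ler_wpM2r// gen_row_norm.
rewrite big_seq [leRHS]big_seq; apply: ler_sum => v vz; apply: ler_sum => w _.
have pr x : 0 < F x / F z by rewrite divr_gt0.
have [rv1 rv2] := rho_stay_le c0 c1 (pr v) (FA _ vz).
have norm_ok y : `|y| <= b -> - (`|L z v| * `|L v w| * b) <= L z v * L v w * y.
  move=> yb; rewrite lerNl; apply: le_trans (ler_norm _) _.
  by rewrite normrN !normrM ler_wpM2l// mulr_ge0.
have [wE|wv] := eqVneq w v; first by apply: norm_ok; rewrite wE.
have [vE|vNz] := eqVneq v z.
  have [wz|/gen_out L0] := boolP (w \in nbs G v); last first.
    by rewrite L0 normr0 !mulr0 !mul0r oppr0.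
  apply: norm_ok; rewrite vE divff ?gt_eqF// mulr1 in wz *.
  by have [] := rho_stay_le c0 c1 (pr w) (FA _ wz).
have Lzv : 0 <= L z v by rewrite gen_ge0// eq_sym.
have Lvw : 0 <= L v w by rewrite gen_ge0// eq_sym.
rewrite (ger0_norm Lzv) (ger0_norm Lvw) -mulrN ler_wpM2l ?mulr_ge0//.
apply: le_trans (rho_ge _ _); rewrite lerN2 /b.
have cv0 : 0 <= c * (F v / F z) by rewrite mulr_ge0 ?(ltW (pr v)) ?(ltW c0).
have : (c * (F v / F z)) ^+ 2 <= A ^+ 2.
  by rewrite lerXn2r ?nnegrE ?FA// (le_trans cv0)// FA.
by have := sqr_ge0 A; lra.
Qed.

(** The pairs (v, w) that stay within distance one of z contribute terms
    tending to 0, or bounded below by a quantity tending to 0; the limit only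
    keeps the pairs with v a neighbour of z and w at distance two. *)
Lemma dissipation_rate_lowlim (c_ : nat -> R) (F_ : nat -> X -> R) (A AA : X -> R) z :
  (forall n, 0 < c_ n) -> c_ n @[n --> \oo] --> 0 ->
  (forall n v, 0 < F_ n v) ->
  (forall v, e z v -> c_ n * (F_ n v / F_ n z) @[n --> \oo] --> A v) ->
  (forall w, d z w = 2%N -> c_ n ^+ 2 * (F_ n w / F_ n z) @[n --> \oo] --> AA w) ->
  lowlim (fun n => dissipation_rate G (c_ n) (F_ n) z)
    ((\sum_(v <- nbs G z | e z v) A v * L z v) ^+ 2 +
     \sum_(v <- nbs G z | e z v) \sum_(w <- nbs G v | d z w == 2%N)
       rho (A v) (AA w) * L v w * L z v).
Proof.
move=> c0 cc F0 hA hAA.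
have Fnz n : F_ n z != 0 by rewrite gt_eqF.
pose A' v := if e z v then A v else 0.
have hA' v : v \in nbs G z -> c_ n * (F_ n v / F_ n z) @[n --> \oo] --> A' v.
  rewrite mem_nbs /A'; case: ifPn => [zv _|_]; first exact: hA.
  rewrite orbF => /eqP ->; under eq_fun do rewrite divff// mulr1; exact: cc.
have pr n v : 0 < F_ n v / F_ n z by rewrite divr_gt0.
have pcr n v : 0 < c_ n * (F_ n v / F_ n z) by rewrite mulr_gt0.
have pccr n v : 0 < c_ n ^+ 2 * (F_ n v / F_ n z) by rewrite mulr_gt0 ?exprn_gt0.
rewrite /dissipation_rate; apply: lowlimD.
  apply: lowlim_cvg; rewrite expr2; under eq_fun do rewrite expr2.
  suff h : \sum_(v <- nbs G z) L z v * (c_ n * (F_ n v / F_ n z)) @[n --> \oo] -->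
      \sum_(v <- nbs G z | e z v) A v * L z v by exact: cvgM.
  rewrite [X in _ --> X](_ : _ = \sum_(v <- nbs G z) L z v * A' v); last first.
    rewrite big_mkcond; apply: eq_bigr => v _; rewrite /A'.
    by case: ifP; rewrite ?mulr0// mulrC.
  apply: (@cvg_sum_seq _ nat \oo _ X (nbs G z)
    (fun n v => L z v * (c_ n * (F_ n v / F_ n z))) (fun v => L z v * A' v)) => v.
  have [vz|/gen_out ->] := boolP (v \in nbs G z).
    by apply: cvgM; [exact: cvg_cst|exact: hA'].
  by rewrite mul0r; under eq_fun do rewrite mul0r; exact: cvg_cst.
rewrite big_mkcond/=; apply: lowlim_sum => v.
have -> : (if e z v then \sum_(w <- nbs G v | d z w == 2%N)
    rho (A v) (AA w) * L v w * L z v else 0) =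
  \sum_(w <- nbs G v) if e z v && (d z w == 2%N) then
    rho (A v) (AA w) * L v w * L z v else 0.
  by case: ifP => _ /=; [rewrite -big_mkcond|rewrite big1].
apply: lowlim_sum => w.
have zero (u : nat -> R) (b : bool) (t : R) : b = false ->
    u n @[n --> \oo] --> 0 -> lowlim u (if b then t else 0).
  by move=> -> u0; exact: lowlim_cvg.
have zeroM (u : nat -> R) (b : bool) (t q : R) : b = false ->
    u n @[n --> \oo] --> 0 -> lowlim (fun n => q * u n) (if b then t else 0).
  move=> bF u0; apply: zero => //; rewrite -(mulr0 q).
  by apply: cvgM => //; exact: cvg_cst.
have zero0 (u : nat -> R) (b : bool) (t q : R) : b = false -> q = 0 ->
    lowlim (fun n => q * u n) (if b then t else 0).
  move=> bF q0; apply: zero => //.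
  by rewrite (_ : (fun n => _) = fun=> 0); [exact: cvg_cst|apply/funext => n; rewrite q0 mul0r].
have [vz|vz] := boolP (v \in nbs G z); last first.
  apply: zero0; last by rewrite gen_out ?mul0r.
  by move: vz; rewrite mem_nbs negb_or => /andP[_ /negbTE ->].
have [wv|wv] := boolP (w \in nbs G v); last first.
  have L0 := gen_out wv; rewrite L0.
  rewrite (_ : (if _ then _ else _) = 0); last by case: ifP; rewrite ?mulr0 ?mul0r.
  rewrite (_ : (fun n => _) = fun=> 0); first by apply: lowlim_cvg; exact: cvg_cst.
  by apply/funext => n; rewrite mulr0 mul0r.
have [vE|vNz] := eqVneq v z.
  (* v = z: the term is rho (c, c^2 r) *)
  rewrite vE adj_irr/=; rewrite vE in wv.
  have [h _] := rho_stay_cvg0 (fun n => pcr n w) c0 cc (hA' _ wv).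
  apply: (zeroM _ false 0) => //.
  rewrite (_ : (fun n => rho _ _) = (fun n => rho (c_ n) (c_ n * (c_ n * (F_ n w / F_ n z)))))//.
  by apply/funext => n; rewrite divff// mulr1 expr2 -mulrA.
have zv : e z v by move: vz; rewrite mem_nbs (negbTE vNz).
have dzv : d z v = 1%N by apply/eqP; rewrite gdist_eq1.
have [wE|wNv] := eqVneq w v.
  have [_ h] := rho_stay_cvg0 (fun n => pcr n v) c0 cc (hA' _ vz).
  apply: zeroM; first by rewrite wE dzv andbF.
  rewrite (_ : (fun n => rho _ _) = (fun n => rho (c_ n * (F_ n v / F_ n z))
    (c_ n * (c_ n * (F_ n v / F_ n z)))))//.
  by apply/funext => n; rewrite wE expr2 -mulrA.
have Lp : 0 <= L z v * L v w by rewrite mulr_ge0// gen_ge0// eq_sym.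
have vw : e v w by move: wv; rewrite mem_nbs (negbTE wNv).
have lowM (t : R) : lowlim (fun n => rho (c_ n * (F_ n v / F_ n z)) (c_ n ^+ 2 * (F_ n w / F_ n z))) t ->
    lowlim (fun n => L z v * L v w *
      rho (c_ n * (F_ n v / F_ n z)) (c_ n ^+ 2 * (F_ n w / F_ n z))) (L z v * L v w * t).
  by apply: lowlimM; [exact: nearW|exact: cvg_cst].
rewrite zv/=; case: ifPn => [/eqP dzw|dzw].
  have -> : rho (A v) (AA w) * L v w * L z v = L z v * L v w * rho (A v) (AA w) by ring.
  by apply: lowM; apply: rho_lowlim => //; [exact: hA|exact: hAA].
have wz : w \in nbs G z.
  have := gdist_triangle G v z w; rewrite dzv mem_nbs -gdist_eq1 eq_sym -(gdist_eq0 G).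
  have := vw; rewrite -gdist_eq1 => /eqP ->.
  by move: dzw; case: (d z w) => [|[|[|]]].
rewrite -(mulr0 (L z v * L v w)); apply: lowM.
have -> : 0 = rho (A' v) (0 : R) by rewrite /rho ltxx andbF.
apply: rho_lowlim => //; first exact: hA'.
rewrite -(mul0r (A' w)).
rewrite (_ : (fun n => c_ n ^+ 2 * _) = (fun n => c_ n * (c_ n * (F_ n w / F_ n z)))).
  by apply: cvgM => //; exact: hA'.
by apply/funext => n; rewrite expr2 -mulrA.
Qed.

End DissipationBounds.

(** * Small-time asymptotics *)

Section SmallTime.
Context (R : realType) (X : countType) (G : graph_space R X) (S I : R).
Local Notation e := (adj G).
Local Notation d := (gdist G).
Local Notation m := (mass G).
Local Notation L := (gen G).
Hypothesis (S_ge1 : 1 <= S) (gen_bound : forall x, `|L x x| <= S).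
Hypothesis (I_gt0 : 0 < I) (gen_lbound : forall x y, e x y -> I <= L x y).

Let S_ge0 : 0 <= S. Proof. exact: le_trans ler01 S_ge1. Qed.

(** A geodesic contributes to the power of the nonnegative kernel L + S, and the
    lower powers of L vanish between points at distance d x y. *)
Lemma genpow_gt0 x y : 0 < genpow G (d x y) x y.
Proof.
pose N u v := L u v + S * (u == v)%:R.
have N0 u v : 0 <= N u v.
  rewrite /N; case: eqVneq => [->|uv]; last by rewrite mulr0 addr0 gen_ge0.
  by have := gen_bound v; rewrite mulr1 ler_norml => /andP[? _]; lra.
have NI u v : e u v -> I <= N u v.
  by move=> /gen_lbound uv; apply: le_trans uv _; rewrite lerDl mulr_ge0.
have := kpow_walk (ltW I_gt0) N0 NI (gdist_walk G x y).
rewrite kpow_shift (bigD1 ord_max)//= binn subnn expr0 !mul1r big1 ?addr0.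
  by rewrite -genpowE; apply: lt_le_trans; rewrite exprn_gt0.
move=> j; rewrite -val_eqE/= => jd; rewrite kpow_out ?mulr0//.
by rewrite ltn_neqAle jd -ltnS ltn_ord.
Qed.

(** The coefficient of c^(d x y) in the expansion of the heat kernel at time c s as
    c tends to 0. *)
Definition leading (s : R) x y : R :=
  s ^+ d x y / (d x y)`!%:R * genpow G (d x y) x y.

Lemma leading_gt0 s x y : 0 < s -> 0 < leading s x y.
Proof.
by move=> s0; rewrite mulr_gt0 ?genpow_gt0// divr_gt0 ?exprn_gt0 ?ltr0n ?fact_gt0.
Qed.

Lemma heat_asymptotics (c_ : nat -> R) (s : R) x y :
  (forall n, 0 < c_ n) -> c_ n @[n --> \oo] --> 0 -> 0 <= s ->
  heat G (c_ n * s) x y / c_ n ^+ d x y @[n --> \oo] --> leading s x y.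
Proof.
move=> c0 cc s0; set D := d x y.
have S2 : 0 <= 2 * S by rewrite mulr_ge0.
apply/cvgrPdist_le => eps eps0 /=.
pose C := (2 * S * s) ^+ D.+1 * expR (2 * S * s).
have C0 : 0 <= C by rewrite mulr_ge0 ?exprn_ge0 ?expR_ge0 ?mulr_ge0.
have cC : c_ n * C @[n --> \oo] --> 0.
  by rewrite -(mul0r C); apply: cvgM => //; exact: cvg_cst.
have /cvgrPdist_le /(_ _ eps0) near_cC := cC.
have /cvgrPdist_lt /(_ _ ltr01) near_c := cc.
apply: filter_app near_cC; apply: filterS near_c => n.
rewrite !sub0r !normrN => c1 hC.
have cn := c0 n; have cD : 0 < c_ n ^+ D by rewrite exprn_gt0.
have c1' : c_ n <= 1 by rewrite (le_trans (ler_norm _))// ltW.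
apply: le_trans hC; rewrite (ger0_norm (mulr_ge0 (ltW cn) C0)).
have cs0 : 0 <= c_ n * s by rewrite mulr_ge0// ltW.
have := heat_lead S_ge0 gen_bound x y cs0; rewrite -/D => hl.
have -> : leading s x y - heat G (c_ n * s) x y / c_ n ^+ D =
  - ((heat G (c_ n * s) x y - (c_ n * s) ^+ D / D`!%:R * genpow G D x y) / c_ n ^+ D).
  have f0 : (D`!%:R : R) != 0 by rewrite pnatr_eq0 -lt0n fact_gt0.
  rewrite /leading -/D exprMn; field.
  by rewrite f0 expf_neq0 ?gt_eqF.
rewrite normrN normrM normfV (ger0_norm (ltW cD)) ler_pdivrMr//.
apply: le_trans hl _; rewrite /C.
have -> : 2 * S * (c_ n * s) = c_ n * (2 * S * s) by ring.
rewrite [(c_ n * _) ^+ _]exprMn [c_ n ^+ D.+1]exprS.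
have -> : c_ n * ((2 * S * s) ^+ D.+1 * expR (2 * S * s)) * c_ n ^+ D =
  c_ n * c_ n ^+ D * (2 * S * s) ^+ D.+1 * expR (2 * S * s) by ring.
rewrite ler_wpM2l ?mulr_ge0 ?exprn_ge0 ?mulr_ge0 ?(ltW cn)//.
by rewrite ler_expR ler_piMl ?mulr_ge0.
Qed.

End SmallTime.

(** * Schroedinger systems with finitely supported marginals *)

Section Support.
Context (R : realType) (X : countType).
Implicit Types nu : X -> R.

Definition supp_seq nu : seq X := finmap.enum_fset (fset_set (supp nu)).

Lemma mem_supp_seq nu x : finite_probability nu -> (x \in supp_seq nu) = (0 < nu x).
Proof.
move=> [_ fn _]; apply: etrans (in_fset_set fn x) _.
by apply/asboolP/idP.
Qed.

Lemma supp_seq_uniq nu : uniq (supp_seq nu).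
Proof. exact: finmap.fset_uniq. Qed.

Lemma finite_probability_ex nu : finite_probability nu -> exists x, 0 < nu x.
Proof.
move=> [nu0 _ nu1]; apply: contrapT => /forallNP h; have := nu1.
rewrite fsbig1 => [/esym/eqP|x _]; first by rewrite oner_eq0.
by apply/eqP; rewrite eq_le nu0 andbT leNgt; apply/negP/h.
Qed.

Lemma not_supp_seq nu x : finite_probability nu -> x \notin supp_seq nu -> nu x = 0.
Proof.
move=> nuP; rewrite mem_supp_seq// -leNgt => h; apply/eqP; rewrite eq_le h/=.
by have [] := nuP.
Qed.

End Support.

Section SchrodingerSystem.
Context (R : realType) (X : countType) (G : graph_space R X) (S I : R).
Local Notation e := (adj G).
Local Notation d := (gdist G).
Local Notation m := (mass G).
Local Notation L := (gen G).
Hypothesis (S_ge1 : 1 <= S) (gen_bound : forall x, `|L x x| <= S).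
Hypothesis (I_gt0 : 0 < I) (gen_lbound : forall x y, e x y -> I <= L x y).

Let hgt0 s x y : 0 < s -> 0 < heat G s x y.
Proof. exact: (heat_gt0 S_ge1 gen_bound I_gt0 gen_lbound). Qed.

Lemma schrodinger_sym nu0 nu1 c f g :
  schrodinger_system G nu0 nu1 c f g -> schrodinger_system G nu1 nu0 c g f.
Proof. by move=> []. Qed.

(** The heat kernel is positive, so P_1 g is positive everywhere as soon as g is
    not zero, and f vanishes exactly where nu0 does. *)
Lemma schrodinger_support nu0 nu1 (c : R) f g : 0 < c ->
  finite_probability nu0 -> schrodinger_system G nu0 nu1 c f g ->
  (forall x, 0 < nu0 x -> 0 < f x) /\ (forall x, x \notin supp_seq nu0 -> f x = 0).
Proof.
move=> c0 nu0P [f0 g0 fE _].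
have [x1 nx1] := finite_probability_ex nu0P.
have sg0 x : (0 <= semigroup G c 1 g x)%E.
  apply: esum_ge0 => y _; rewrite lee_fin mulr_ge0// ltW// hgt0//.
  by rewrite mulr1.
have [y1 gy1] : exists y, 0 < g y.
  apply: contrapT => /forallNP h; have := fE x1.
  rewrite (_ : semigroup G c 1 g x1 = 0%E) ?mule0; last first.
    apply: esum1 => y _; have -> : g y = 0; last by rewrite mulr0.
    by apply/eqP; rewrite eq_le g0 andbT leNgt; apply/negP/h.
  by move=> [/eqP]; rewrite eq_sym mulf_eq0 invr_eq0 !gt_eqF// mass_gt0.
have sgp x : (0 < semigroup G c 1 g x)%E.
  apply: (@lt_le_trans _ _ (heat G (c * 1) x y1 * g y1)%:E).
    by rewrite lte_fin mulr_gt0 ?hgt0 ?mulr1.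
  apply: esum_ge; exists [set y1] => //.
  by rewrite fsbig_set1.
split=> x.
  move=> nx; rewrite lt_neqAle f0 andbT eq_sym; apply/eqP => fx0.
  have := fE x; rewrite fx0 mul0e => -[/esym/eqP].
  by rewrite mulf_eq0 invr_eq0 !gt_eqF// mass_gt0.
move=> /(not_supp_seq nu0P) nx0; have := fE x; rewrite nx0 mul0r => /eqP.
by rewrite mule_eq0 (gt_eqF (sgp x)) orbF => /eqP[].
Qed.

Lemma semigroup_fsum (c t : R) (r : seq X) (h : X -> R) z : 0 < c * t -> uniq r ->
  (forall x, 0 <= h x) -> (forall x, x \notin r -> h x = 0) ->
  semigroup G c t h z = (\sum_(x <- r) heat G (c * t) z x * h x)%:E.
Proof.
move=> ct0 ur h0 hr; rewrite /semigroup.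
rewrite (_ : (\esum_(y in [set: X]) _)%E =
   (\esum_(y in [set` r]) (heat G (c * t) z y * h y)%:E)%E); last first.
  rewrite [RHS]esum_mkcond; apply: eq_esum => y _.
  by case: ifPn => //; rewrite mem_setE => /hr ->; rewrite mulr0.
rewrite esum_fset; [|exact: finite_seq|].
  by rewrite -fsbig_seq// sumEFin.
by move=> y _; rewrite lee_fin mulr_ge0// ltW// hgt0.
Qed.

Lemma semigroup_flow (c t : R) (r : seq X) (h : X -> R) z : 0 < c * t -> uniq r ->
  (forall x, 0 <= h x) -> (forall x, x \notin r -> h x = 0) ->
  fine (semigroup G c t h z) = flow G r h c 0 t z.
Proof.
move=> ct0 ur h0 hr; rewrite (semigroup_fsum z ct0 ur h0 hr)/= /flow mul1r /hsum.
by apply: eq_bigr => x _; rewrite mulrC.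
Qed.

Section Coupling.
Variables (nu0 nu1 : X -> R) (c : R) (f g : X -> R).
Hypothesis (c_gt0 : 0 < c).
Hypothesis (nu0P : finite_probability nu0) (nu1P : finite_probability nu1).
Hypothesis (sys : schrodinger_system G nu0 nu1 c f g).

Let f0 x : 0 <= f x. Proof. by have [] := sys. Qed.
Let g0 x : 0 <= g x. Proof. by have [] := sys. Qed.

Lemma coupling_ge0 x y : 0 <= bridge_coupling G c f g x y.
Proof.
rewrite /bridge_coupling !mulr_ge0 ?(ltW (mass_gt0 _ _))// ltW// hgt0//.
by rewrite mulr1.
Qed.

(** The first marginal of the coupling is nu0. *)
Lemma coupling_le x y : bridge_coupling G c f g x y <= nu0 x.
Proof.
have c1 : 0 < c * 1 by rewrite mulr1.
have [_ gr] := schrodinger_support c_gt0 nu1P (schrodinger_sym sys).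
have nu0x : nu0 x = \sum_(w <- supp_seq nu1) bridge_coupling G c f g x w.
  have [_ _ /(_ x) + _] := sys.
  rewrite (semigroup_fsum x c1 (supp_seq_uniq nu1) g0 gr) -EFinM => -[h].
  have mx : m x != 0 by rewrite gt_eqF// mass_gt0.
  rewrite -[LHS](divfK mx) -h mulrC mulrA mulr_sumr; apply: eq_bigr => w _.
  by rewrite /bridge_coupling; ring.
have [yr|/gr gy0] := boolP (y \in supp_seq nu1).
  rewrite nu0x (bigD1_seq y yr (supp_seq_uniq nu1))/= lerDl sumr_ge0// => w _.
  exact: coupling_ge0.
by rewrite /bridge_coupling gy0 mulr0; have [] := nu0P.
Qed.

Lemma coupling_out x y : x \notin supp_seq nu0 -> bridge_coupling G c f g x y = 0.
Proof.
have [_ fr] := schrodinger_support c_gt0 nu0P sys.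
by move=> /fr fx; rewrite /bridge_coupling fx mulr0 mul0r.
Qed.

End Coupling.

Lemma bridge_coupling_sym c f g x y : 0 <= c ->
  bridge_coupling G c f g x y = bridge_coupling G c g f y x.
Proof.
move=> c0; have S0 : 0 <= S by exact: le_trans ler01 S_ge1.
rewrite /bridge_coupling; have c1 : 0 <= c * 1 by rewrite mulr1.
have := heatn_rev S0 gen_bound 0 x y c1; rewrite !heatn0 => ->.
by rewrite mulrAC.
Qed.

End SchrodingerSystem.

(** * Finite sums over balls and neighbourhoods *)

Section Balls.
Context (R : realType) (X : countType) (G : graph_space R X).
Local Notation e := (adj G).
Local Notation d := (gdist G).

Fixpoint ball_seq (n : nat) (x : X) : seq X :=
  if n is n'.+1 then flatten [seq ball_seq n' v | v <- nbs G x] else [:: x].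

Lemma mem_ball_seq n x z : (d x z <= n)%N -> z \in ball_seq n x.
Proof.
elim: n x => [|n IH] x.
  by rewrite leqn0 gdist_eq0 => /eqP ->; rewrite inE.
move=> xz; suff [v vx vz] : exists2 v, v \in nbs G x & (d v z <= n)%N.
  by apply/flattenP; exists (ball_seq n v); [exact: map_f|exact: IH].
have [dn|dn] := leqP (d x z) n; first by exists x; rewrite // mem_nbs eqxx.
have [p [xp sp lp]] := gdist_walk G x z.
have : (0 < size p)%N by rewrite sp (leq_ltn_trans _ dn).
case: p xp sp lp => // v p /= /andP[xv vp] sp lp _.
exists v; first by rewrite mem_nbs xv orbT.
apply: (@leq_trans (size p)); last by lia.
by apply: gdist_le; exists p.
Qed.

End Balls.

(** The masses brought by reversibility cancel. *)
Lemma rratio_rev (R : realType) (X : countType) (G : graph_space R X) x y z :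
  rratio G x z z y = rratio G y z z x.
Proof.
rewrite /rratio (gdist_sym G z x) (gdist_sym G y z) (gdist_sym G y x).
have h1 := genpow_rev G (gdist G x z) x z; have h2 := genpow_rev G (gdist G z y) z y.
have h3 := genpow_rev G (gdist G x y) x y.
have [mx my mz] : [/\ mass G x != 0, mass G y != 0 & mass G z != 0].
  by split; rewrite gt_eqF ?mass_gt0.
have revE u v (p p' : R) : mass G u != 0 -> mass G u * p = mass G v * p' ->
    p = mass G v * p' / mass G u.
  by move=> mu <-; rewrite mulrAC divff ?mul1r.
rewrite (revE _ _ _ _ mx h1) (revE _ _ _ _ mz h2) (revE _ _ _ _ mx h3) !invfM invrK.
move: (genpow G _ y x)^-1 => u.
by field; rewrite mx my mz.
Qed.

Section Integrand.
Context (R : realType) (X : countType) (G : graph_space R X).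
Local Notation e := (adj G).
Local Notation d := (gdist G).
Local Notation L := (gen G).

Lemma fsum_filter (s : seq X) (P : set X) (b : pred X) (h : X -> R) : uniq s ->
  (forall v, v \in s -> b v -> P v) ->
  (forall v, P v -> h v != 0 -> v \in s /\ b v) ->
  \sum_(v \in P) h v = \sum_(v <- s | b v) h v.
Proof.
move=> us sP Ps; rewrite (fsbigE [seq v <- s | b v]) ?filter_uniq//.
- rewrite -[RHS]big_filter big_seq_cond [RHS]big_seq; apply: eq_bigl => v.
  apply: andb_idr => vs; apply/mem_set.
  by have := vs; rewrite (mem_filter b v s) => /andP[bv vz]; exact: sP.
- move=> v vs; have : v \in [seq w <- s | b w] by exact: vs.
  by rewrite mem_filter => /andP[bv vz]; exact: sP.
- move=> v Pv vs; apply/eqP; apply: contraNT vs => hv.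
  by have [vz bv] := Ps v Pv hv; rewrite mem_filter bv vz.
Qed.

Lemma fsum_nbs (P : set X) (b : pred X) z (h : X -> R) :
  (forall v, P v <-> v \in nbs G z /\ b v) ->
  \sum_(v \in P) h v = \sum_(v <- nbs G z | b v) h v.
Proof.
move=> PE; apply: fsum_filter; first exact: nbs_uniq.
  by move=> v vz bv; exact: (proj2 (PE v)).
by move=> v Pv _; exact: (proj1 (PE v)).
Qed.

Lemma integrandE (A AA : X -> R) z :
  integrand G (V G z) (VV G z) A AA z =
  (\sum_(v <- nbs G z | e z v) A v * L z v) ^+ 2 +
  \sum_(v <- nbs G z | e z v) \sum_(w <- nbs G v | d z w == 2%N)
     rho (A v) (AA w) * L v w * L z v.
Proof.
have Vz v : V G z v <-> v \in nbs G z /\ e z v.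
  by rewrite /V/= mem_nbs; split=> [->|[]//]; rewrite orbT.
rewrite /integrand (fsum_nbs _ Vz); congr (_ + _).
rewrite (fsum_nbs _ Vz); apply: eq_bigr => v zv.
apply: fsum_nbs => w; rewrite /VV/= mem_nbs; split.
  by move=> [dw vw]; rewrite vw orbT dw.
move=> [/orP[/eqP ->|vw] /eqP dw]; last by split.
by move: dw zv; rewrite -gdist_eq1 => ->.
Qed.

End Integrand.

(** * Limits of the slowed-down bridges *)

Section Limit.
Context (R : realType) (X : countType) (G : graph_space R X) (S I : R).
Local Notation e := (adj G).
Local Notation d := (gdist G).
Local Notation m := (mass G).
Local Notation L := (gen G).
Local Notation K := (growth S I).
Hypothesis (S_ge1 : 1 <= S) (gen_bound : forall x, `|L x x| <= S).
Hypothesis (I_gt0 : 0 < I) (I_le1 : I <= 1).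
Hypothesis (gen_lbound : forall x y, e x y -> I <= L x y).
Variables (nu0 nu1 : X -> R).
Hypothesis (nu0P : finite_probability nu0) (nu1P : finite_probability nu1).
Variables (c : nat -> R) (f g : nat -> X -> R).
Hypothesis (c_gt0 : forall n, 0 < c n) (c_cvg0 : c n @[n --> \oo] --> (0 : R)).
Hypothesis (sys : forall n, schrodinger_system G nu0 nu1 (c n) (f n) (g n)).
Variable (pihat : X -> X -> R).
Hypothesis (pihat_lim : forall x y,
  bridge_coupling G (c n) (f n) (g n) x y @[n --> \oo] --> pihat x y).
Variables (t : R).
Hypothesis (t01 : 0 < t < 1).

Let r := supp_seq nu0.
Let r' := supp_seq nu1.
Let t0 : 0 < t. Proof. by case/andP: t01. Qed.
Let t1 : 0 < 1 - t. Proof. by rewrite subr_gt0; case/andP: t01. Qed.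
Let hgt0 s x y : 0 < s -> 0 < heat G s x y.
Proof. exact: (heat_gt0 S_ge1 gen_bound I_gt0 gen_lbound). Qed.
Let f0 n x : 0 <= f n x. Proof. by have [] := sys n. Qed.
Let g0 n x : 0 <= g n x. Proof. by have [] := sys n. Qed.

Definition source_flow n z : R := flow G (supp_seq nu0) (f n) (c n) 0 t z.
Definition target_flow n z : R := flow G (supp_seq nu1) (g n) (c n) 0 (1 - t) z.

Let F := source_flow.
Let H := target_flow.
Let Q n z := bridge_marginal G (c n) (f n) (g n) t z.

Lemma bridge_marginalE n z : Q n z = m z * F n z * H n z.
Proof.
have [_ fr] := schrodinger_support S_ge1 gen_bound I_gt0 gen_lbound (c_gt0 n) nu0P (sys n).
have [_ gr] := schrodinger_support S_ge1 gen_bound I_gt0 gen_lbound (c_gt0 n) nu1P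
  (schrodinger_sym (sys n)).
rewrite /Q /bridge_marginal.
rewrite (semigroup_flow S_ge1 gen_bound I_gt0 gen_lbound _ _ _ _ fr) ?supp_seq_uniq ?mulr_gt0//.
by rewrite (semigroup_flow S_ge1 gen_bound I_gt0 gen_lbound _ _ _ _ gr) ?supp_seq_uniq ?mulr_gt0.
Qed.

Lemma pihat_ge0 x y : 0 <= pihat x y.
Proof.
have h0 : (0 : R) @[n --> \oo] --> (0 : R) by exact: cvg_cst.
apply: (ler_cvg_to h0 (@pihat_lim x y)).
by apply: nearW => n; exact: (coupling_ge0 S_ge1 gen_bound I_gt0 gen_lbound (c_gt0 n) (sys n)).
Qed.

Lemma pihat_out x y : x \notin r -> pihat x y = 0.
Proof.
move=> xr; have := @pihat_lim x y.
rewrite (_ : (fun n => _) = fun=> 0); last first.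
  apply/funext => n.
  exact: (coupling_out S_ge1 gen_bound I_gt0 gen_lbound (c_gt0 n) nu0P (sys n)).
by move=> h; apply: (@cvg_unique _ (@Rhausdorff R) _ _ _ _ h); exact: cvg_cst.
Qed.

Let fgE n x y : f n x * g n y =
  bridge_coupling G (c n) (f n) (g n) x y / (m x * heat G (c n * 1) x y).
Proof.
have c1 : 0 < c n * 1 by rewrite mulr1.
have mx := mass_gt0 G x; have hx := hgt0 x y c1.
rewrite /bridge_coupling; field.
by rewrite !gt_eqF.
Qed.

Let cvg_pow k : c n ^+ k @[n --> \oo] --> ((k == 0%N)%:R : R).
Proof.
case: k => [|k]; first by under eq_fun do rewrite expr0; exact: cvg_cst.
rewrite -(expr0n R k.+1); elim: k => [|k IH].
  by under eq_fun do rewrite expr1; rewrite expr1.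
by under eq_fun do rewrite exprS; rewrite exprS; exact: cvgM.
Qed.

(** The limit of c^(j + d z y) F v g y, for v at distance j from z.  A source w
    counts only if a geodesic from w to y passes through v and then z; the other
    terms carry an additional power of c. *)
Definition source_limit j z y v : R :=
  \sum_(w <- supp_seq nu0) if (j + d z y + d v w == d w y)%N then
    leading G t v w / (m w * leading G 1 w y) * pihat w y else 0.

Let asymp s x y : 0 < s -> heat G (c n * s) x y / c n ^+ d x y @[n --> \oo] -->
  leading G s x y.
Proof. by move=> s0; apply: (heat_asymptotics S_ge1 gen_bound) => //; exact: ltW. Qed.

Let lead_gt0 s x y : 0 < s -> 0 < leading G s x y.
Proof. exact: (leading_gt0 S_ge1 gen_bound I_gt0 gen_lbound). Qed.

(** Multiplying by g y expresses the unknown f w through the coupling at (w, y),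
    which converges. *)
Lemma source_flow_cvg z y v :
  c n ^+ (d z v + d z y) * (F n v * g n y) @[n --> \oo] -->
  source_limit (d z v) z y v.
Proof.
pose T n w := c n ^+ (d z v + d z y + d v w - d w y) *
  ((heat G (c n * t) v w / c n ^+ d v w) /
   (m w * (heat G (c n * 1) w y / c n ^+ d w y)) *
   bridge_coupling G (c n) (f n) (g n) w y).
rewrite (_ : (fun n => _) = (fun n => \sum_(w <- r) T n w)); last first.
  apply/funext => n; rewrite /F /source_flow /flow mul1r /hsum mulr_suml mulr_sumr.
  apply: eq_bigr => w _; rewrite heatn0 mulrAC fgE /T.
  have cn0 k : c n ^+ k != 0 by rewrite expf_neq0// gt_eqF.
  have mw : m w != 0 by rewrite gt_eqF// mass_gt0.
  have c1 : 0 < c n * 1 by rewrite mulr1.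
  have h0 : heat G (c n * 1) w y != 0 by rewrite gt_eqF// hgt0.
  have tri : (d w y <= d z v + d z y + d v w)%N.
    have := gdist_triangle G v w y; have := gdist_triangle G z v y.
    by rewrite (gdist_sym G v w) (gdist_sym G v z); clear; lia.
  have E : c n ^+ (d z v + d z y) * c n ^+ d v w =
      c n ^+ (d z v + d z y + d v w - d w y) * c n ^+ d w y.
    by rewrite -!exprD subnK.
  have -> : c n ^+ (d z v + d z y) =
      c n ^+ (d z v + d z y + d v w - d w y) * c n ^+ d w y / c n ^+ d v w.
    by rewrite -E mulfK.
  move: (c n ^+ _) (c n ^+ d w y) (c n ^+ d v w) (cn0 (d w y)) (cn0 (d v w)) => p q s q0 s0.
  by field; rewrite h0 mw q0 s0.
apply: (@cvg_sum_seq _ nat \oo _ X r T) => w; rewrite /T.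
have lim : (heat G (c n * t) v w / c n ^+ d v w) /
   (m w * (heat G (c n * 1) w y / c n ^+ d w y)) *
   bridge_coupling G (c n) (f n) (g n) w y @[n --> \oo] -->
   leading G t v w / (m w * leading G 1 w y) * pihat w y.
  apply: cvgM => //; apply: cvgM; first exact: asymp.
  apply: cvgV; last by apply: cvgM; [exact: cvg_cst|exact: asymp].
  by rewrite mulf_neq0 ?gt_eqF ?mass_gt0 ?lead_gt0.
have := cvgM (@cvg_pow (d z v + d z y + d v w - d w y)) lim.
have tri : (d w y <= d z v + d z y + d v w)%N.
  have := gdist_triangle G v w y; have := gdist_triangle G z v y.
  by rewrite (gdist_sym G v w) (gdist_sym G v z); clear; lia.
have -> : (d z v + d z y + d v w - d w y == 0)%N = (d z v + d z y + d v w == d w y)%N.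
  by rewrite subn_eq0 [RHS]eqn_leq tri andbT.
by case: (_ == d w y)%N; rewrite /= ?mulr1n ?mulr0n ?mul1r ?mul0r => h; exact: h.
Qed.

(** The limit bridge at time t, in the form given by the small-time asymptotics. *)
Definition marginal_limit z : R :=
  \sum_(x <- supp_seq nu0) \sum_(y <- supp_seq nu1)
    if (d z x + d z y == d x y)%N then
      m z * (leading G t z x * leading G (1 - t) z y / (m x * leading G 1 x y)
      * pihat x y) else 0.

Lemma marginal_cvg z : Q n z @[n --> \oo] --> marginal_limit z.
Proof.
pose T n x y := c n ^+ (d z x + d z y - d x y) * (m z *
  ((heat G (c n * t) z x / c n ^+ d z x) * (heat G (c n * (1 - t)) z y / c n ^+ d z y) /
   (m x * (heat G (c n * 1) x y / c n ^+ d x y)) *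
   bridge_coupling G (c n) (f n) (g n) x y)).
have tri x y : (d x y <= d z x + d z y)%N.
  by rewrite (gdist_sym G z x) gdist_triangle.
rewrite (_ : (fun n => _) = (fun n => \sum_(x <- r) \sum_(y <- r') T n x y)); last first.
  apply/funext => n; rewrite bridge_marginalE /F /H /source_flow /target_flow /flow.
  rewrite !mul1r /hsum -mulrA mulr_suml mulr_sumr; apply: eq_bigr => x _.
  rewrite !mulr_sumr; apply: eq_bigr => y _; rewrite !heatn0 /T.
  have -> : m z * (f n x * heat G (c n * t) z x * (g n y * heat G (c n * (1 - t)) z y)) =
   m z * (heat G (c n * t) z x * heat G (c n * (1 - t)) z y * (f n x * g n y)) by ring.
  rewrite fgE.
  have cn0 k : c n ^+ k != 0 by rewrite expf_neq0// gt_eqF.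
  have mx : m x != 0 by rewrite gt_eqF// mass_gt0.
  have c1 : 0 < c n * 1 by rewrite mulr1.
  have h0 : heat G (c n * 1) x y != 0 by rewrite gt_eqF// hgt0.
  have -> : c n ^+ (d z x + d z y - d x y) = c n ^+ d z x * c n ^+ d z y / c n ^+ d x y.
    by rewrite -exprD -{2}(subnK (tri x y)) exprD mulfK.
  move: (c n ^+ d x y) (c n ^+ d z x) (c n ^+ d z y) (cn0 (d x y)) (cn0 (d z x)) (cn0 (d z y)).
  by move=> p q s p0 q0 s0; field; rewrite h0 mx q0 s0 p0.
apply: (@cvg_sum_seq _ nat \oo _ X r (fun n x => \sum_(y <- r') T n x y)) => x.
apply: (@cvg_sum_seq _ nat \oo _ X r' (fun n y => T n x y)) => y; rewrite /T.
have lim : m z * ((heat G (c n * t) z x / c n ^+ d z x) *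
   (heat G (c n * (1 - t)) z y / c n ^+ d z y) /
   (m x * (heat G (c n * 1) x y / c n ^+ d x y)) *
   bridge_coupling G (c n) (f n) (g n) x y) @[n --> \oo] -->
   m z * (leading G t z x * leading G (1 - t) z y / (m x * leading G 1 x y) * pihat x y).
  apply: cvgM; first exact: cvg_cst.
  apply: cvgM => //; apply: cvgM; first by apply: cvgM; exact: asymp.
  apply: cvgV; last by apply: cvgM; [exact: cvg_cst|exact: asymp].
  by rewrite mulf_neq0 ?gt_eqF ?mass_gt0 ?lead_gt0.
have := cvgM (@cvg_pow (d z x + d z y - d x y)) lim.
have -> : (d z x + d z y - d x y == 0)%N = (d z x + d z y == d x y)%N.
  by rewrite subn_eq0 [RHS]eqn_leq tri andbT.
by case: (_ == d x y)%N; rewrite /= ?mulr1n ?mulr0n ?mul1r ?mul0r => h; exact: h.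
Qed.

Lemma marginal_limit_gt0 z : 0 < marginal_limit z ->
  exists x y, [/\ x \in supp_seq nu0, y \in supp_seq nu1, 0 < pihat x y & between G x y z].
Proof.
move=> mz; apply: contrapT => h; move: mz; rewrite lt_neqAle eq_sym => /andP[/eqP + _].
apply; rewrite /marginal_limit big_seq big1// => x xr; rewrite big_seq big1// => y yr.
case: ifP => // /eqP dE; have [p0|] := eqVneq (pihat x y) 0.
  by rewrite p0 !mulr0.
move=> p0; exfalso; apply: h; exists x, y; split => //.
  by rewrite lt_neqAle eq_sym p0 pihat_ge0.
by apply/betweenP; rewrite (gdist_sym G x z).
Qed.

(** * Identification of the coefficients *)

(** The factor, common to all v and j, between the coefficients of the theorem and
    source_limit: it cancels in A1 and A2. *)
Let kappa z y : R :=
  genpow G (d y z) y z * (1 - t) ^+ d y z / (d y z)`!%:R * (m y / nu1 y).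

Let S_ge0 : 0 <= S. Proof. exact: le_trans ler01 S_ge1. Qed.

Let gpos x y : 0 < genpow G (d x y) x y.
Proof. exact: (genpow_gt0 S_ge1 gen_bound I_gt0 gen_lbound). Qed.

Let fact_pos n : 0 < (n`!%:R : R). Proof. by rewrite ltr0n fact_gt0. Qed.

Lemma kappa_gt0 z y : 0 < nu1 y -> 0 < kappa z y.
Proof.
move=> ny; rewrite /kappa mulr_gt0 ?divr_gt0 ?mass_gt0//.
by rewrite mulr_gt0 ?exprn_gt0 ?gpos.
Qed.

(** N stands for the product of the first j factors d y w, d y w - 1 of a falling
    factorial: with it, the binomial coefficient becomes the quotient of the
    factorials that come with the leading coefficients. *)
Let coefficientE z y v w j (N : R) : 0 < nu1 y ->
  d y w = (j + d y z + d v w)%N -> d z w = (j + d v w)%N ->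
  N * 'C(d y w - j, d z w - j)%:R * ((d y z)`!%:R * (d v w)`!%:R) = (d y w)`!%:R ->
  rratio G y z v w * N * binmass t (d y w - j) (d z w - j) * kernel_bwd nu1 pihat w y =
  kappa z y * (leading G t v w / (m w * leading G 1 w y) * pihat w y).
Proof.
move=> ny yw zw NE; rewrite /rratio /binmass /kernel_bwd /kappa /leading expr1n.
rewrite (gdist_sym G w y).
have hq : (d z w - j = d v w)%N by rewrite zw addKn.
have hp : (d y w - j - (d z w - j) = d y z)%N by rewrite hq yw -addnA addKn addnK.
have gr : m w * genpow G (d y w) w y = m y * genpow G (d y w) y w by exact: genpow_rev.
have -> : genpow G (d y w) w y = m y * genpow G (d y w) y w / m w.
  by rewrite -gr mulrAC divff ?mul1r// gt_eqF ?mass_gt0.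
rewrite hp hq; rewrite hq in NE.
have [p0 q0] := (fact_pos (d y z), fact_pos (d v w)).
have n0 := fact_pos (d y w); have [g1 g3] := (gpos y z, gpos y w).
have [my mw] := (mass_gt0 G y, mass_gt0 G w).
rewrite -NE in n0 *.
have NC : N * 'C(d y w - j, d v w)%:R != 0.
  by apply: contraTneq n0 => ->; rewrite mul0r ltxx.
move: ('C(_, _)%:R) NC (genpow G (d y z) y z) g1 (genpow G (d v w) v w)
  (genpow G (d y w) y w) g3 p0 q0 => C NC a a0 b e' e0.
move: ((d y z)`!%:R) ((d v w)`!%:R) (t ^+ _) ((1 - t) ^+ _) => P Q' T U P0 Q0.
have [N0 C0] : N != 0 /\ C != 0 by move: NC; rewrite mulf_eq0 negb_or => /andP[].
field.
by rewrite N0 C0 !gt_eqF.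
Qed.

Let geodesic_dist z y v w : between2 G y w z v ->
  [/\ d z w = (d z v + d v w)%N, d y w = (d z v + d y z + d v w)%N & z != v].
Proof.
move=> /between2P[zv dE].
have := gdist_triangle G z y w; have := gdist_triangle G v z w.
move=> h1 h2; split=> //; move: dE h1 h2; clear; lia.
Qed.

Let fact_binomial (p q n : nat) : n = (p + q)%N ->
  'C(n, q)%:R * (p`!%:R * q`!%:R) = (n`!%:R : R).
Proof.
move=> ->; rewrite -!natrM; congr (_%:R).
by rewrite -(bin_fact (leq_addl p q)) addnK [(p`! * _)%N]mulnC.
Qed.

Let sum_source_limit z y v j (P : set X) (h : X -> R) :
  d z v = j -> 0 < nu1 y ->
  (forall w, P w <-> (j + d z y + d v w == d w y)%N) ->
  (forall w, pihat w y = 0 -> h w = 0) ->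
  (forall w, P w -> h w =
     kappa z y * (leading G t v w / (m w * leading G 1 w y) * pihat w y)) ->
  \sum_(w \in P) h w = kappa z y * source_limit j z y v.
Proof.
move=> zv ny PE h0 hE.
rewrite (@fsum_filter _ _ (supp_seq nu0) P (fun w => j + d z y + d v w == d w y)%N);
  [|exact: supp_seq_uniq|by move=> w _ bw; exact: (proj2 (PE w))|]; last first.
  move=> w Pw hw; split; last exact: (proj1 (PE w)).
  by apply: contraNT hw => /(@pihat_out w y)/h0 ->.
rewrite /source_limit mulr_sumr big_mkcond; apply: eq_bigr => w _.
by case: ifP => [/(proj2 (PE w))/hE //|_]; rewrite mulr0.
Qed.

Let kernel_bwd0 w y : pihat w y = 0 -> kernel_bwd nu1 pihat w y = 0.
Proof. by rewrite /kernel_bwd => ->; rewrite mul0r. Qed.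

Let between2_flow z y v w j : d z v = j -> (0 < j)%N ->
  between2 G y w z v <-> (j + d z y + d v w == d w y)%N.
Proof.
move=> zv j0; rewrite (gdist_sym G w y) (gdist_sym G z y); split.
  by move=> /geodesic_dist[_ -> _]; rewrite zv.
move=> /eqP dE; apply/between2P; split.
  by rewrite -(gdist_eq0 G) zv -lt0n.
by rewrite zv -dE; clear; lia.
Qed.

Lemma a1E z y v : 0 < nu1 y -> e z v ->
  a1 G nu1 pihat t z v y = kappa z y * source_limit 1 z y v.
Proof.
rewrite -gdist_eq1 => ny /eqP zv; rewrite /a1.
apply: sum_source_limit => //; first by move=> w; exact: between2_flow.
  by move=> w /kernel_bwd0 ->; rewrite mulr0.
move=> w /geodesic_dist[]; rewrite zv => zw yw _.
apply: coefficientE => //.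
have -> : (d z w - 1 = d v w)%N by rewrite zw addKn.
have nE : (d y w - 1 = d y z + d v w)%N by rewrite yw -addnA addKn.
rewrite -mulrA (fact_binomial nE) -natrM; congr (_%:R).
by rewrite {1}yw -{2}(prednK (_ : (0 < d y w)%N)) ?yw// factS subn1.
Qed.

Lemma a2E z y v : 0 < nu1 y -> d z v = 2%N ->
  a2 G nu1 pihat t z v y = kappa z y * source_limit 2 z y v.
Proof.
move=> ny zv; rewrite /a2.
apply: sum_source_limit => //; first by move=> w; exact: between2_flow.
  by move=> w /kernel_bwd0 ->; rewrite mulr0.
move=> w /geodesic_dist[]; rewrite zv => zw yw _.
apply: coefficientE => //.
have -> : (d z w - 2 = d v w)%N by rewrite zw addKn.
have nE : (d y w - 2 = d y z + d v w)%N by rewrite yw -addnA addKn.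
rewrite -mulrA (fact_binomial nE) nE.
have -> : d y w = (d y z + d v w).+2 by rewrite yw; clear; lia.
rewrite !factS !natrM mulrA; congr (_ * _ * _).
by rewrite -[in LHS]addn1 natrD addrK.
Qed.

Lemma a0E z y : 0 < nu1 y ->
  a0 G nu1 pihat t z y = kappa z y * source_limit 0 z y z.
Proof.
move=> ny; rewrite /a0.
pose P := [set w | between G w y z].
have -> : \sum_(w \in [set: X]) Qxy G t w y z * kernel_bwd nu1 pihat w y =
    \sum_(w \in P) rratio G w z z y * binmass t (d w y) (d w z) * kernel_bwd nu1 pihat w y.
  rewrite [RHS]fsbig_mkcond; apply: eq_fsbigr => w _; rewrite patchE /Qxy.
  by case: (asboolP (between G w y z)) => bw; [rewrite ifT ?inE|rewrite ifF ?mul0r//; apply/negbTE; rewrite notin_setE].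
apply: sum_source_limit => //; first exact: gdistxx.
- move=> w; rewrite /P/= add0n; split=> [/betweenP dE|/eqP dE].
    by rewrite addnC (gdist_sym G z w) dE.
  by apply/betweenP; rewrite -dE addnC (gdist_sym G z w).
- by move=> w /kernel_bwd0 ->; rewrite mulr0.
move=> w /betweenP dE.
have yw : d y w = (0 + d y z + d z w)%N.
  by rewrite add0n (gdist_sym G y w) -dE addnC (gdist_sym G w z) (gdist_sym G z y).
rewrite -(@coefficientE z y z w 0 1)//; last first.
  rewrite !subn0 mul1r; apply: fact_binomial.
  by rewrite yw add0n.
by rewrite !subn0 mulr1 (gdist_sym G w y) (gdist_sym G w z) rratio_rev.
Qed.

Lemma source_limit_gt0 z y x : 0 < pihat x y -> between G x y z ->
  0 < source_limit 0 z y z.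
Proof.
move=> pxy /betweenP dE.
have xr : x \in supp_seq nu0.
  by apply: contraTT pxy => /(@pihat_out x y) ->; rewrite ltxx.
have term w : 0 <= leading G t z w / (m w * leading G 1 w y) * pihat w y.
  apply: mulr_ge0; last exact: pihat_ge0.
  by apply/ltW/divr_gt0; [exact: lead_gt0|rewrite mulr_gt0 ?mass_gt0 ?lead_gt0].
have xz : (0 + d z y + d z x == d x y)%N.
  by rewrite add0n addnC (gdist_sym G z x) dE.
rewrite /source_limit (bigD1_seq x xr (supp_seq_uniq nu0))/= xz ltr_pwDl//.
  apply: mulr_gt0 => //.
  by apply: divr_gt0; [exact: lead_gt0|rewrite mulr_gt0 ?mass_gt0 ?lead_gt0].
by apply: sumr_ge0 => w _; case: ifP.
Qed.

(** The unknown g y and the common power of c cancel in a quotient of two source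
    flows. *)
Lemma source_ratio_cvg z y v : 0 < nu1 y -> 0 < source_limit 0 z y z ->
  c n ^+ d z v * (F n v / F n z) @[n --> \oo] -->
  source_limit (d z v) z y v / source_limit 0 z y z.
Proof.
move=> ny sl; have h1 := @source_flow_cvg z y v; have h2 := @source_flow_cvg z y z.
rewrite gdistxx in h2.
have h : (c n ^+ (d z v + d z y) * (F n v * g n y)) /
    (c n ^+ (0 + d z y) * (F n z * g n y)) @[n --> \oo] -->
    source_limit (d z v) z y v / source_limit 0 z y z.
  by apply: cvgM => //; apply: cvgV => //; rewrite gt_eqF.
apply: cvg_trans h; apply: near_eq_cvg; apply: nearW => n /=.
have [gp _] := schrodinger_support S_ge1 gen_bound I_gt0 gen_lbound (c_gt0 n) nu1P
  (schrodinger_sym (sys n)).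
have [fp _] := schrodinger_support S_ge1 gen_bound I_gt0 gen_lbound (c_gt0 n) nu0P (sys n).
have gy : g n y != 0 by rewrite gt_eqF ?gp.
have Fz : F n z != 0.
  have [x1 nx1] := finite_probability_ex nu0P.
  rewrite gt_eqF// /F /source_flow.
  apply: (flow_gt0 S_ge1 gen_bound I_gt0 gen_lbound (f0 n) (c_gt0 n) z (x1 := x1)) => //.
    by rewrite mem_supp_seq.
  exact: fp.
have cz : c n ^+ d z y != 0 by rewrite expf_neq0 ?gt_eqF.
rewrite exprD add0n; field.
by rewrite gy Fz cz.
Qed.

Lemma weak_limitE q : weak_cvg Q q -> forall z, q z = marginal_limit z.
Proof.
move=> wq z; pose h x : R := (x == z)%:R.
have hE (mu : X -> R) : csum (fun x => h x * mu x) = mu z.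
  rewrite (@csum_seq _ _ [:: z])//; first by rewrite big_seq1 /h eqxx mul1r.
  by move=> x; rewrite inE => /negbTE xz; rewrite /h xz mul0r.
have hb : exists B : R, forall x, `|h x| <= B.
  by exists 1 => x; rewrite /h; case: (x == z); rewrite ?normr1 ?normr0.
have := wq h hb; rewrite hE; under eq_fun do rewrite hE; move=> qz.
by apply: (@cvg_unique _ (@Rhausdorff R) _ _ _ _ qz); exact: marginal_cvg.
Qed.

(** * Tightness and the Fatou argument *)

Section Tightness.
Variables (x0 : X) (D : nat).
Hypothesis rD : forall x, x \in supp_seq nu0 -> (d x0 x <= D)%N.
Hypothesis rD' : forall y, y \in supp_seq nu1 -> (d x0 y <= D)%N.

Let E : R := expR (4 * S).
Let low x y : R := I ^+ d x y / (d x y)`!%:R * expR (- S).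

Let tightness : R := \sum_(x <- supp_seq nu0) \sum_(y <- supp_seq nu1) E * E * (nu0 x / low x y).

Let low_gt0 x y : 0 < low x y.
Proof. by rewrite /low mulr_gt0 ?expR_gt0// divr_gt0 ?exprn_gt0. Qed.

Let heat_le s n x y : 0 <= s -> s <= 1 -> c n <= 1 ->
  `|heat G (c n * s) x y| <= E * c n ^+ d x y.
Proof.
move=> s0 s1 cn1; have cn0 := ltW (c_gt0 n).
have := @heatn_small _ _ G S S_ge1 gen_bound 0 (c n * s) (c n) x y.
rewrite expr0 mul1r subn0 heatn0; apply => //; first exact: mulr_ge0.
by rewrite -[leRHS]mulr1 ler_wpM2l.
Qed.

Let marginalE n z : Q n z = \sum_(x <- supp_seq nu0) \sum_(y <- supp_seq nu1)
  heat G (c n * t) x z * heat G (c n * (1 - t)) z y *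
  (bridge_coupling G (c n) (f n) (g n) x y / heat G (c n * 1) x y).
Proof.
rewrite bridge_marginalE /F /H /source_flow /target_flow /flow.
rewrite !mul1r /hsum -mulrA mulr_suml mulr_sumr; apply: eq_bigr => x _.
rewrite !mulr_sumr; apply: eq_bigr => y _; rewrite !heatn0.
have ct : 0 <= c n * t by rewrite mulr_ge0 ?ltW.
have := heatn_rev S_ge0 gen_bound 0 z x ct; rewrite !heatn0 => zx.
have -> : m z * (f n x * heat G (c n * t) z x * (g n y * heat G (c n * (1 - t)) z y)) =
  (m z * heat G (c n * t) z x) * heat G (c n * (1 - t)) z y * (f n x * g n y) by ring.
have c1 : 0 < c n * 1 by rewrite mulr1.
rewrite zx fgE; field.
by rewrite !gt_eqF ?hgt0 ?mass_gt0.
Qed.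

(** A bridge from x to y visiting z carries d x z + d z y - d x y powers of c, and
    this excess is at least d x0 z - 3 D when x and y are within D of x0. *)
Lemma marginal_bound n z : c n <= 1 ->
  0 <= Q n z /\ Q n z <= tightness * c n ^+ (d x0 z - 3 * D).
Proof.
move=> cn1; have cn0 := ltW (c_gt0 n).
have c1 : 0 < c n * 1 by rewrite mulr1.
have [ct cs] : 0 < c n * t /\ 0 < c n * (1 - t) by rewrite !mulr_gt0.
have pi0 x y : 0 <= bridge_coupling G (c n) (f n) (g n) x y.
  exact: (coupling_ge0 S_ge1 gen_bound I_gt0 gen_lbound (c_gt0 n) (sys n)).
rewrite marginalE; split.
  apply: sumr_ge0 => x _; apply: sumr_ge0 => y _.
  by apply: mulr_ge0; [apply: mulr_ge0; apply/ltW/hgt0|apply: divr_ge0 => //; apply/ltW/hgt0].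
rewrite /tightness mulr_suml big_seq [leRHS]big_seq; apply: ler_sum => x xr.
rewrite mulr_suml big_seq [leRHS]big_seq; apply: ler_sum => y yr.
have pile : bridge_coupling G (c n) (f n) (g n) x y <= nu0 x.
  exact: (coupling_le S_ge1 gen_bound I_gt0 gen_lbound (c_gt0 n) nu0P nu1P (sys n)).
have h1 : heat G (c n * t) x z <= E * c n ^+ d x z.
  by apply: le_trans (ler_norm _) (heat_le _ _ _ _ _) => //; move: t01; lra.
have h2 : heat G (c n * (1 - t)) z y <= E * c n ^+ d z y.
  by apply: le_trans (ler_norm _) (heat_le _ _ _ _ _) => //; move: t01; lra.
have h3 : c n ^+ d x y * low x y <= heat G (c n * 1) x y.
  apply: le_trans (heat_lower S_ge0 gen_bound x y (ltW c1) (ltW I_gt0) gen_lbound).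
  rewrite mulr1 exprMn /low !mulrA ler_wpM2l//.
    by rewrite divr_ge0 ?mulr_ge0 ?exprn_ge0 ?ltW.
  by rewrite ler_expR lerN2 -[leRHS]mulr1 ler_wpM2l.
have cp k : 0 < c n ^+ k by rewrite exprn_gt0.
have xy := low_gt0 x y.
have h4 : bridge_coupling G (c n) (f n) (g n) x y / heat G (c n * 1) x y <=
    nu0 x / (c n ^+ d x y * low x y).
  apply: ler_pM => //; first by rewrite invr_ge0 ltW// hgt0.
  by rewrite lef_pV2 ?posrE; [exact: h3|exact: hgt0|exact: mulr_gt0].
have nx : 0 <= nu0 x by case: nu0P.
have E0 : 0 <= E by exact: expR_ge0.
apply: (@le_trans _ _ (E * c n ^+ d x z * (E * c n ^+ d z y) *
   (nu0 x / (c n ^+ d x y * low x y)))).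
  apply: ler_pM => //.
  - by apply: mulr_ge0; apply/ltW/hgt0.
  - by apply: divr_ge0 => //; apply/ltW/hgt0.
  - by apply: ler_pM => //; apply/ltW/hgt0.
have tri : (d x y <= d x z + d z y)%N by exact: gdist_triangle.
have -> : E * c n ^+ d x z * (E * c n ^+ d z y) *
   (nu0 x / (c n ^+ d x y * low x y)) =
   E * E * (nu0 x / low x y) * c n ^+ (d x z + d z y - d x y).
  have -> : c n ^+ (d x z + d z y - d x y) = c n ^+ d x z * c n ^+ d z y / c n ^+ d x y.
    by rewrite -exprD -{2}(subnK tri) exprD mulfK// gt_eqF.
  by field; rewrite !gt_eqF.
apply: ler_wpM2l; first by rewrite !mulr_ge0 ?invr_ge0// ltW.
apply: ler_wiXn2l => //.
have := rD xr; have := rD' yr; have := gdist_triangle G x x0 z.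
have := gdist_triangle G x0 x y; rewrite (gdist_sym G x x0); move: tri; clear; lia.
Qed.

Let K_ge1 : 1 <= K. Proof. exact: (growth_ge1 S_ge1 I_gt0 I_le1). Qed.

Let F_gt0 n z : 0 < F n z.
Proof.
have [fp _] := schrodinger_support S_ge1 gen_bound I_gt0 gen_lbound (c_gt0 n) nu0P (sys n).
have [x1 nx1] := finite_probability_ex nu0P.
apply: (flow_gt0 S_ge1 gen_bound I_gt0 gen_lbound (f0 n) (c_gt0 n) z (x1 := x1)) => //.
  by rewrite mem_supp_seq.
exact: fp.
Qed.

Let Ca : R := (flow_const S I D t + S) / I.

Let dissipation_rate_lower n z : c n <= 1 ->
  - ((2 * S) ^+ 2 * (4 * Ca ^+ 2) * (K ^+ 2) ^+ d x0 z) <= dissipation_rate G (c n) (F n) z.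
Proof.
move=> cn1; have [tle1 tge0] : t <= 1 /\ 0 <= t by move: t01; lra.
have k1 := flow_const_ge1 S_ge1 I_gt0 I_le1 D t0 tle1.
have Kz : 1 <= K ^+ d x0 z by rewrite exprn_ege1.
have kK : 1 <= flow_const S I D t * K ^+ d x0 z by rewrite mulr_ege1.
have Ca1 : 1 <= Ca.
  by rewrite /Ca ler_pdivlMr// mul1r; move: k1 I_le1 S_ge1; lra.
have A1 : 1 <= Ca * K ^+ d x0 z by rewrite mulr_ege1.
apply: le_trans (@dissipation_rate_ge _ _ G S S_ge1 gen_bound (c n) (Ca * K ^+ d x0 z)
  (F n) z (c_gt0 n) cn1 (F_gt0 n) _).
  have -> : (2 * S) ^+ 2 * (4 * Ca ^+ 2) * (K ^+ 2) ^+ d x0 z =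
      (2 * S) ^+ 2 * (4 * (Ca * K ^+ d x0 z) ^+ 2).
    by rewrite -[(K ^+ 2) ^+ _]exprM [(2 * _)%N]mulnC exprM; ring.
  rewrite lerN2 ler_wpM2l ?sqr_ge0//.
  have : 1 <= (Ca * K ^+ d x0 z) ^+ 2 by rewrite exprn_ege1.
  by move: (_ ^+ 2) => u; lra.
have gF : `|c n * genop G (F n) z| <= flow_const S I D t * K ^+ d x0 z * F n z.
  rewrite /F /source_flow (genop_flow S_ge1 gen_bound _ _ (c_gt0 n))//.
  exact: (flow_ratio S_ge1 gen_bound I_gt0 I_le1 gen_lbound rD (f0 n) (c_gt0 n) cn1).
move=> v vz; apply: le_trans (neighbour_ratio_le S_ge1 gen_bound I_gt0 I_le1 gen_lbound
   (c_gt0 n) cn1 kK (F_gt0 n) gF vz) _.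
rewrite /Ca [leRHS]mulrAC ler_wpM2r ?invr_ge0 ?(ltW I_gt0)// mulrDl lerD2l.
by rewrite ler_peMr.
Qed.

Let coef1 z := A1 G nu1 pihat t z.
Let coef2 z := A2 G nu1 pihat t z.

Let limit_dissipation z : R := integrand G (V G z) (VV G z) (coef1 z) (coef2 z) z * marginal_limit z.

Let eventually_small (b : R) : 0 < b -> \forall n \near \oo, c n <= b.
Proof.
move=> b0; have := c_cvg0; move/cvgrPdist_le => /(_ b b0).
by apply: filterS => n; rewrite sub0r normrN ger0_norm// ltW.
Qed.

Let marginal_limit_ge0 z : 0 <= marginal_limit z.
Proof.
have h0 : (0 : R) @[n --> \oo] --> (0 : R) by exact: cvg_cst.
apply: (ler_cvg_to h0 (@marginal_cvg z)).
by apply: filterS (eventually_small ltr01) => n /(@marginal_bound n z)[].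
Qed.

(** Where the limit bridge has no mass, the bound from below is enough; elsewhere
    some y is available at which the ratios converge to the coefficients. *)
Let limit_dissipation_lowlim z :
  lowlim (fun n => Q n z * dissipation_rate G (c n) (F n) z) (limit_dissipation z).
Proof.
have Q0 : \forall n \near \oo, 0 <= Q n z.
  by apply: filterS (eventually_small ltr01) => n /(@marginal_bound n z)[].
have [q0|qz] := eqVneq (marginal_limit z) 0.
  rewrite /limit_dissipation q0 mulr0.
  pose C : R := (2 * S) ^+ 2 * (4 * Ca ^+ 2) * (K ^+ 2) ^+ d x0 z.
  have -> : 0 = marginal_limit z * (- C) by rewrite q0 mul0r.
  apply: (lowlimM Q0); first exact: marginal_cvg.
  apply: (@lowlim_le _ (fun=> - C)); last first.
    by apply: lowlim_cvg; exact: cvg_cst.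
  by apply: filterS (eventually_small ltr01) => n; exact: dissipation_rate_lower.
have {qz} : 0 < marginal_limit z by rewrite lt_neqAle eq_sym qz marginal_limit_ge0.
move=> /marginal_limit_gt0[x [y [xr yr pxy xyz]]].
have : Yhat G nu1 pihat z (ysel G nu1 pihat z).
  apply: (@xgetPex _ z (Yhat G nu1 pihat z)); exists y; split; last by exists x.
  by have := yr; rewrite mem_supp_seq.
set y' := ysel G nu1 pihat z => -[ny [w [pw wyz]]].
have sl := source_limit_gt0 pw wyz.
have kp := kappa_gt0 z ny.
rewrite /limit_dissipation [X in lowlim _ X]mulrC; apply: (lowlimM Q0); first exact: marginal_cvg.
rewrite integrandE; apply: dissipation_rate_lowlim => // [v zv|v zv].
  rewrite /coef1 /A1 -/y' (a1E ny zv) (a0E z ny) -mulf_div divff ?gt_eqF// mul1r.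
  have := @source_ratio_cvg z y' v ny sl.
  by move: zv; rewrite -gdist_eq1 => /eqP ->.
rewrite /coef2 /A2 -/y' (a2E ny zv) (a0E z ny) -mulf_div divff ?gt_eqF// mul1r.
by have := @source_ratio_cvg z y' v ny sl; rewrite zv.
Qed.

Let limit_dissipation_out z : z \notin ball_seq G (3 * D) x0 -> limit_dissipation z = 0.
Proof.
move=> zb; rewrite /limit_dissipation (_ : marginal_limit z = 0) ?mulr0//.
rewrite /marginal_limit big_seq big1// => x xr; rewrite big_seq big1// => y yr.
case: ifP => // /eqP dE; exfalso; apply: (negP zb); apply: mem_ball_seq.
have := rD xr; have := rD' yr; have := gdist_triangle G x x0 z.
have := gdist_triangle G x0 x y; rewrite (gdist_sym G x x0) (gdist_sym G x z).
by move: dE; clear; lia.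
Qed.

Variable go : R.
Hypothesis (go_gt0 : 0 < go) (go_le1 : go <= 1).
Hypothesis (go_absum : absum (fun z => go ^+ d x0 z)).

(** Once c is at most go / K^2, the decay of the bridge in the distance beats the
    growth of the dissipation rate, which gives the domination that the Fatou
    lemma requires. *)
Lemma entropy_liminf (Phi : nat -> R -> R) :
  (forall n (s : R), 0 < s < 1 -> Phi n s = csum (fun z =>
     ln (flow G (supp_seq nu0) (f n) (c n) 0 s z) * flow G (supp_seq nu0) (f n) (c n) 0 s z *
     flow G (supp_seq nu1) (g n) (c n) 0 (1 - s) z * m z)) ->
  ((csum limit_dissipation)%:E <= limn_einf (fun n => (derive1n 2 (Phi n) t)%:E))%E /\
  ((csum limit_dissipation)%:E <=
   limn_einf (fun n => (derive1n 2 (fun s : R => Phi n (1 - s)) (1 - t))%:E))%E.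
Proof.
move=> PhiE.
(* c n <= b means that K ^+ 2 * c n is at most go *)
pose b : R := go / K ^+ 2.
have K2 : 1 <= K ^+ 2 by rewrite exprn_ege1.
have K2_gt0 : 0 < K ^+ 2 by exact: lt_le_trans K2.
have b0 : 0 < b by rewrite divr_gt0.
have b1 : b <= 1 by rewrite ler_pdivrMr// mul1r (le_trans go_le1).
pose C0 : R := (2 * S) ^+ 2 * (4 * Ca ^+ 2).
have C0_ge0 : 0 <= C0 by apply: mulr_ge0; [|apply: mulr_ge0]; rewrite ?sqr_ge0.
have tight0 : 0 <= tightness.
  apply: sumr_ge0 => x _; apply: sumr_ge0 => y _.
  have [nu0x _ _] := nu0P.
  by rewrite mulr_ge0 ?divr_ge0 ?(ltW (low_gt0 _ _))// mulr_ge0// expR_ge0.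
pose M z : R := tightness * C0 / b ^+ (3 * D) * go ^+ d x0 z.
have absM : absum M by exact: absumZ.
have derivE n : c n <= b ->
    absum (fun z => Q n z * dissipation_rate G (c n) (F n) z) /\
    derive1n 2 (Phi n) t = csum (fun z => Q n z * dissipation_rate G (c n) (F n) z) /\
    derive1n 2 (fun s : R => Phi n (1 - s)) (1 - t) =
      csum (fun z => Q n z * dissipation_rate G (c n) (F n) z).
  move=> cb; have cn1 := le_trans cb b1.
  have [fp _] := schrodinger_support S_ge1 gen_bound I_gt0 gen_lbound (c_gt0 n) nu0P (sys n).
  have [x1 nx1] := finite_probability_ex nu0P.
  have x1r : x1 \in supp_seq nu0 by rewrite mem_supp_seq.
  have ac : absum (fun z => (K ^+ 2 * c n) ^+ d x0 z).
    apply: absum_le go_absum => z; rewrite normrX lerXn2r ?nnegrE ?(ltW go_gt0)//.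
    have kc : 0 <= K ^+ 2 * c n by rewrite mulr_ge0 ?ltW.
    by rewrite ger0_norm// mulrC -ler_pdivlMr.
  have -> : (fun z => Q n z * dissipation_rate G (c n) (F n) z) =
      (fun z => m z * F n z * H n z * dissipation_rate G (c n) (F n) z).
    by apply/funext => z; rewrite bridge_marginalE.
  exact: (entropy_second_derivative S_ge1 gen_bound I_gt0 I_le1 gen_lbound rD rD'
    (f0 n) (g0 n) x1r (fp _ nx1) (c_gt0 n) cn1 ac (PhiE n) t01).
have lim : lowlim (fun n => csum (fun z => Q n z * dissipation_rate G (c n) (F n) z)) (csum limit_dissipation).
  apply: (@fatou_csum _ _ (fun n z => Q n z * dissipation_rate G (c n) (F n) z) _ M _ _ _ _
    limit_dissipation_lowlim) => //.
  - exact: absum_seq limit_dissipation_out.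
  - by apply: filterS (eventually_small b0) => n /derivE[].
  apply: filterS (eventually_small b0) => n cb z; have cn1 := le_trans cb b1.
  have [Qn0 Qn1] := marginal_bound z cn1.
  have K0 : 0 <= C0 * (K ^+ 2) ^+ d x0 z by rewrite mulr_ge0// exprn_ge0// ltW.
  apply: (@le_trans _ _ (Q n z * - (C0 * (K ^+ 2) ^+ d x0 z))); last first.
    by rewrite ler_wpM2l// dissipation_rate_lower.
  rewrite mulrN lerN2; apply: (@le_trans _ _
    (tightness * (b ^+ d x0 z / b ^+ (3 * D)) * (C0 * (K ^+ 2) ^+ d x0 z))).
    rewrite ler_wpM2r//; apply: le_trans Qn1 _; rewrite ler_wpM2l//.
    rewrite ler_pdivlMr ?exprn_gt0//.
    apply: (@le_trans _ _ (b ^+ (d x0 z - 3 * D) * b ^+ (3 * D))).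
      rewrite ler_wpM2r ?exprn_ge0 ?(ltW b0)// lerXn2r// nnegrE ltW//.
    rewrite -exprD; apply: ler_wiXn2l => //; first exact: ltW.
    by clear; lia.
  rewrite /M /b exprMn; set B' := (go / _) ^+ _; set e' := go ^+ _.
  rewrite [(_^-1) ^+ _]exprVn; set k' := (K ^+ 2) ^+ _.
  have k0 : k' != 0 by rewrite expf_neq0// gt_eqF.
  have B0 : B' != 0 by rewrite expf_neq0// gt_eqF.
  rewrite le_eqVlt; apply/orP; left; apply/eqP; field.
  by rewrite k0 B0.
by split; apply: lowlim_limn_einf; apply: lowlim_le lim;
  apply: filterS (eventually_small b0) => n /derivE[_ [h1 h2]];
  rewrite ?h1 ?h2.
Qed.

End Tightness.

End Limit.

(** * The entropy inequality *)

Section EntropyBound.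
Context (R : realType) (X : countType) (G : graph_space R X) (S I : R).
Local Notation e := (adj G).
Local Notation d := (gdist G).
Local Notation L := (gen G).
Hypothesis (S_ge1 : 1 <= S) (gen_bound : forall x, `|L x x| <= S).
Hypothesis (I_gt0 : 0 < I) (I_le1 : I <= 1).
Hypothesis (gen_lbound : forall x y, e x y -> I <= L x y).
Hypothesis (dist_summable : forall x, exists gamma_o : R,
  0 < gamma_o <= 1 /\ (\esum_(y in [set: X]) (gamma_o ^+ d x y)%:E < +oo)%E).
Variables (nu0 nu1 : X -> R).
Hypothesis (nu0P : finite_probability nu0) (nu1P : finite_probability nu1).
Variables (c : nat -> R) (f g : nat -> X -> R).
Hypothesis (c_gt0 : forall n, 0 < c n) (c_cvg0 : c n @[n --> \oo] --> (0 : R)).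
Hypothesis (sys : forall n, schrodinger_system G nu0 nu1 (c n) (f n) (g n)).
Variable (pihat : X -> X -> R).
Hypothesis (pihat_lim : forall x y,
  bridge_coupling G (c n) (f n) (g n) x y @[n --> \oo] --> pihat x y).
Variables (t : R).
Hypothesis (t01 : 0 < t < 1).
Variable (q : X -> R).
Hypothesis (q_lim : weak_cvg (fun n => bridge_marginal G (c n) (f n) (g n) t) q).

Let pihat0 x y : 0 <= pihat x y.
Proof. exact: (pihat_ge0 S_ge1 gen_bound I_gt0 gen_lbound c_gt0 sys pihat_lim). Qed.

Lemma phi_flow n (s : R) : 0 < s < 1 -> phi G (c n) (f n) (g n) s = csum (fun z =>
  ln (flow G (supp_seq nu0) (f n) (c n) 0 s z) * flow G (supp_seq nu0) (f n) (c n) 0 s z *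
  flow G (supp_seq nu1) (g n) (c n) 0 (1 - s) z * mass G z).
Proof.
move=> /andP[s0 s1]; have cn := c_gt0 n.
have [f0 g0 _ _] := sys n.
have [_ fr] := schrodinger_support S_ge1 gen_bound I_gt0 gen_lbound cn nu0P (sys n).
have [_ gr] := schrodinger_support S_ge1 gen_bound I_gt0 gen_lbound cn nu1P
  (schrodinger_sym (sys n)).
have cs : 0 < c n * s by exact: mulr_gt0.
have cs' : 0 < c n * (1 - s) by rewrite mulr_gt0// subr_gt0.
apply: eq_csum => z.
rewrite (semigroup_flow S_ge1 gen_bound I_gt0 gen_lbound z cs (supp_seq_uniq nu0) f0 fr).
by rewrite (semigroup_flow S_ge1 gen_bound I_gt0 gen_lbound z cs' (supp_seq_uniq nu1) g0 gr).
Qed.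

Let IA := csum (fun z => integrand G (V G z) (VV G z)
  (A1 G nu1 pihat t z) (A2 G nu1 pihat t z) z * q z).

Lemma entropy_lower_bound :
  (IA%:E <= limn_einf (fun n => (derive1n 2 (phi G (c n) (f n) (g n)) t)%:E))%E /\
  (IA%:E <= limn_einf (fun n =>
    (derive1n 2 (fun s : R => phi G (c n) (f n) (g n) (1 - s)) (1 - t))%:E))%E.
Proof.
have [x0 _] := finite_probability_ex nu0P.
pose D := (\max_(x <- supp_seq nu0 ++ supp_seq nu1) d x0 x)%N.
have rD x : x \in supp_seq nu0 ++ supp_seq nu1 -> (d x0 x <= D)%N.
  by move=> xr; rewrite /D (big_rem x)//= leq_maxl.
have rD0 x : x \in supp_seq nu0 -> (d x0 x <= D)%N.
  by move=> xr; apply: rD; rewrite mem_cat xr.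
have rD1 x : x \in supp_seq nu1 -> (d x0 x <= D)%N.
  by move=> xr; apply: rD; rewrite mem_cat xr orbT.
have [go [/andP[go0 go1] gosum]] := dist_summable x0.
have go_absum : absum (fun z => go ^+ d x0 z).
  rewrite /absum; under eq_esum do rewrite ger0_norm ?exprn_ge0 ?(ltW go0)//.
  exact: gosum.
rewrite /IA.
rewrite (_ : (fun z => _ * q z) = (fun z => integrand G (V G z) (VV G z)
    (A1 G nu1 pihat t z) (A2 G nu1 pihat t z) z * marginal_limit G nu0 nu1 pihat t z)).
  exact: (entropy_liminf S_ge1 gen_bound I_gt0 I_le1 gen_lbound nu0P nu1P c_gt0 c_cvg0
    sys pihat_lim t01 rD0 rD1 go0 go1 go_absum phi_flow).
apply/funext => z; congr (_ * _).
exact: (weak_limitE S_ge1 gen_bound I_gt0 gen_lbound nu0P nu1P c_gt0 c_cvg0 sys pihat_lim t01).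
Qed.

Lemma between2_sym x y z w : between2 G x y z w <-> between2 G y x w z.
Proof.
suff h a b u v : between2 G a b u v -> between2 G b a v u by split; exact: h.
move=> /between2P[uv dE]; apply/between2P; rewrite eq_sym; split=> //.
by rewrite (gdist_sym G b v) (gdist_sym G v u) (gdist_sym G u a) (gdist_sym G b a);
  move: dE; clear; lia.
Qed.

Let C_bwd_of y w z v : z != v -> between2 G y w z v -> ~ C_bwd G pihat z v ->
  kernel_bwd nu1 pihat w y = 0.
Proof.
move=> zv /between2_sym wy nC; rewrite /kernel_bwd.
have [->|p0] := eqVneq (pihat w y) 0; first by rewrite mul0r.
exfalso; apply: nC; split; first by rewrite eq_sym.
by exists w, y; split=> //; rewrite lt_neqAle eq_sym p0 pihat0.
Qed.

Let a1_out z v y : V G z v -> ~ V_bwd G pihat z v -> a1 G nu1 pihat t z v y = 0.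
Proof.
move=> zv nv; have zNv : z != v by apply/eqP => h; move: zv; rewrite /V/= h adj_irr.
rewrite /a1 fsbig1// => w bw; rewrite (C_bwd_of zNv bw) ?mulr0// => C.
by apply: nv.
Qed.

Let a2_out z v y : VV G z v -> ~ VV_bwd G pihat z v -> a2 G nu1 pihat t z v y = 0.
Proof.
move=> zv nv; have zNv : z != v.
  by apply/eqP => h; move: zv; rewrite /VV/= h gdistxx.
rewrite /a2 fsbig1// => w bw; rewrite (C_bwd_of zNv bw) ?mulr0// => C.
by apply: nv.
Qed.

(** A nonzero term of the coefficient at (z, v) has a w with pihat w y > 0 and
    (z, v) on a geodesic from y to w, which says that (v, z) is in C_fwd.  Off
    these pairs the coefficients, hence the terms in rho, are zero. *)
Lemma integrand_bwd z :
  integrand G (V_bwd G pihat z) (VV_bwd G pihat z)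
    (A1 G nu1 pihat t z) (A2 G nu1 pihat t z) z =
  integrand G (V G z) (VV G z) (A1 G nu1 pihat t z) (A2 G nu1 pihat t z) z.
Proof.
have A1_out v : V G z v -> ~ V_bwd G pihat z v -> A1 G nu1 pihat t z v = 0.
  by move=> h h'; rewrite /A1 a1_out ?mul0r.
have A2_out v : VV G z v -> ~ VV_bwd G pihat z v -> A2 G nu1 pihat t z v = 0.
  by move=> h h'; rewrite /A2 a2_out ?mul0r.
have sub1 : V_bwd G pihat z `<=` V G z by move=> v [].
rewrite /integrand; congr (_ ^+ 2 + _).
  by apply: fsbig_widen => // v [zv nv]; rewrite /= A1_out ?mul0r.
have inner v : \sum_(w \in [set w | VV_bwd G pihat z w /\ e v w])
     rho (A1 G nu1 pihat t z v) (A2 G nu1 pihat t z w) * L v w * L z v =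
   \sum_(w \in [set w | VV G z w /\ e v w])
     rho (A1 G nu1 pihat t z v) (A2 G nu1 pihat t z w) * L v w * L z v.
  apply: fsbig_widen => [w [[]]//|w [[zw vw] nw]]; rewrite /= A2_out//.
    by rewrite /rho ltxx andbF !mul0r.
  by move=> bw; apply: nw.
under eq_fsbigr do rewrite inner.
apply: fsbig_widen => // v [zv nv]; rewrite /= fsbig1// => w _.
by rewrite A1_out// /rho ltxx !mul0r.
Qed.

End EntropyBound.

(** * Time reversal of the coefficients *)

Section TimeReversal.
Context (R : realType) (X : countType) (G : graph_space R X).
Local Notation d := (gdist G).
Local Notation m := (mass G).
Variables (nu : X -> R) (pihat : X -> X -> R) (t : R).

Let pihatT x y := pihat y x.

Lemma between_sym x y z : between G x y z <-> between G y x z.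
Proof.
suff h a b : between G a b z -> between G b a z by split; exact: h.
move=> /betweenP dE; apply/betweenP.
by rewrite (gdist_sym G b z) (gdist_sym G z a) (gdist_sym G b a) -dE addnC.
Qed.

Lemma psi_phi c f g : psi G c f g = (fun s : R => phi G c g f (1 - s)).
Proof. by apply/funext => s; rewrite /psi /phi subKr. Qed.

Lemma bridge_marginal_rev c f g :
  bridge_marginal G c f g t = bridge_marginal G c g f (1 - t).
Proof. by apply/funext => z; rewrite /bridge_marginal subKr mulrAC. Qed.

Lemma binmass_rev (n k l : nat) : (k + l)%N = n -> binmass t n k = binmass (1 - t) n l.
Proof.
move=> <-; rewrite /binmass subKr addnK addKn -[in RHS]bin_sub ?leq_addl// addnK.
by rewrite mulrAC.
Qed.

Lemma Xhat_Yhat z : Xhat G nu pihat z = Yhat G nu pihatT z.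
Proof.
by apply/seteqP; split => x [nx [y [pxy bxy]]]; split=> //; exists y; split=> //;
  exact/between_sym.
Qed.

Lemma C_fwd_bwd z w : C_fwd G pihat z w <-> C_bwd G pihatT z w.
Proof.
by split=> -[zw [x [y [pxy bxy]]]]; (split; first by rewrite eq_sym);
  exists y, x; split=> //; exact/between2_sym.
Qed.

Lemma V_fwd_bwd z : V_fwd G pihat z = V_bwd G pihatT z.
Proof. by apply/seteqP; split=> v [zv /C_fwd_bwd]. Qed.

Lemma VV_fwd_bwd z : VV_fwd G pihat z = VV_bwd G pihatT z.
Proof. by apply/seteqP; split=> v [zv /C_fwd_bwd]. Qed.

Lemma b0_a0 z x : b0 G nu pihat t z x = a0 G nu pihatT (1 - t) z x.
Proof.
rewrite /b0 /a0; apply: eq_fsbigr => w _; congr (_ * _); rewrite /Qxy.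
have [bw|bw] := asboolP (between G x w z); last first.
  by rewrite asboolF// => /between_sym.
rewrite asboolT; last exact/between_sym.
move/betweenP: bw => dE; rewrite -rratio_rev (gdist_sym G w x) (gdist_sym G w z).
by rewrite (binmass_rev dE).
Qed.

Lemma b1_a1 z v x : b1 G nu pihat t z v x = a1 G nu pihatT (1 - t) z v x.
Proof.
rewrite /b1 /a1; apply: eq_fsbigr => w /set_mem/between2P[zv dE].
congr (_ * _ * _); apply: binmass_rev.
have := gdist_triangle G v z w; have : (0 < d z v)%N by rewrite lt0n gdist_eq0.
have := gdist_triangle G z x w; move: dE; clear; lia.
Qed.

Lemma b2_a2 z v x : d z v = 2%N -> b2 G nu pihat t z v x = a2 G nu pihatT (1 - t) z v x.
Proof.
move=> zv2; rewrite /b2 /a2; apply: eq_fsbigr => w /set_mem/between2P[zv dE].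
congr (_ * _ * _); apply: binmass_rev.
have := gdist_triangle G v z w; move: zv2.
have := gdist_triangle G z x w; move: dE; clear; lia.
Qed.

Lemma xsel_ysel z : xsel G nu pihat z = ysel G nu pihatT z.
Proof. by rewrite /xsel /ysel Xhat_Yhat. Qed.

Lemma B1_A1 z v : B1 G nu pihat t z v = A1 G nu pihatT (1 - t) z v.
Proof. by rewrite /B1 /A1 b1_a1 b0_a0 xsel_ysel. Qed.

Lemma B2_A2 z v : d z v = 2%N -> B2 G nu pihat t z v = A2 G nu pihatT (1 - t) z v.
Proof. by move=> zv; rewrite /B2 /A2 b2_a2// b0_a0 xsel_ysel. Qed.

End TimeReversal.

(** * The two inequalities *)

Lemma eq_integrand (R : realType) (X : countType) (G : graph_space R X)
    (W WW : set X) (K1 K2 K1' K2' : X -> R) z :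
  (forall v, W v -> K1 v = K1' v) -> (forall v, WW v -> K2 v = K2' v) ->
  integrand G W WW K1 K2 z = integrand G W WW K1' K2' z.
Proof.
move=> h1 h2; rewrite /integrand; congr (_ ^+ 2 + _).
  by apply: eq_fsbigr => v /set_mem/h1 ->.
apply: eq_fsbigr => v /set_mem Wv; apply: eq_fsbigr => w /set_mem[Ww _].
by rewrite h1// h2.
Qed.

Theorem theorem3p5 (R : realType) (X : countType) (G : graph_space R X)
  (nu0 nu1 : X -> R)
  (nu0_prob : finite_probability nu0) (nu1_prob : finite_probability nu1)
  (S : R) (S_ge1 : 1 <= S) (gen_bound : forall x, `|gen G x x| <= S)
  (I : R) (I_gt0 : 0 < I) (I_le1 : I <= 1)
  (gen_lbound : forall x y, adj G x y -> I <= gen G x y)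
  (dist_summable : forall x, exists gamma_o : R,
     0 < gamma_o <= 1 /\
     (\esum_(y in [set: X]) (gamma_o ^+ gdist G x y)%:E < +oo)%E)
  (f g : R -> X -> R)
  (fg_solution : forall gamma : R, 0 < gamma ->
     schrodinger_system G nu0 nu1 gamma (f gamma) (g gamma))
  (gamma_ : nat -> R) (gamma_gt0 : forall l, 0 < gamma_ l)
  (gamma_cvg0 : gamma_ l @[l --> \oo] --> (0 : R))
  (pihat : X -> X -> R)
  (pihat_lim : forall x y,
     bridge_coupling G (gamma_ l) (f (gamma_ l)) (g (gamma_ l)) x y
       @[l --> \oo] --> pihat x y)
  (Qhat : R -> X -> R)
  (Qhat_lim : forall t : R, 0 < t < 1 ->
     weak_cvg
       (fun l => bridge_marginal G (gamma_ l) (f (gamma_ l)) (g (gamma_ l)) t)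
       (Qhat t))
  (t : R) (t01 : 0 < t < 1) :
  let A z z' := A1 G nu1 pihat t z z' in
  let AA z z'' := A2 G nu1 pihat t z z'' in
  let B z z' := B1 G nu0 pihat t z z' in
  let BB z z'' := B2 G nu0 pihat t z z'' in
  let phi'' (l : nat) : R :=
    derive1n 2 (phi G (gamma_ l) (f (gamma_ l)) (g (gamma_ l))) t in
  let psi'' (l : nat) : R :=
    derive1n 2 (psi G (gamma_ l) (f (gamma_ l)) (g (gamma_ l))) t in
  let IAbwd := csum (fun z =>
    integrand G (V_bwd G pihat z) (VV_bwd G pihat z) (A z) (AA z) z * Qhat t z) in
  let IA := csum (fun z =>
    integrand G (V G z) (VV G z) (A z) (AA z) z * Qhat t z) in
  let IBfwd := csum (fun z =>
    integrand G (V_fwd G pihat z) (VV_fwd G pihat z) (B z) (BB z) z * Qhat t z) in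
  let IB := csum (fun z =>
    integrand G (V G z) (VV G z) (B z) (BB z) z * Qhat t z) in
  [/\ (IAbwd%:E <= limn_einf (fun l => (phi'' l)%:E))%E,
      IAbwd = IA,
      (IBfwd%:E <= limn_einf (fun l => (psi'' l)%:E))%E &
      IBfwd = IB].
Proof.
move=> A AA B BB phi'' psi'' IAbwd IA IBfwd IB.
have gamma_ge0 l : 0 <= gamma_ l by exact: ltW.
have sys l := @fg_solution _ (gamma_gt0 l).
pose pihatT x y := pihat y x.
have pihatT_lim x y : bridge_coupling G (gamma_ l) (g (gamma_ l)) (f (gamma_ l)) x y
    @[l --> \oo] --> pihatT x y.
  have := @pihat_lim y x.
  by under eq_fun do rewrite (bridge_coupling_sym S_ge1 gen_bound _ _ _ _ (gamma_ge0 _)).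
have t01' : 0 < 1 - t < 1 by case/andP: t01 => t0 t1; rewrite subr_gt0 t1 ltrBlDr ltrDl.
have Q_lim' : weak_cvg (fun l => bridge_marginal G (gamma_ l) (g (gamma_ l))
    (f (gamma_ l)) (1 - t)) (Qhat t).
  have := @Qhat_lim _ t01.
  by under eq_fun do rewrite bridge_marginal_rev.
have [phi_le _] := entropy_lower_bound S_ge1 gen_bound I_gt0 I_le1 gen_lbound
  dist_summable nu0_prob nu1_prob gamma_gt0 gamma_cvg0 sys pihat_lim t01 (@Qhat_lim _ t01).
have [_ psi_le] := entropy_lower_bound S_ge1 gen_bound I_gt0 I_le1 gen_lbound
  dist_summable nu1_prob nu0_prob gamma_gt0 gamma_cvg0 (fun l => schrodinger_sym (sys l))
  pihatT_lim t01' Q_lim'.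
have IAE : IAbwd = IA.
  apply: eq_csum => z; congr (_ * _).
  exact: (integrand_bwd S_ge1 gen_bound I_gt0 gen_lbound gamma_gt0 sys pihat_lim t z).
have BE (U W : set X) (z : X) : W `<=` VV G z -> integrand G U W (B z) (BB z) z =
    integrand G U W (A1 G nu0 pihatT (1 - t) z) (A2 G nu0 pihatT (1 - t) z) z.
  move=> WV.
  apply: eq_integrand => v.
    move=> _.
    exact: (B1_A1 G nu0 pihat t z v).
  move=> /WV zv.
  exact: (B2_A2 nu0 pihat t zv).
have IBE : IB = csum (fun z => integrand G (V G z) (VV G z)
    (A1 G nu0 pihatT (1 - t) z) (A2 G nu0 pihatT (1 - t) z) z * Qhat t z).
  by apply: eq_csum => z; rewrite BE.
have IBE' : IBfwd = IB.
  rewrite IBE; apply: eq_csum => z; congr (_ * _).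
  rewrite BE; last by move=> v [].
  rewrite V_fwd_bwd VV_fwd_bwd.
  exact: (integrand_bwd S_ge1 gen_bound I_gt0 gen_lbound gamma_gt0
    (fun l => schrodinger_sym (sys l)) pihatT_lim (1 - t) z).
split; [rewrite IAE; exact: phi_le|exact: IAE| |exact: IBE'].
rewrite IBE' IBE; move: psi_le; rewrite subKr => psi_le.
have psiE l : psi'' l = derive1n 2 (fun s : R =>
    phi G (gamma_ l) (g (gamma_ l)) (f (gamma_ l)) (1 - s)) t.
  by rewrite /psi'' psi_phi.
rewrite (_ : (fun l => (psi'' l)%:E) = (fun l => (derive1n 2 (fun s : R =>
  phi G (gamma_ l) (g (gamma_ l)) (f (gamma_ l)) (1 - s)) t)%:E)); first exact: psi_le.
by apply/funext => l; rewrite psiE.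
Qed.
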